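(* Let $\{\varphi_l:1\le l\le N\}\subset L^2(K)$ be such that $\{\varphi_l(\cdot-u(k)):1\le l\le N,\ k\in\mathbb{N}_0\}$ is a frame for its closed linear span $V_0$, with frame bounds $C_1$ and $C_2$. For $0\le r\le q-1$ and $1\le l,j\le N$ let $\{h^r_{ljk}:k\in\mathbb{N}_0\}\in\ell^2(\mathbb{N}_0)$, and let $H_r(\xi)$ and $H(\xi)$ be the associated matrices of order $N$ and $qN$. Let $\lambda=\inf_\xi\lambda(\xi)$ and $\Lambda=\sup_\xi\Lambda(\xi)$, where $\lambda(\xi)$ and $\Lambda(\xi)$ are respectively the minimal and maximal eigenvalues of $H^*(\xi)H(\xi)$. Assume that all entries of $H(\xi)$ are bounded measurable functions such that $0<\lambda\le\Lambda<\infty$. Let $\{\psi^n_l:n\ge0,\ 1\le l\le N\}$ be the wavelet frame packets and let $V_j=\{f\in L^2(K):f(\mathfrak{p}^j\cdot)\in V_0\}$. Then for all $j\ge0$ the system of functions $$\{\psi^n_l(\cdot-u(k)):0\le n\le q^j-1,\ 1\le l\le N,\ k\in\mathbb{N}_0\}$$ is a frame of $V_j$ with frame bounds $\lambda^jC_1$ and $\Lambda^jC_2$.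
   Context: $K$ is a local field (a nondiscrete, totally disconnected, locally compact topological field) of characteristic $p>0$. Let $dx$ be Haar measure on the additive group $K^+$ and $|\cdot|$ the absolute value given by $d(\alpha x)=|\alpha|\,dx$ for $\alpha\ne0$, $|0|=0$. Put $\mathfrak{D}=\{x:|x|\le1\}$, $\mathfrak{P}=\{x:|x|<1\}$, $\mathfrak{D}^*=\mathfrak{D}\setminus\mathfrak{P}$; $dx$ is normalized so that $\mathfrak{D}$ has measure $1$. $\mathfrak{p}$ is a fixed element of $\mathfrak{P}$ of maximal absolute value (a prime element), $\mathfrak{D}/\mathfrak{P}\cong GF(q)$ with $q=p^c$, and $|\mathfrak{p}|=q^{-1}$. $\mathbb{N}_0=\{0,1,2,\dots\}$. Choose $\{1=\epsilon_0,\epsilon_1,\dots,\epsilon_{c-1}\}\subset\mathfrak{D}^*$ such that $\mathrm{span}\{\epsilon_j\}_{j=0}^{c-1}\cong GF(q)$, the span being over $GF(p)$. For $0\le n<q$ with $n=a_0+a_1p+\cdots+a_{c-1}p^{c-1}$, $0\le a_k<p$, put $u(n)=(a_0+a_1\epsilon_1+\cdots+a_{c-1}\epsilon_{c-1})\mathfrak{p}^{-1}$; for general $n\in\mathbb{N}_0$ with $n=b_0+b_1q+\cdots+b_sq^s$, $0\le b_k<q$, put $u(n)=u(b_0)+u(b_1)\mathfrak{p}^{-1}+\cdots+u(b_s)\mathfrak{p}^{-s}$. Then $\{u(n)\}_{n\ge0}$ is a complete list of distinct coset representatives of $\mathfrak{D}$ in $K^+$. $\chi$ is the continuous unitary character of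 $K^+$ with $\chi(\epsilon_\mu\mathfrak{p}^{-j})=\exp(2\pi i/p)$ if $\mu=0$ and $j=1$, and $\chi(\epsilon_\mu\mathfrak{p}^{-j})=1$ if $\mu\in\{1,\dots,c-1\}$ or $j\ne1$; it is trivial on $\mathfrak{D}$ and nontrivial on $\mathfrak{p}^{-1}\mathfrak{D}$. Put $\chi_k(\xi)=\chi(u(k)\xi)$ for $k\in\mathbb{N}_0$. Frames: a countable family $\{x_k\}$ in a separable Hilbert space $\mathcal{H}$ is a frame for $\mathcal{H}$ if there are constants $0<C_1\le C_2<\infty$ with $C_1\|x\|^2\le\sum_k|\langle x,x_k\rangle|^2\le C_2\|x\|^2$ for all $x\in\mathcal{H}$. The largest $C_1$ and the smallest $C_2$ for which this holds are called the frame bounds. Matrices: $h^r_{lj}(\xi)=\sum_{k\in\mathbb{N}_0}q^{-1/2}h^r_{ljk}\overline{\chi_k(\xi)}$, $H_r(\xi)=\bigl(h^r_{lj}(\xi)\bigr)_{1\le l,j\le N}$, and $H(\xi)=\bigl(H_r(\xi+\mathfrak{p}u(s))\bigr)_{0\le r,s\le q-1}$ is the block matrix of order $qN$ whose $(r,s)$ block is $H_r(\xi+\mathfrak{p}u(s))$. The infimum and supremum over $\xi$ are understood up to null sets. Wavelet frame packets: starting with $\varphi_1,\dots,\varphi_N$, put, for $0\le s\le q-1$ and $1\le l\le N$, $$\psi^s_l(x)=q^{1/2}\sum_{j=1}^N\sum_{k\in\mathbb{N}_0}h^s_{ljk}\,\varphi_j(\mathfrak{p}^{-1}x-u(k)).$$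 Then $\psi^n_l$ is defined for every integer $n\ge0$ and $1\le l\le N$ recursively: supposing that $\psi^r_l$ is already defined for $r\in\mathbb{N}_0$ and $1\le l\le N$, for $0\le s\le q-1$ and $1\le l\le N$ define $$\psi^{s+qr}_l(x)=\sum_{j=1}^N\sum_{k\in\mathbb{N}_0}h^s_{ljk}\,q^{1/2}\,\psi^r_j(\mathfrak{p}^{-1}x-u(k)).$$
   Formalization: ''Frame bounds'' here means constants for which the two frame inequalities hold, not the largest C1 and smallest C2: with optimal constants the claim fails, since λ^jC1 and Λ^jC2 need not be optimal for the packet system. *)

(* Defs.v *)
From HB Require Import structures.
From mathcomp Require Import all_boot all_order all_algebra.
From mathcomp Require Import complex.
From mathcomp Require Import all_classical all_reals all_analysis.

Set Implicit Arguments.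
Unset Strict Implicit.
Unset Printing Implicit Defensive.

Import Order.TTheory GRing.Theory Num.Theory.
Import numFieldNormedType.Exports.

Local Open Scope classical_set_scope.
Local Open Scope ring_scope.
Local Open Scope complex_scope.

HB.mixin Record TopologicalZmodule_isTopologicalField K
    of TopologicalZmodule K & GRing.Field K := {
  mul_continuous : continuous (fun x : K * K => x.1 * x.2) ;
  inv_continuous : forall x : K, x != 0 -> {for x, continuous (@GRing.inv K)}
}.

#[short(type="topologicalFieldType")]
HB.structure Definition TopologicalField :=
  {K of TopologicalZmodule K & GRing.Field K
        & TopologicalZmodule_isTopologicalField K}.

Record local_field (K : topologicalFieldType) : Prop := LocalField {
  lf_nondiscrete : ~ (forall A : set K, open A) ;
  lf_totally_disconnected : totally_disconnected [set: K] ;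
  lf_locally_compact : locally_compact [set: K]
}.

(* Measurable spaces are pointed in the library; 0 is used as the point. *)
Definition pointed_copy (K : topologicalFieldType) : Type := K.
HB.instance Definition _ (K : topologicalFieldType) :=
  Choice.on (pointed_copy K).
HB.instance Definition _ (K : topologicalFieldType) :=
  isPointed.Build (pointed_copy K) (0 : K).

(* K with its Borel sigma-algebra; convertible to K. *)
Definition borel (K : topologicalFieldType) :=
  @g_sigma_algebraType (pointed_copy K) (@open K).
HB.instance Definition _ (K : topologicalFieldType) := Measurable.on (borel K).

Section Haar.
Context {R : realType} {K : topologicalFieldType}.
Variable mu : {measure set (borel K) -> \bar R}.

(* A local field is second countable, so that regularity is automatic. *)
Record haar_measure : Prop := HaarMeasure {
  haar_translate : forall (a : K) (A : set (borel K)), measurable A ->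
    mu [set a + x | x in (A : set K)] = mu A ;
  haar_compact : forall A : set K, compact A -> (mu A < +oo)%E ;
  haar_open : forall A : set K, open A -> A !=set0 -> (0 < mu A)%E
}.

(* abs is the module of K: d(a x) = |a| dx *)
Record modulus (abs : K -> R) : Prop := Modulus {
  modulus0 : abs 0 = 0 ;
  modulus_scale : forall (a : K) (A : set (borel K)), a != 0 -> measurable A ->
    mu [set a * x | x in (A : set K)] = ((abs a)%:E * mu A)%E
}.

End Haar.

Section Arithmetic.
Context {R : realType} {K : topologicalFieldType}.
Variable abs : K -> R.

Definition integers : set K := [set x | abs x <= 1].
Definition max_ideal : set K := [set x | abs x < 1].
Definition integer_units : set K := integers `\` max_ideal.

Definition prime_element (varpi : K) : Prop :=
  max_ideal varpi /\ forall x, max_ideal x -> abs x <= abs varpi.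

(* The quotient of the integers by the maximal ideal is a field with q
   elements; f is the reduction map, its values outside the integers being
   irrelevant. *)
Definition residue_field_card (q : nat) : Prop :=
  exists (F : finFieldType) (f : K -> F), #|F| = q /\
    [/\ f 1 = 1,
        forall x y, integers x -> integers y ->
          f (x + y) = f x + f y /\ f (x * y) = f x * f y,
        forall z : F, exists2 x, integers x & f x = z
      & forall x, integers x -> (f x = 0 <-> max_ideal x)].

(* As K has characteristic p, integral combinations are combinations over the
   prime field. *)
Definition prime_span (c : nat) (eps : 'I_c -> K) : set K :=
  [set x | exists a : 'I_c -> nat, x = \sum_(i < c) eps i *+ a i].

(* The span is isomorphic to GF(q) as a field. *)
Definition residue_basis (q c : nat) (eps : 'I_c -> K) : Prop :=
  [/\ forall i : 'I_c, i = 0%N :> nat -> eps i = 1,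
      forall i, integer_units (eps i)
    & exists (F : finFieldType) (f : {rmorphism F -> K}),
        #|F| = q /\ range f = prime_span eps].

Variables (p c : nat) (varpi : K) (eps : 'I_c -> K).

Definition digit (b n k : nat) : nat := (n %/ b ^ k) %% b.

Definition coset_rep0 (n : nat) : K :=
  (\sum_(i < c) eps i *+ digit p n i) * varpi^-1.

(* For p ^ c > 1, all the base p ^ c digits of n of index > n vanish. *)
Definition coset_rep (n : nat) : K :=
  \sum_(k < n.+1) coset_rep0 (digit (p ^ c) n k) * varpi ^- k.

Record standard_character (chi : K -> R[i]) : Prop := StandardCharacter {
  char_continuous : continuous (chi : K -> (R[i])^o) ;
  charD : forall x y, chi (x + y) = chi x * chi y ;
  char_unitary : forall x, `|chi x| = 1 ;
  char_value : forall (m : 'I_c) (j : int),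
    chi (eps m * varpi ^ (- j)) =
      if (m == 0%N :> nat) && (j == 1)
      then (cos (2 * pi / p%:R)) +i* (sin (2 * pi / p%:R))
      else 1
}.

End Arithmetic.

Section L2.
Context {R : realType} {d : measure_display} {T : measurableType d}.
Variable mu : {measure set T -> \bar R}.
Implicit Types (f g : T -> R[i]) (D : set T).

Definition complex_measurable f : Prop :=
  measurable_fun [set: T] (fun x => complex.Re (f x)) /\
  measurable_fun [set: T] (fun x => complex.Im (f x)).

Definition complex_integral D f : R[i] :=
  (\int[mu]_(x in D) complex.Re (f x)) +i* (\int[mu]_(x in D) complex.Im (f x)).

Definition sqnorm_on D f : \bar R :=
  (\int[mu]_(x in D) ((Normc.normc (f x)) ^+ 2)%:E)%E.
Definition sqnorm f : \bar R := sqnorm_on [set: T] f.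

(* Elements of L^2 are represented by functions, up to equality a.e. *)
Definition square_integrable : set (T -> R[i]) :=
  [set f | complex_measurable f /\ (sqnorm f < +oo)%E].

Definition inner f g : R[i] :=
  complex_integral [set: T] (fun x => f x * (g x)^*).

Definition L2_cvg_on D (F : nat -> T -> R[i]) f : Prop :=
  (fun n => sqnorm_on D (fun x => F n x - f x)) @ \oo --> 0%E.

Section Families.
Context {I : choiceType}.
Variable x : I -> T -> R[i].

Definition linear_span : set (T -> R[i]) :=
  [set g | exists s : seq (R[i] * I),
     g = fun t => \sum_(a <- s) a.1 * x a.2 t].

Definition closed_linear_span : set (T -> R[i]) :=
  [set f | square_integrable f /\
     forall e : R, 0 < e -> exists2 g, linear_span g &
       (sqnorm (fun t => f t - g t)%R < e%:E)%E].

(* Constants satisfying the frame inequalities; they need not be optimal. *)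
Definition frame_with_bounds (V : set (T -> R[i])) (C1 C2 : R) : Prop :=
  [/\ forall i, V (x i),
      0 < C1 <= C2
    & forall f, V f ->
        (C1%:E * sqnorm f <=
           \esum_(i in [set: I]) ((Normc.normc (inner f (x i))) ^+ 2)%:E)%E /\
        (\esum_(i in [set: I]) ((Normc.normc (inner f (x i))) ^+ 2)%:E
           <= C2%:E * sqnorm f)%E].

End Families.
End L2.

Section Eigenvalues.
Context {R : realType} {n : nat}.
Implicit Type A : 'M[R[i]]_n.

(* For Hermitian A and n > 0 all the eigenvalues are real, and these infimum
   and supremum of a finite nonempty set are a minimum and a maximum. *)
Definition min_eigenvalue A : R := inf [set a : R | eigenvalue A a%:C].
Definition max_eigenvalue A : R := sup [set a : R | eigenvalue A a%:C].

End Eigenvalues.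

Section Packets.
Context {R : realType} {K : topologicalFieldType}.
Variable mu : {measure set (borel K) -> \bar R}.
Variables (p c : nat) (varpi : K) (eps : 'I_c -> K).
Local Notation q := (p ^ c)%N.
Local Notation u := (coset_rep p varpi eps).
Variable N : nat.

Definition translates (I : Type) (f : I -> K -> R[i]) :
    I * nat -> borel K -> R[i] :=
  fun i x => f i.1 (x - u i.2).

(* f lies in V_j iff f (varpi ^ j .) lies in V_0 *)
Definition dilated_space (V0 : set (borel K -> R[i])) (j : nat) :
    set (borel K -> R[i]) :=
  [set f | square_integrable mu f /\
           V0 (fun x : borel K => f (varpi ^+ j * (x : K)))].

Definition square_summable (a : nat -> R[i]) : Prop :=
  (\esum_(k in [set: nat]) ((Normc.normc (a k)) ^+ 2)%:E < +oo)%E.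

(* h is the sum of the Fourier series with square summable coefficients
   q^(-1/2) a_k.  It is periodic with respect to the u(n), and the series
   converges in L^2 on each compact set, so that h is determined a.e. *)
Definition fourier_symbol (chi : K -> R[i]) (a : nat -> R[i])
    (h : borel K -> R[i]) : Prop :=
  complex_measurable h /\
  forall D : set K, compact D ->
    L2_cvg_on mu (D : set (borel K))
      (fun n (xi : borel K) => \sum_(k < n)
         ((Num.sqrt (q%:R : R))^-1)%:C * a k * (chi (u k * (xi : K)))^*)
      h.

Definition symbol_mx (h : 'I_q -> 'I_N -> 'I_N -> borel K -> R[i])
    (r : 'I_q) (xi : K) : 'M[R[i]]_N :=
  \matrix_(l < N, j < N) h r l j xi.

Definition block_symbol_mx (h : 'I_q -> 'I_N -> 'I_N -> borel K -> R[i])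
    (xi : K) : 'M[R[i]]_(\sum_(r < q) N) :=
  \mxblock_(r < q, s < q) symbol_mx h r (xi + varpi * u s).

(* g_l(x) = q^(1/2) \sum_j \sum_k a_{ljk} f_j (x / varpi - u(k)) in L^2 *)
Definition refines (a : 'I_N -> 'I_N -> nat -> R[i])
    (f g : 'I_N -> borel K -> R[i]) : Prop :=
  forall l, L2_cvg_on mu [set: borel K]
    (fun n (x : borel K) => \sum_(j < N) \sum_(k < n)
       (Num.sqrt (q%:R : R))%:C * a l j k
         * f j (varpi^-1 * (x : K) - u k))
    (g l).

(* The recursion is imposed for all r >= 0.  For r = 0 it yields the functions
   psi^s, s < q, from psi^0, while packet_start yields them from phi; when the
   block matrix is bounded below, this amounts to psi^0 = phi a.e. *)
Record wavelet_frame_packets (a : 'I_q -> 'I_N -> 'I_N -> nat -> R[i])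
    (phi : 'I_N -> borel K -> R[i]) (psi : nat -> 'I_N -> borel K -> R[i]) :
    Prop := WaveletFramePackets {
  packet_L2 : forall n l, square_integrable mu (psi n l) ;
  packet_start : forall s : 'I_q, refines (a s) phi (psi s) ;
  packet_rec : forall (r : nat) (s : 'I_q),
    refines (a s) (psi r) (psi (s + q * r)%N)
}.

End Packets.

Arguments block_symbol_mx {R K} p {c} varpi eps {N} h xi.
Arguments wavelet_frame_packets {R K} mu p {c} varpi eps {N} a phi psi.

(* Main.v *)
Require Import Defs.
From HB Require Import structures.
From mathcomp Require Import all_boot all_order all_algebra.
From mathcomp Require Import complex.
From mathcomp Require finmap finfield.
From mathcomp Require Import finalg sesquilinear spectral.
From mathcomp Require Import all_classical all_reals all_analysis ess_sup_inf.
From mathcomp Require Import measurable_realfun.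
From mathcomp Require Import ring lra.

Set Implicit Arguments.
Unset Strict Implicit.
Unset Printing Implicit Defensive.

Import Order.TTheory GRing.Theory Num.Theory.
Import numFieldNormedType.Exports.

(** Why the theorem holds.  Going from one generation of packets to the next
    changes the coefficients of a function by a fixed operator on square
    summable families, and the eigenvalue bounds on H*H say that this operator
    multiplies squared norms by a factor between lambda and Lambda.

    In detail, let f be in the (j+1)-st dilated space.  Then g = f(varpi x) is
    in the j-th one, and |g|^2 = q |f|^2 because |varpi| = 1/q.  For r < q^j let
    b_i(m) be the conjugate of <f, q^(1/2) psi^r_i(x / varpi - u(m))>
    ([refine_coef]).  Its modulus is q^(-1/2) times that of
    <g, psi^r_i(x - u(m))> ([refine_coef_dilate]), so the induction hypothesis
    for g controls the sum of all |b_i(m)|^2.  The recursion defining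
    psi^(s+qr) turns into the formula
      conj <f, psi^(s+qr)_l(x - u(k))> = sum_i sum_m a^s_(l,i)(m) b_i(n),
    with u(n) = u(q k) + u(m) ([refined_coef]).  Call the right hand side
    (T b)(s,l,k) ([filter_out]).  What remains is the inequality
      lambda |b|^2 <= |T b|^2 <= Lambda |b|^2        ([filter_out_bounds]).

    For finitely supported b let t_i be the trigonometric polynomial with
    coefficients b_i.  The characters chi_n are orthonormal on the ring of
    integers ([ip_chi]), so |b|^2 is the squared norm of t.  Summing a function
    over its shifts by varpi u(s), s < q, keeps exactly the frequencies
    divisible by q ([sum_chi_shift]); hence q^(1/2) (T b)(r,l,k) is the k-th of
    the remaining Fourier coefficients of
      sum_s sum_i h^r_(l,i)(xi + varpi u(s)) t_i(xi + varpi u(s)).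
    This is the (r,l) entry of the block matrix H(xi) applied to the vector of
    all t_i(xi + varpi u(s)).  Bounding |H v|^2 pointwise by Rayleigh quotients
    ([gram_bounds]), integrating over the integers and applying Parseval on both
    sides ([nrm2_folded]) gives the inequality; truncation extends it to all
    square summable b.

    The induction starts from the frame generated by phi, so psi^0 = phi almost
    everywhere is needed ([packet0]).  Both families have the same refinements
    psi^s, s < q, and refinement is injective: the lower bound for T forces the
    coefficients b of a function f against the dilates of the difference F to
    vanish as soon as they are square summable, and this is so when f is a
    dilate of the restriction of F_i to a coset of the integers, since the
    translates of such a coset are disjoint ([translates_bessel],
    [refines_null]).

    Everything used about the field is derived from the Haar measure.  Comparing
    the measures of a compact neighbourhood V of 0 and of disjoint copies of w V
    inside it shows that the absolute value is at most 1/2 near 0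
    ([abs_near0]); from this the integers are relatively compact
    ([integers_in_compact]), Frobenius gives the ultrametric inequality
    ([integersD]), and counting cosets gives |varpi| = 1/q ([abs_varpi]). *)

Local Open Scope classical_set_scope.
Local Open Scope complex_scope.
Local Open Scope ring_scope.

(** * Complex valued square integrable functions *)
Section SquareModulus.
Context {R : realType}.
Implicit Types z w : R[i].

Definition nsq z : R := Normc.normc z ^+ 2.

Lemma nsqE z : nsq z = complex.Re z ^+ 2 + complex.Im z ^+ 2.
Proof. by rewrite /nsq; case: z => a b /=; rewrite sqr_sqrtr// addr_ge0// sqr_ge0. Qed.

Lemma nsq_ge0 z : 0 <= nsq z.
Proof. exact: sqr_ge0. Qed.

Lemma nsqM z w : nsq (z * w) = nsq z * nsq w.
Proof. by rewrite /nsq Normc.normcM exprMn. Qed.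

Lemma nsqN z : nsq (- z) = nsq z.
Proof. by rewrite !nsqE; case: z => a b /=; rewrite !sqrrN. Qed.

Lemma nsqJ z : nsq z^* = nsq z.
Proof. by rewrite !nsqE; case: z => a b /=; rewrite !sqrrN. Qed.

Lemma nsq0 : nsq 0 = 0 :> R.
Proof. by rewrite nsqE /= expr0n addr0. Qed.

Lemma nsq_eq0 z : nsq z = 0 -> z = 0.
Proof. by move/eqP; rewrite sqrf_eq0 => /eqP /Normc.eq0_normc. Qed.

Lemma nsq_real (r : R) : nsq r%:C = r ^+ 2.
Proof. by rewrite nsqE /= expr0n addr0. Qed.

Lemma mulrJ z : z * z^* = (nsq z)%:C.
Proof.
rewrite nsqE; case: z => a b; apply/eqP; rewrite eq_complex /=.
by apply/andP; split; apply/eqP; ring.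
Qed.

Lemma nsqD z w : nsq (z + w) = nsq z + 2 * complex.Re (z * w^*) + nsq w.
Proof. by rewrite !nsqE; case: z => a b; case: w => x y /=; ring. Qed.

Lemma nsqD_le z w : nsq (z + w) <= 2 * (nsq z + nsq w).
Proof.
rewrite !nsqE; case: z => a b; case: w => x y /=.
have : 0 <= (a - x) ^+ 2 + (b - y) ^+ 2 by rewrite addr_ge0// sqr_ge0.
lra.
Qed.

Lemma ReD z w : complex.Re (z + w) = complex.Re z + complex.Re w.
Proof. by case: z; case: w. Qed.
Lemma ImD z w : complex.Im (z + w) = complex.Im z + complex.Im w.
Proof. by case: z; case: w. Qed.
Lemma ReM z w : complex.Re (z * w) =
  complex.Re z * complex.Re w - complex.Im z * complex.Im w.
Proof. by case: z; case: w. Qed.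
Lemma ImM z w : complex.Im (z * w) =
  complex.Re z * complex.Im w + complex.Im z * complex.Re w.
Proof. by case: z; case: w. Qed.
Lemma ReJ z : complex.Re z^* = complex.Re z.
Proof. by case: z. Qed.
Lemma ImJ z : complex.Im z^* = - complex.Im z.
Proof. by case: z. Qed.

End SquareModulus.

Section ComplexMeasurable.
Context {R : realType} {d : measure_display} {T : measurableType d}.
Implicit Types f g : T -> R[i].

Lemma complex_measurable_cst (z : R[i]) : complex_measurable (fun _ : T => z).
Proof. by split; exact: measurable_cst. Qed.

Lemma complex_measurableD f g : complex_measurable f -> complex_measurable g ->
  complex_measurable (fun x => f x + g x).
Proof.
move=> [fr fi] [gr gi]; split.
  by under eq_fun do rewrite ReD; exact: measurable_funD.
by under eq_fun do rewrite ImD; exact: measurable_funD.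
Qed.

Lemma complex_measurableM f g : complex_measurable f -> complex_measurable g ->
  complex_measurable (fun x => f x * g x).
Proof.
move=> [fr fi] [gr gi]; split.
  under eq_fun do rewrite ReM.
  by apply: measurable_funB; exact: measurable_funM.
under eq_fun do rewrite ImM.
by apply: measurable_funD; exact: measurable_funM.
Qed.

Lemma complex_measurableJ f : complex_measurable f ->
  complex_measurable (fun x => (f x)^*).
Proof.
move=> [fr fi]; split; first by under eq_fun do rewrite ReJ.
by under eq_fun do rewrite ImJ; exact: measurableT_comp.
Qed.

Lemma complex_measurable_sum (I : Type) (s : seq I) (P : pred I) (f : I -> T -> R[i]) :
  (forall i, complex_measurable (f i)) ->
  complex_measurable (fun x => \sum_(i <- s | P i) f i x).
Proof.
move=> mf; elim: s => [|i s ih].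
  by under eq_fun do rewrite big_nil; exact: complex_measurable_cst.
under eq_fun do rewrite big_cons.
by case: (P i) => //; exact: complex_measurableD.
Qed.

Lemma measurable_nsq f : complex_measurable f ->
  measurable_fun [set: T] (fun x => nsq (f x)).
Proof.
move=> [fr fi]; under eq_fun do rewrite nsqE.
by apply: measurable_funD; exact: measurable_funX.
Qed.

End ComplexMeasurable.

Section ComplexIntegral.
Context {R : realType} {d : measure_display} {T : measurableType d}.
Variables (mu : {measure set T -> \bar R}) (D : set T).
Hypothesis mD : measurable D.
Implicit Types f g : T -> R[i].

Definition complex_integrable f : Prop :=
  mu.-integrable D (EFin \o (fun x => complex.Re (f x))) /\
  mu.-integrable D (EFin \o (fun x => complex.Im (f x))).

Local Notation cint := (complex_integral mu D).

Lemma eq_complex_integral f g : {in D, f =1 g} -> cint f = cint g.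
Proof.
move=> fg; rewrite /complex_integral.
by congr (_ +i* _); apply: eq_Rintegral => x xD; rewrite fg.
Qed.

Lemma complex_integralD f g : complex_integrable f -> complex_integrable g ->
  cint (fun x => f x + g x) = cint f + cint g.
Proof.
move=> [fr fi] [gr gi]; rewrite /complex_integral.
under [X in X +i* _]eq_Rintegral do rewrite ReD.
under [X in _ +i* X]eq_Rintegral do rewrite ImD.
by rewrite !RintegralD.
Qed.

Let integrableZlR (k : R) (u : T -> R) : mu.-integrable D (EFin \o u) ->
  mu.-integrable D (EFin \o (fun x => k * u x)).
Proof. by move=> iu; exact: (integrableZl mD k iu). Qed.

Lemma complex_integralZ (w : R[i]) f : complex_integrable f ->
  cint (fun x => w * f x) = w * cint f.
Proof.
move=> [fr fi]; rewrite /complex_integral.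
under [X in X +i* _]eq_Rintegral do rewrite ReM -mulNr.
under [X in _ +i* X]eq_Rintegral do rewrite ImM.
rewrite !RintegralD ?RintegralZl//; try exact: integrableZlR.
by case: w => a b; apply/eqP; rewrite eq_complex /= mulNr !eqxx.
Qed.

Lemma complex_integral_conj f : complex_integrable f ->
  cint (fun x => (f x)^*) = (cint f)^*.
Proof.
move=> [fr fi]; rewrite /complex_integral /=; congr (_ +i* _).
  by apply: eq_Rintegral => x _; rewrite ReJ.
under eq_Rintegral do rewrite ImJ -mulN1r.
by rewrite RintegralZl// mulN1r.
Qed.

End ComplexIntegral.

Section L2on.
Context {R : realType} {d : measure_display} {T : measurableType d}.
Variables (mu : {measure set T -> \bar R}) (D : set T).
Hypothesis mD : measurable D.
Implicit Types f g : T -> R[i].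

Definition L2on f : Prop := complex_measurable f /\ (sqnorm_on mu D f < +oo)%E.
Definition nrm2 f : R := fine (sqnorm_on mu D f).
Definition ip f g : R[i] := complex_integral mu D (fun x => f x * (g x)^*).

Lemma sqnorm_on_ge0 f : (0 <= sqnorm_on mu D f)%E.
Proof. by apply: integral_ge0 => x _; rewrite lee_fin nsq_ge0. Qed.

Lemma nrm2_ge0 f : 0 <= nrm2 f.
Proof. by rewrite fine_ge0// sqnorm_on_ge0. Qed.

Lemma L2on_fin f : L2on f -> sqnorm_on mu D f \is a fin_num.
Proof. by move=> [_ foo]; rewrite ge0_fin_numE// sqnorm_on_ge0. Qed.

Lemma L2on_nrm2 f : L2on f -> sqnorm_on mu D f = (nrm2 f)%:E.
Proof. by move=> /L2on_fin foo; rewrite fineK. Qed.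

Let mnsq f : complex_measurable f ->
  measurable_fun D (fun x => (Normc.normc (f x) ^+ 2)%:E).
Proof.
move=> mf; apply/measurable_EFinP; apply: measurable_funS (measurable_nsq mf) => //.
Qed.

Lemma L2on_integrable f : L2on f -> mu.-integrable D (EFin \o (fun x => nsq (f x))).
Proof.
move=> [mf foo]; apply/integrableP; split; first exact: mnsq.
by under eq_integral do rewrite /= ger0_norm ?nsq_ge0//.
Qed.

Lemma eq_sqnorm_on f g : {in D, forall x, nsq (f x) = nsq (g x)} ->
  sqnorm_on mu D f = sqnorm_on mu D g.
Proof. by move=> fg; apply: eq_integral => x xD; congr EFin; exact: fg. Qed.

Lemma le_sqnorm_on f g : complex_measurable f -> complex_measurable g ->
  (forall x, D x -> nsq (f x) <= nsq (g x)) ->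
  (sqnorm_on mu D f <= sqnorm_on mu D g)%E.
Proof.
move=> mf mg fg; apply: ge0_le_integral => //.
- by move=> x _; rewrite lee_fin nsq_ge0.
- exact: mnsq.
- exact: mnsq.
Qed.

Lemma sqnorm_onZ (w : R[i]) f : complex_measurable f ->
  sqnorm_on mu D (fun x => w * f x) = ((nsq w)%:E * sqnorm_on mu D f)%E.
Proof.
move=> mf; rewrite /sqnorm_on -ge0_integralZl;
  do 1?[exact: mD|exact: mnsq|by move=> *; rewrite lee_fin nsq_ge0].
by apply: eq_integral => x _; rewrite -EFinM -/(nsq _) nsqM.
Qed.

Lemma sqnorm_onD_le f g : complex_measurable f -> complex_measurable g ->
  (sqnorm_on mu D (fun x => f x + g x)%R <=
     2%:E * (sqnorm_on mu D f + sqnorm_on mu D g))%E.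
Proof.
move=> mf mg; rewrite /sqnorm_on -ge0_integralD;
  do 1?[exact: mD|exact: mnsq|by move=> *; rewrite lee_fin nsq_ge0].
rewrite -ge0_integralZl//; first last.
- by move=> x _; rewrite -EFinD lee_fin addr_ge0// nsq_ge0.
- by apply: emeasurable_funD; exact: mnsq.
apply: ge0_le_integral => //.
- by move=> x _; rewrite lee_fin nsq_ge0.
- by apply: mnsq; exact: complex_measurableD.
- by apply: measurable_funeM; apply: emeasurable_funD; exact: mnsq.
- by move=> x _; rewrite -EFinD -EFinM lee_fin nsqD_le.
Qed.

Lemma L2on0 : L2on (fun _ => 0).
Proof.
split; first exact: complex_measurable_cst.
rewrite /sqnorm_on integral0_eq// => x _.
by rewrite -/(nsq _) nsq0.
Qed.

Lemma L2onD f g : L2on f -> L2on g -> L2on (fun x => f x + g x).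
Proof.
move=> [mf foo] [mg goo]; split; first exact: complex_measurableD.
apply: le_lt_trans (sqnorm_onD_le mf mg) _.
by rewrite lte_mul_pinfty// lte_add_pinfty.
Qed.

Lemma L2onZ (w : R[i]) f : L2on f -> L2on (fun x => w * f x).
Proof.
move=> [mf foo]; split.
  by apply: complex_measurableM => //; exact: complex_measurable_cst.
by rewrite sqnorm_onZ// lte_mul_pinfty// lee_fin nsq_ge0.
Qed.

Lemma L2onN f : L2on f -> L2on (fun x => - f x).
Proof. by move=> /(L2onZ (-1)); under eq_fun do rewrite mulN1r. Qed.

Lemma L2onB f g : L2on f -> L2on g -> L2on (fun x => f x - g x).
Proof. by move=> Lf Lg; apply: L2onD => //; exact: L2onN. Qed.

Lemma L2on_sum (I : Type) (s : seq I) (P : pred I) (f : I -> T -> R[i]) :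
  (forall i, L2on (f i)) -> L2on (fun x => \sum_(i <- s | P i) f i x).
Proof.
move=> Lf; elim: s => [|i s ih].
  by under eq_fun do rewrite big_nil; exact: L2on0.
by under eq_fun do rewrite big_cons; case: (P i) => //; exact: L2onD.
Qed.

Lemma L2onM_integrable f g : L2on f -> L2on g ->
  complex_integrable mu D (fun x => f x * (g x)^*).
Proof.
move=> Lf Lg.
have mfg : complex_measurable (fun x => f x * (g x)^*).
  by apply: complex_measurableM; [exact: Lf.1|apply: complex_measurableJ; exact: Lg.1].
have ifg := integrableD mD (L2on_integrable Lf) (L2on_integrable Lg).
have bnd z w : `|complex.Re (z * w^*)| <= nsq z + nsq w /\
               `|complex.Im (z * w^*)| <= nsq z + nsq (w : R[i]).
  rewrite !nsqE; case: z => a b; case: w => x y /=.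
  have := sqr_ge0 (a - x); have := sqr_ge0 (a + x).
  have := sqr_ge0 (b - y); have := sqr_ge0 (b + y).
  have := sqr_ge0 (a - y); have := sqr_ge0 (a + y).
  have := sqr_ge0 (b - x); have := sqr_ge0 (b + x).
  by move=> *; split; rewrite ler_norml; apply/andP; split; lra.
split; apply: (le_integrable mD _ _ ifg).
- by apply/measurable_EFinP; apply: measurable_funS mfg.1.
- move=> x _ /=; rewrite lee_fin [leRHS]ger0_norm ?addr_ge0 ?nsq_ge0//.
  exact: (bnd _ _).1.
- by apply/measurable_EFinP; apply: measurable_funS mfg.2.
- move=> x _ /=; rewrite lee_fin [leRHS]ger0_norm ?addr_ge0 ?nsq_ge0//.
  exact: (bnd _ _).2.
Qed.

Lemma ipC f g : L2on f -> L2on g -> ip g f = (ip f g)^*.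
Proof.
move=> Lf Lg; rewrite /ip -complex_integral_conj//; last exact: L2onM_integrable.
by apply: eq_complex_integral => x _; rewrite rmorphM /= conjCK mulrC.
Qed.

Lemma ipDl f1 f2 g : L2on f1 -> L2on f2 -> L2on g ->
  ip (fun x => f1 x + f2 x) g = ip f1 g + ip f2 g.
Proof.
move=> L1 L2 Lg; rewrite /ip -complex_integralD//; try exact: L2onM_integrable.
by apply: eq_complex_integral => x _; rewrite mulrDl.
Qed.

Lemma ipZl w f g : L2on f -> L2on g -> ip (fun x => w * f x) g = w * ip f g.
Proof.
move=> Lf Lg; rewrite /ip -complex_integralZ//; last exact: L2onM_integrable.
by apply: eq_complex_integral => x _; rewrite mulrA.
Qed.

Lemma ipDr f g1 g2 : L2on f -> L2on g1 -> L2on g2 ->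
  ip f (fun x => g1 x + g2 x) = ip f g1 + ip f g2.
Proof.
move=> L1 L2 Lg; rewrite /ip -complex_integralD//; try exact: L2onM_integrable.
by apply: eq_complex_integral => x _; rewrite rmorphD mulrDr.
Qed.

Lemma ipZr w f g : L2on f -> L2on g -> ip f (fun x => w * g x) = w^* * ip f g.
Proof.
move=> Lf Lg; rewrite /ip -complex_integralZ//; last exact: L2onM_integrable.
by apply: eq_complex_integral => x _; rewrite rmorphM /=; ring.
Qed.

Lemma ipBr f g1 g2 : L2on f -> L2on g1 -> L2on g2 ->
  ip f (fun x => g1 x - g2 x) = ip f g1 - ip f g2.
Proof.
move=> Lf L1 L2; rewrite ipDr//; last exact: L2onN.
rewrite (_ : (fun x => - g2 x) = (fun x => -1 * g2 x)).
  by rewrite ipZr// rmorphN rmorph1 mulN1r.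
by apply/funext => x; rewrite mulN1r.
Qed.

Lemma ip0r f : L2on f -> ip f (fun=> 0) = 0.
Proof.
move=> Lf; rewrite (_ : (fun _ => _) = (fun x => 0 * (fun=> 0) x : R[i])).
  by rewrite ipZr ?rmorph0 ?mul0r//; exact: L2on0.
by apply/funext => x; rewrite mul0r.
Qed.

Lemma ip_sumr (I : Type) (s : seq I) (P : pred I) f (g : I -> T -> R[i]) :
  L2on f -> (forall i, L2on (g i)) ->
  ip f (fun x => \sum_(i <- s | P i) g i x) = \sum_(i <- s | P i) ip f (g i).
Proof.
move=> Lf Lg; elim: s => [|i s ih].
  rewrite big_nil; transitivity (ip f (fun=> 0)); last exact: ip0r.
  by congr ip; apply/funext => x; rewrite big_nil.
under [in LHS]eq_fun do rewrite big_cons; rewrite big_cons.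
case: (P i) => //; rewrite ipDr ?ih//; exact: L2on_sum.
Qed.

Lemma ip_self f : L2on f -> ip f f = (nrm2 f)%:C.
Proof.
move=> Lf; rewrite /ip /complex_integral.
under [X in X +i* _]eq_Rintegral do rewrite mulrJ /=.
under [X in _ +i* X]eq_Rintegral do rewrite mulrJ /=.
by rewrite Rintegral_cst// mul0r.
Qed.

Lemma nrm2D f g : L2on f -> L2on g ->
  nrm2 (fun x => f x + g x) = nrm2 f + 2 * complex.Re (ip f g) + nrm2 g.
Proof.
move=> Lf Lg; apply: (@complexI R).
rewrite -ip_self; last exact: L2onD.
rewrite ipDl//; last exact: L2onD.
rewrite !ipDr// !ip_self// (ipC Lf Lg).
apply/eqP; rewrite eq_complex /=; case: (ip f g) => a b /=.
by apply/andP; split; apply/eqP; ring.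
Qed.

Lemma nrm2Z w f : L2on f -> nrm2 (fun x => w * f x) = nsq w * nrm2 f.
Proof. by move=> Lf; rewrite /nrm2 sqnorm_onZ ?fineM//; [exact: L2on_fin|exact: Lf.1]. Qed.

(** The usual discriminant argument, with the quadratic polynomial
    |f + w g|^2 restricted to the line w = - t z through z = <f, g>. *)
Lemma cauchy_schwarz f g : L2on f -> L2on g -> nsq (ip f g) <= nrm2 f * nrm2 g.
Proof.
move=> Lf Lg; set z := ip f g.
have pos w : 0 <= nrm2 f + 2 * complex.Re (w^* * z) + nsq w * nrm2 g.
  by rewrite -nrm2Z// -ipZr// -nrm2D//; [exact: nrm2_ge0|exact: L2onZ].
have {}pos (t : R) : 0 <= nrm2 f - 2 * t * nsq z + t ^+ 2 * nsq z * nrm2 g.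
  have := pos (- t%:C * z).
  have -> : (- t%:C * z)^* * z = (- t * nsq z)%:C.
    rewrite nsqE; case: (z) => a b; apply/eqP; rewrite eq_complex /=.
    by apply/andP; split; apply/eqP; ring.
  by rewrite nsqM nsqN nsq_real /=; lra.
(* If g = 0 a.e. the polynomial is affine in t, and this t makes it -1. *)
have [g0|g0] := eqVneq (nrm2 g) 0.
  rewrite g0 mulr0; move: pos; rewrite g0 => pos.
  rewrite leNgt; apply/negP => z0.
  have := pos ((nrm2 f + 1) / (2 * nsq z)).
  rewrite mulr0 addr0 (_ : _ * nsq z = nrm2 f + 1); first lra.
  by field; lra.
have gp : 0 < nrm2 g by rewrite lt_def g0 nrm2_ge0.
have h := pos (nrm2 g)^-1.
have : 0 <= nrm2 g * (nrm2 f - 2 * (nrm2 g)^-1 * nsq z + (nrm2 g)^-1 ^+ 2 * nsq z * nrm2 g).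
  by apply: mulr_ge0; [exact: ltW|exact: h].
by rewrite (_ : nrm2 g * _ = nrm2 f * nrm2 g - nsq z); [rewrite subr_ge0|field].
Qed.

End L2on.

(** * Limits of complex sequences and of square integrable functions *)
Section ComplexLimits.
Context {R : realType}.
Implicit Types (u v : nat -> R[i]) (z w : R[i]).

(** Convergence in R[i], phrased by squared moduli so that L2 estimates apply
    directly to it. *)
Definition ccvg u z : Prop := (fun n => nsq (u n - z)) @ \oo --> (0 : R).

Lemma ccvg_unique u z w : ccvg u z -> ccvg u w -> z = w.
Proof.
move=> uz uw; apply/eqP; rewrite -subr_eq0; apply/eqP/nsq_eq0/eqP.
rewrite eq_le nsq_ge0 andbT.
have c : (fun n => 2 * (nsq (u n - z) + nsq (u n - w))) @ \oo --> (2 * (0 + 0) : R).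
  by apply: cvgM; [exact: cvg_cst|exact: cvgD].
rewrite addr0 mulr0 in c.
rewrite -(cvg_lim _ c)//; apply: limr_ge; first by apply/cvgP: c.
apply: nearW => n.
rewrite (_ : z - w = - (u n - z) + (u n - w)); last by ring.
by rewrite (le_trans (nsqD_le _ _))// nsqN.
Qed.

Lemma ccvg_cst z : ccvg (fun _ => z) z.
Proof. by rewrite /ccvg subrr nsq0; exact: cvg_cst. Qed.

Lemma ccvg_eq u v z : (forall n, u n = v n) -> ccvg u z -> ccvg v z.
Proof. by move=> /funext ->. Qed.

Lemma ccvg_le u z (e : nat -> R) : (forall n, nsq (u n - z) <= e n) ->
  e @ \oo --> (0 : R) -> ccvg u z.
Proof.
move=> ue e0; apply: (@squeeze_cvgr _ _ _ _ (fun=> 0) e) => //.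
  by apply: nearW => n; rewrite nsq_ge0 ue.
exact: cvg_cst.
Qed.

Lemma ccvgD u v z w : ccvg u z -> ccvg v w -> ccvg (fun n => u n + v n) (z + w).
Proof.
move=> uz vw; apply: (@ccvg_le _ _ (fun n => 2 * (nsq (u n - z) + nsq (v n - w)))).
  by move=> n; rewrite opprD addrACA nsqD_le.
by rewrite -[X in _ --> X](mulr0 2) -[X in 2 * X]addr0; apply: cvgM; [exact: cvg_cst|exact: cvgD].
Qed.

Lemma ccvgZ u z w : ccvg u z -> ccvg (fun n => w * u n) (w * z).
Proof.
move=> uz; apply: (@ccvg_le _ _ (fun n => nsq w * nsq (u n - z))).
  by move=> n; rewrite -mulrBr nsqM.
by rewrite -[X in _ --> X](mulr0 (nsq w)); apply: cvgM; [exact: cvg_cst|].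
Qed.

Lemma ccvgJ u z : ccvg u z -> ccvg (fun n => (u n)^*) z^*.
Proof.
move=> uz; apply: (ccvg_le _ uz) => n.
by rewrite -rmorphB nsqJ.
Qed.

Lemma ccvg_sum (I : Type) (s : seq I) (P : pred I) (u : I -> nat -> R[i]) (z : I -> R[i]) :
  (forall i, ccvg (u i) (z i)) ->
  ccvg (fun n => \sum_(i <- s | P i) u i n) (\sum_(i <- s | P i) z i).
Proof.
move=> uz; elim: s => [|i s ih].
  by under eq_fun do rewrite big_nil; rewrite big_nil; exact: ccvg_cst.
under eq_fun do rewrite big_cons; rewrite big_cons.
by case: (P i) => //; exact: ccvgD.
Qed.

Lemma cvg_sqr0 (u : nat -> R) : (fun n => u n ^+ 2) @ \oo --> (0 : R) ->
  u @ \oo --> (0 : R).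
Proof.
move=> u0; apply/norm_cvg0P.
under eq_fun do rewrite -sqrtr_sqr.
have : (fun n => Num.sqrt (u n ^+ 2)) @ \oo --> Num.sqrt (0 : R).
  by apply: continuous_cvg => //; exact: sqrt_continuous.
by rewrite sqrtr0.
Qed.

Lemma ccvg_Re u z : ccvg u z ->
  (fun n => complex.Re (u n)) @ \oo --> complex.Re z.
Proof.
move=> uz; apply: (@cvg_sub0 _ _ _ _ _ _ (fun=> complex.Re z)); last exact: cvg_cst.
apply: cvg_sqr0.
apply: (@squeeze_cvgr _ _ _ _ (fun=> 0) (fun n => nsq (u n - z))) => //.
  apply: nearW => n; rewrite sqr_ge0 /= nsqE.
  rewrite [X in X ^+ 2 <= _](_ : _ = complex.Re (u n - z)) ?lerDl ?sqr_ge0//.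
  by rewrite !fctE /=; case: (u n) (z) => a b [].
exact: cvg_cst.
Qed.

Lemma ccvg_nsq u z : ccvg u z -> (fun n => nsq (u n)) @ \oo --> nsq z.
Proof.
move=> uz; rewrite (_ : (fun n => nsq (u n)) =
  (fun n => nsq (u n - z) + 2 * complex.Re (z^* * (u n - z)) + nsq z)); last first.
  by apply/funext => n; rewrite -[in LHS](subrK z (u n)) [LHS]nsqD [z^* * _]mulrC.
have c : ccvg (fun n => z^* * (u n - z)) 0.
  rewrite -[X in ccvg _ X](mulr0 z^*); apply: ccvgZ.
  by rewrite /ccvg; under eq_fun do rewrite subr0.
rewrite -[X in _ --> X]add0r; apply: cvgD; last exact: cvg_cst.
rewrite -[X in _ --> X]addr0; apply: cvgD; first exact: uz.
rewrite -[X in _ --> X](mulr0 2); apply: cvgM; first exact: cvg_cst.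
exact: (ccvg_Re c).
Qed.

End ComplexLimits.

Section L2limits.
Context {R : realType} {d : measure_display} {T : measurableType d}.
Variables (mu : {measure set T -> \bar R}) (D : set T).
Hypothesis mD : measurable D.
Implicit Types (f g : T -> R[i]) (F : nat -> T -> R[i]).

Lemma L2_cvg_on_fin F f : L2_cvg_on mu D F f ->
  exists n, (sqnorm_on mu D (fun x => F n x - f x)%R < +oo)%E.
Proof.
move=> /fine_cvgP[fin _]; have [n _ nfin] := fin.
by exists n; rewrite -ge0_fin_numE ?sqnorm_on_ge0//; exact: (nfin n (leqnn n)).
Qed.

Lemma L2_cvg_on_L2 F f : (forall n, L2on mu D (F n)) -> complex_measurable f ->
  L2_cvg_on mu D F f -> L2on mu D f.
Proof.
move=> LF mf /L2_cvg_on_fin[n nfin].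
have mFf : complex_measurable (fun x => F n x - f x).
  apply: complex_measurableD; first exact: (LF n).1.
  under eq_fun do rewrite -mulN1r.
  by apply: complex_measurableM => //; exact: complex_measurable_cst.
have : L2on mu D (fun x => F n x - (F n x - f x)) by apply: L2onB.
by under eq_fun do rewrite subKr.
Qed.

Lemma L2_cvg_nrm2 F f : L2_cvg_on mu D F f ->
  (fun n => nrm2 mu D (fun x => F n x - f x)) @ \oo --> (0 : R).
Proof. by move=> /fine_cvgP[_]. Qed.

Lemma nrm2_L2_cvg F f : (forall n, L2on mu D (F n)) -> L2on mu D f ->
  (fun n => nrm2 mu D (fun x => F n x - f x)) @ \oo --> (0 : R) ->
  L2_cvg_on mu D F f.
Proof.
move=> LF Lf c; apply/fine_cvgP; split => //.
by apply: nearW => n; apply: L2on_fin; exact: L2onB.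
Qed.

Lemma ip_cvg F f g : (forall n, L2on mu D (F n)) -> L2on mu D f -> L2on mu D g ->
  L2_cvg_on mu D F f -> ccvg (fun n => ip mu D g (F n)) (ip mu D g f).
Proof.
move=> LF Lf Lg Ff.
apply: (@ccvg_le _ _ _ (fun n => nrm2 mu D g * nrm2 mu D (fun x => F n x - f x))).
  move=> n; rewrite -ipBr//; apply: cauchy_schwarz => //; exact: L2onB.
rewrite -[X in _ --> X](mulr0 (nrm2 mu D g)); apply: cvgM; first exact: cvg_cst.
exact: L2_cvg_nrm2.
Qed.

Lemma nrm2_cvg F f : (forall n, L2on mu D (F n)) -> L2on mu D f ->
  L2_cvg_on mu D F f -> (fun n => nrm2 mu D (F n)) @ \oo --> nrm2 mu D f.
Proof.
move=> LF Lf Ff; have LFf n : L2on mu D (fun x => F n x - f x) by exact: L2onB.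
rewrite (_ : (fun n => nrm2 mu D (F n)) = (fun n => nrm2 mu D f +
   2 * complex.Re (ip mu D f (fun x => F n x - f x)) + nrm2 mu D (fun x => F n x - f x))).
  rewrite -[X in _ --> X]addr0; apply: cvgD; last exact: L2_cvg_nrm2.
  rewrite -[X in _ --> X]addr0; apply: cvgD; first exact: cvg_cst.
  rewrite -[X in _ --> X](mulr0 2); apply: cvgM; first exact: cvg_cst.
  rewrite (_ : 0 = complex.Re (0 : R[i]))//; apply: ccvg_Re.
  apply: (@ccvg_eq _ (fun n => ip mu D f (F n) - ip mu D f f)).
    by move=> n; rewrite ipBr.
  by rewrite /ccvg; under eq_fun do rewrite subr0; exact: ip_cvg.
apply/funext => n; rewrite -nrm2D//; congr nrm2.
by apply/funext => x; rewrite addrC subrK.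
Qed.

End L2limits.

(** * Topology of a local field and the module of Haar measure *)
Section FieldTopology.
Context {K : topologicalFieldType}.
Implicit Types (a b x y : K) (A U V W : set K).

Lemma nbhs_sub x y U : nbhs (x - y) U ->
  exists A B, [/\ nbhs x A, nbhs y B & forall s t, A s -> B t -> U (s - t)].
Proof.
move=> /(@sub_continuous K (x, y))[[A B] /= [xA yB] ABU].
by exists A, B; split => // s t As Bt; exact: (ABU (s, t)).
Qed.

Lemma nbhs_add x y U : nbhs (x + y) U ->
  exists A B, [/\ nbhs x A, nbhs y B & forall s t, A s -> B t -> U (s + t)].
Proof.
move=> /(@add_continuous K (x, y))[[A B] /= [xA yB] ABU].
by exists A, B; split => // s t As Bt; exact: (ABU (s, t)).
Qed.

Lemma addl_continuous a : continuous (fun x : K => a + x).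
Proof.
move=> x; apply: (@continuous_comp K (K * K)%type K (fun x => (a, x))
  (fun z => z.1 + z.2)); last exact: add_continuous.
by apply: cvg_pair; [exact: cvg_cst|exact: cvg_id].
Qed.

Lemma mull_continuous a : continuous (fun x : K => a * x).
Proof.
move=> x; apply: (@continuous_comp K (K * K)%type K (fun x => (a, x))
  (fun z => z.1 * z.2)); last exact: Defs.mul_continuous.
by apply: cvg_pair; [exact: cvg_cst|exact: cvg_id].
Qed.

Lemma shift_preimage a A : [set a + x | x in A] = (fun x => - a + x) @^-1` A.
Proof.
apply/seteqP; split => [_ [x Ax <-] /=|x /= Ax]; first by rewrite addKr.
by exists (- a + x); rewrite ?addNKr.
Qed.

Lemma scale_preimage a A : a != 0 ->
  [set a * x | x in A] = (fun x => a^-1 * x) @^-1` A.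
Proof.
move=> a0; apply/seteqP; split => [_ [x Ax <-] /=|x /= Ax]; first by rewrite mulKf.
by exists (a^-1 * x); rewrite ?mulVKf.
Qed.

Lemma nbhs0_shift a U : nbhs 0 U -> nbhs a [set a + x | x in U].
Proof.
move=> U0; rewrite shift_preimage; apply: addl_continuous.
by rewrite addNr.
Qed.

Lemma nbhs0_scale a U : a != 0 -> nbhs 0 U -> nbhs 0 [set a * x | x in U].
Proof.
move=> a0 U0; rewrite scale_preimage//; apply: mull_continuous.
by rewrite mulr0.
Qed.

Lemma compact_scale a A : compact A -> compact [set a * x | x in A].
Proof.
move=> cA; apply: continuous_compact => //.
by apply: continuous_subspaceT; exact: mull_continuous.
Qed.

Lemma compact_shift a A : compact A -> compact [set a + x | x in A].
Proof.
move=> cA; apply: continuous_compact => //.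
by apply: continuous_subspaceT; exact: addl_continuous.
Qed.

(** Tube lemma: continuity of multiplication at the points (0, v) is uniform
    over the compact set V. *)
Lemma near0_scale_sub V U : compact V -> nbhs (0 : K) U ->
  \forall w \near (0 : K), forall v, V v -> U (w * v).
Proof.
move=> cV U0.
have /compact_near_coveringP cov := cV.
have := cov K (nbhs (0 : K)) (fun w v => U (w * v)) _.
apply => v Vv.
have : nbhs ((0 : K) * v) U by rewrite mul0r.
move=> /(Defs.mul_continuous (0, v))[[A B] /= [A0 vB] ABU].
exists (B, A) => //= -[s t] /= [Bs At].
exact: (ABU (t, s)).
Qed.

Hypothesis K_local : local_field K.

(** Points are their own components, hence closed; with the group structure this
    makes the field Hausdorff. *)
Lemma closed_point a : closed [set a].
Proof.
have := lf_totally_disconnected K_local (x := a) I => <-.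
by apply: component_closed; exact: closedT.
Qed.

Lemma local_field_hausdorff : hausdorff_space K.
Proof.
move=> p q pq; apply/eqP; rewrite -subr_eq0; apply/negPn/negP => pq0.
have /nbhs_sub[A [B [pA qB ABU]]] : nbhs (p - q) (~` [set 0]).
  apply: open_nbhs_nbhs; split; last exact/eqP.
  by apply: closed_openC; exact: closed_point.
have [z [Az Bz]] := pq _ _ pA qB.
by apply: (ABU _ _ Az Bz); rewrite subrr.
Qed.

Lemma local_field_compact_nbhs : exists V, compact V /\ nbhs (0 : K) V.
Proof.
have := lf_locally_compact K_local; rewrite /locally_compact.
move=> /(_ 0 I) [V V0 [cV _]].
by exists V; split=> //; move: V0; rewrite withinE => -[W W0]; rewrite !setIT => ->.
Qed.

Lemma open_measurable_borel (A : set K) : open A -> measurable (A : set (borel K)).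
Proof. by move=> oA; exact: sub_sigma_algebra. Qed.

Lemma closed_measurable_borel (A : set K) : closed A -> measurable (A : set (borel K)).
Proof.
move=> cA; rewrite -[A]setCK; apply: (@measurableC _ (borel K)).
by apply: open_measurable_borel; exact: closed_openC.
Qed.

Lemma compact_measurable_borel (A : set K) : compact A -> measurable (A : set (borel K)).
Proof.
move=> cA; apply: closed_measurable_borel; apply: compact_closed => //.
exact: local_field_hausdorff.
Qed.

Lemma nbhs0_nonzero U : nbhs (0 : K) U -> exists2 b, b != 0 & U b.
Proof.
move=> U0; apply: contrapT => nb; apply: (lf_nondiscrete K_local) => A.
rewrite openE => x Ax; rewrite /interior.
have /(nbhs0_shift x) : nbhs (0 : K) [set 0].
  apply: filterS U0 => b Ub; apply/eqP/negPn/negP => b0.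
  by apply: nb; exists b.
by apply: filterS => _ [_ -> <-]; rewrite addr0.
Qed.

Context {R : realType}.
Variable mu : {measure set (borel K) -> \bar R}.
Hypothesis mu_haar : haar_measure mu.
Local Notation Mu A := (mu (A : set (borel K))).

Lemma compact_haar_fin V : compact V -> Mu V \is a fin_num.
Proof. by move=> cV; rewrite ge0_fin_numE// (haar_compact mu_haar). Qed.

Lemma compact_nbhs_haar_gt0 V : compact V -> nbhs (0 : K) V -> 0 < fine (Mu V).
Proof.
move=> cV V0; rewrite -lte_fin fineK ?compact_haar_fin//.
have oV := @open_interior _ V.
apply: (@lt_le_trans _ _ (Mu (interior V))).
  by apply: (haar_open mu_haar) => //; exists 0.
apply: le_measure; rewrite ?inE.
- exact: open_measurable_borel.
- exact: compact_measurable_borel.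
- exact: interior_subset.
Qed.

Variable abs : K -> R.
Hypothesis abs_modulus : modulus mu abs.

Lemma haar_scale a V : a != 0 -> compact V ->
  fine (Mu [set a * x | x in V]) = abs a * fine (Mu V).
Proof.
move=> a0 cV; rewrite (modulus_scale abs_modulus)//; last exact: compact_measurable_borel.
by rewrite fineM//; exact: compact_haar_fin.
Qed.

Lemma le_haar V W : compact V -> compact W -> V `<=` W ->
  fine (Mu V) <= fine (Mu W).
Proof.
move=> cV cW VW; rewrite fine_le ?compact_haar_fin//.
by apply: le_measure => //; rewrite inE; exact: compact_measurable_borel.
Qed.

Lemma abs0 : abs 0 = 0.
Proof. exact: (modulus0 abs_modulus). Qed.

Lemma abs1 : abs 1 = 1.
Proof.
have [V [cV V0]] := local_field_compact_nbhs.
have mV := compact_nbhs_haar_gt0 cV V0.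
apply: (mulIf (lt0r_neq0 mV)); rewrite -haar_scale ?oner_neq0// mul1r.
congr (fine (mu _)); rewrite scale_preimage ?oner_neq0//.
by apply/seteqP; split => x /=; rewrite invr1 mul1r.
Qed.

Lemma absM a b : abs (a * b) = abs a * abs b.
Proof.
have [->|a0] := eqVneq a 0; first by rewrite !mul0r abs0 mul0r.
have [->|b0] := eqVneq b 0; first by rewrite !mulr0 abs0 mulr0.
have [V [cV V0]] := local_field_compact_nbhs.
have mV := compact_nbhs_haar_gt0 cV V0.
apply: (mulIf (lt0r_neq0 mV)).
rewrite -mulrA -!haar_scale ?mulf_neq0//; last exact: compact_scale.
congr (fine (mu _)); apply/seteqP; split => [_ [x Vx <-]|_ [_ [x Vx <-] <-]].
  by exists (b * x); [exists x|rewrite mulrA].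
by exists x; rewrite ?mulrA.
Qed.

Lemma abs_ge0 a : 0 <= abs a.
Proof.
have [->|a0] := eqVneq a 0; first by rewrite abs0.
have [V [cV V0]] := local_field_compact_nbhs.
have mV := compact_nbhs_haar_gt0 cV V0.
by rewrite -(pmulr_lge0 _ mV) -haar_scale// fine_ge0.
Qed.

Lemma abs_gt0 a : a != 0 -> 0 < abs a.
Proof.
move=> a0; rewrite lt_def abs_ge0 andbT.
have : abs a * abs a^-1 != 0 by rewrite -absM divff// abs1 oner_neq0.
by apply: contra => /eqP ->; rewrite mul0r.
Qed.

Lemma absV a : a != 0 -> abs a^-1 = (abs a)^-1.
Proof.
move=> a0; apply: (mulfI (lt0r_neq0 (abs_gt0 a0))).
by rewrite -absM !divff ?abs1// lt0r_neq0// abs_gt0.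
Qed.

Lemma absX a n : abs (a ^+ n) = abs a ^+ n.
Proof. by elim: n => [|n ih]; rewrite ?expr0 ?abs1// !exprS absM ih. Qed.

Lemma absN a : abs (- a) = abs a.
Proof.
have h : abs (-1) = 1.
  apply/eqP; rewrite -(@eqrXn2 _ 2) ?abs_ge0// -absX expr1n.
  by rewrite sqrrN expr1n abs1.
by rewrite -mulN1r absM h mul1r.
Qed.

(** If V is a compact neighbourhood of 0 then x V stays in the compact set C V
    for x in C, so that |x| mu(V) = mu(x V) is bounded. *)
Lemma abs_bounded C : compact C -> exists M : R, forall x, C x -> abs x <= M.
Proof.
move=> cC.
have [V [cV V0]] := local_field_compact_nbhs.
have mV := compact_nbhs_haar_gt0 cV V0.
have cCV : compact ((fun z => z.1 * z.2) @` (C `*` V)).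
  apply: continuous_compact; last exact: compact_setX.
  by apply: continuous_subspaceT; exact: Defs.mul_continuous.
exists (fine (Mu ((fun z => z.1 * z.2) @` (C `*` V))) / fine (Mu V)) => x Cx.
have [->|x0] := eqVneq x 0.
  by rewrite abs0 divr_ge0// fine_ge0.
rewrite ler_pdivlMr// -haar_scale//.
apply: le_haar => //; first exact: compact_scale.
by move=> _ [v Vv <-]; exists (x, v).
Qed.

(** Boundedness on the compact set of inverses. *)
Lemma abs_bounded_below C : compact C -> ~ C 0 ->
  exists2 e : R, 0 < e & forall x, C x -> e <= abs x.
Proof.
move=> cC C0.
have cCV : compact ((@GRing.inv K) @` C).
  apply: continuous_compact => //; apply: continuous_in_subspaceT => x.
  rewrite inE => Cx; apply: Defs.inv_continuous.
  by apply/eqP => x0; apply: C0; rewrite -x0.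
have [M hM] := abs_bounded cCV.
exists (Num.max M 1)^-1; first by rewrite invr_gt0 lt_max ltr01 orbT.
move=> x Cx.
have x0 : x != 0 by apply/eqP => x0; apply: C0; rewrite -x0.
have : abs x^-1 <= Num.max M 1 by rewrite le_max hM//; exists x.
rewrite absV// => h.
by rewrite -[leRHS]invrK lef_pV2// posrE ?invr_gt0 ?abs_gt0// lt_max ltr01 orbT.
Qed.

(** Fix a small b <> 0.  For w close to 0 the sets w V and b + w V are disjoint
    and both lie in V; they have the same measure |w| mu(V), so 2 |w| <= 1.  The
    field being nondiscrete is what provides b. *)
Lemma abs_near0 : \forall w \near (0 : K), abs w <= 2^-1.
Proof.
have [V [cV V0]] := local_field_compact_nbhs.
have mV := compact_nbhs_haar_gt0 cV V0.
have /nbhs_add[A [B [A0 B0 ABV]]] : nbhs ((0 : K) + 0) V by rewrite addr0.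
have [b b0 Ab] := nbhs0_nonzero A0.
have /nbhs_sub[A' [B' [A'0 B'0 ABb]]] : nbhs ((0 : K) - 0) (~` [set b]).
  apply: open_nbhs_nbhs; split; first by apply: closed_openC; exact: closed_point.
  by rewrite subr0 => b0'; move: b0; rewrite -b0' eqxx.
have U0 : nbhs (0 : K) (B `&` (A' `&` B')) by do !apply: filterI.
have := near0_scale_sub cV U0; apply: filterS => w wV.
have [->|w0] := eqVneq w 0; first by rewrite abs0 invr_ge0.
rewrite -(ler_pM2r mV) -haar_scale//.
set W := [set w * x | x in V] in wV *.
have cW : compact W by exact: compact_scale.
have cbW : compact [set b + x | x in W] by exact: compact_shift.
suff : fine (Mu W) + fine (Mu W) <= fine (Mu V) by lra.
have mbW : Mu [set b + x | x in W] = Mu W.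
  by rewrite (haar_translate mu_haar)//; exact: compact_measurable_borel.
rewrite -[in X in _ + X]mbW -fineD ?compact_haar_fin//.
rewrite -measureU; [|exact: compact_measurable_borel|exact: compact_measurable_borel|].
  rewrite le_haar//; first exact: compactU.
  move=> x [[v Vv <-]|[_ [v Vv <-] <-]].
    by rewrite -[w * v]add0r; apply: ABV; [exact: nbhs_singleton|exact: (wV v Vv).1].
  by apply: ABV => //; exact: (wV v Vv).1.
apply/seteqP; split => // x [[v Vv <-] [_ [v' Vv' <-]]] e.
apply: (ABb _ _ (wV _ Vv).2.1 (wV _ Vv').2.2).
by rewrite /= -e addrK.
Qed.

End FieldTopology.

(** * The ring of integers *)
Section IntegerRing.
Context {R : realType} {K : topologicalFieldType}.
Implicit Types (a b x y : K) (A U V W : set K).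
Variable mu : {measure set (borel K) -> \bar R}.
Variable abs : K -> R.
Hypothesis K_local : local_field K.
Hypothesis mu_haar : haar_measure mu.
Hypothesis abs_modulus : modulus mu abs.

Let absM := absM K_local mu_haar abs_modulus.
Let abs1 := abs1 K_local mu_haar abs_modulus.
Let abs0 := abs0 abs_modulus.
Let absX := absX K_local mu_haar abs_modulus.
Let abs_ge0 := abs_ge0 K_local mu_haar abs_modulus.
Let abs_gt0 := abs_gt0 K_local mu_haar abs_modulus.
Let absV := absV K_local mu_haar abs_modulus.
Let absN := absN K_local mu_haar abs_modulus.

Lemma half_expn_lt (e : R) : 0 < e -> exists n, 2^-1 ^+ n < e.
Proof.
move=> e0; exists (Num.bound e^-1).
rewrite exprVn invf_plt ?posrE ?exprn_gt0//.
have := archi_boundP (ltW (etrans (invr_gt0 e) e0)) => /lt_trans; apply.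
by rewrite -natrX ltr_nat ltn_expl.
Qed.

(** Take r <> 0 with r V contained in V and |r| <= 1/2.  The powers of r stay in
    V and, the module being bounded below on compact sets avoiding 0, tend to 0.
    So for |a| <= 1 some r^n a is in V; for the least such n > 0 the point r^n a
    is in V but not in r V, where the module is at least some e > 0.  As
    |r^n a| <= 2^(-n), this bounds n independently of a, and a is in r^(-n0) V. *)
Lemma integers_in_compact : exists2 Z, compact Z & integers abs `<=` Z.
Proof.
have [V [cV V0]] := local_field_compact_nbhs K_local.
have hsd := local_field_hausdorff K_local.
have : nbhs (0 : K) (V `&` ([set w | abs w <= 2^-1] `&`
    [set w | forall v, V v -> V (w * v)])).
  apply: filterI => //; apply: filterI; first exact: (abs_near0 K_local mu_haar abs_modulus).
  exact: near0_scale_sub.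
move=> /(nbhs0_nonzero K_local)[r r0 [Vr [/= r2 rV]]].
have rnV n : V (r ^+ n.+1) by elim: n => // n ih; rewrite exprS; exact: rV.
have absrn n : abs (r ^+ n) <= 2^-1 ^+ n.
  by rewrite absX lerXn2r// nnegrE ?abs_ge0// invr_ge0.
have rn0 U : nbhs (0 : K) U -> exists n, U (r ^+ n).
  move=> U0.
  have cX : compact (V `&` ~` (interior U)).
    by apply: compact_closedI => //; apply: open_closedC; exact: open_interior.
  have [e e0 eX] := abs_bounded_below K_local mu_haar abs_modulus cX (fun h => h.2 U0).
  have [n ne] := half_expn_lt e0.
  exists n.+1; apply: interior_subset; apply: contrapT => nU.
  have := eX (r ^+ n.+1) (conj (rnV n) nU).
  apply/negP; rewrite -ltNge; apply: le_lt_trans (absrn _) _.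
  apply: le_lt_trans ne; rewrite exprS ler_piMl ?exprn_ge0 ?invr_ge0//.
  by rewrite invf_le1 ?ler1n.
have ex a : exists n, `[< V (r ^+ n * a) >].
  have : nbhs ((0 : K) * a) V by rewrite mul0r.
  have ca : continuous (fun x => x * a).
    by under eq_fun do rewrite mulrC; exact: mull_continuous.
  by move=> /ca /= /rn0[n]; exists n; apply/asboolP.
have cX : compact (V `&` ~` (interior [set r * x | x in V])).
  by apply: compact_closedI => //; apply: open_closedC; exact: open_interior.
have X0 : ~ (V `&` ~` (interior [set r * x | x in V])) 0.
  by move=> [_]; apply; apply: nbhs0_scale.
have [e e0 eX] := abs_bounded_below K_local mu_haar abs_modulus cX X0.
have [n0 n0e] := half_expn_lt e0.
exists [set (r ^+ n0)^-1 * x | x in V]; first exact: compact_scale.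
move=> a /= a1.
case: (ex_minnP (ex a)) => n /asboolP Vn minn.
have nn0 : (n <= n0)%N.
  rewrite leqNgt; apply/negP => n0n.
  have : e <= abs (r ^+ n * a).
    apply: eX; split => // /interior_subset [v Vv].
    case: n n0n {Vn} minn => // n _ minn.
    rewrite exprS -mulrA => /(mulfI r0) vE.
    have := minn n; rewrite -vE => /(_ (asboolT Vv)).
    by rewrite ltnn.
  apply/negP; rewrite -ltNge; apply: le_lt_trans n0e.
  rewrite absM (le_trans (ler_piMr (abs_ge0 _) a1))//.
  rewrite (le_trans (absrn n))//.
  by rewrite ler_wiXn2l ?invr_ge0 ?invf_le1 ?ler1n// ltnW.
have Vn0 : V (r ^+ n0 * a).
  rewrite -(subnK nn0) exprD -mulrA.
  by elim: (n0 - n)%N => [|k ih]; rewrite ?expr0 ?mul1r// exprS -mulrA; exact: rV.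
by exists (r ^+ n0 * a) => //; rewrite mulKf// expf_neq0.
Qed.

Variable p : nat.
Hypothesis K_char : p \in [pchar K].

(** As 1 + O lies in a compact set, |s + t| <= C for integers s and t.  In
    characteristic p this applies to (x + y)^(p^n) = x^(p^n) + y^(p^n), so all
    these powers of |x + y| are at most C, which forces |x + y| <= 1. *)
Lemma integersD x y : integers abs x -> integers abs y -> integers abs (x + y).
Proof.
have [Z cZ sZ] := integers_in_compact.
have [A hA] := abs_bounded K_local mu_haar abs_modulus (compact_shift (a := 1) cZ).
have p_pr : prime p := pcharf_prime K_char.
have bnd s t : integers abs s -> integers abs t -> abs (s + t) <= Num.max A 1.
  wlog : s t / abs s <= abs t.
    move=> H Is It; have [/H|/ltW/H] := leP (abs s) (abs t); first exact.
    by rewrite addrC; apply.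
  move=> st Is It; have [t0|t0] := eqVneq t 0.
    move: st; rewrite t0 abs0 addr0 => /le_trans; apply.
    by rewrite le_max ler01 orbT.
  rewrite (_ : s + t = t * (1 + s / t)); last first.
    by rewrite mulrDr mulr1 mulrCA divff// mulr1 addrC.
  rewrite absM (le_trans (ler_piMl (abs_ge0 _) It))// le_max hA//.
  exists (s / t) => //; apply: sZ.
  by rewrite /integers /= absM absV// ler_pdivrMr ?abs_gt0// mul1r.
move=> Ix Iy; rewrite /integers /= leNgt; apply/negP => t1.
set t := abs (x + y) in t1.
have tn n : t ^+ (p ^ n) <= Num.max A 1.
  rewrite -absX exprDn_pchar; last first.
    apply/pnatP; rewrite ?expn_gt0 ?prime_gt0// => l l_pr.
    by rewrite Euclid_dvdX// => /andP[]; rewrite dvdn_prime2// => /eqP ->.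
  by apply: bnd; rewrite /integers /= absX exprn_ile1// abs_ge0.
have t10 : 0 < t - 1 by lra.
pose n := Num.bound (Num.max A 1 / (t - 1)).
have : Num.max A 1 < n%:R * (t - 1).
  rewrite -ltr_pdivrMr//; apply: archi_boundP.
  by rewrite divr_ge0 ?(ltW t10)// le_max ler01 orbT.
apply/negP; rewrite -leNgt; apply: le_trans (tn n).
(* Bernoulli's inequality: the powers of t > 1 are unbounded. *)
have bern (m : nat) : 1 + m%:R * (t - 1) <= t ^+ m.
  elim: m => [|m ih]; first by rewrite mul0r addr0 expr0.
  rewrite exprS.
  have tm : 1 <= t ^+ m by rewrite exprn_ege1// ltW.
  have : (t - 1) * 1 <= (t - 1) * t ^+ m by rewrite ler_pM2l.
  by rewrite -(@natr1 _ m); lra.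
apply: le_trans (bern _).
have : n%:R <= (p ^ n)%:R :> R by rewrite ler_nat ltnW// ltn_expl// prime_gt1.
by rewrite -(ler_pM2r t10); lra.
Qed.

Lemma integers0 : integers abs 0.
Proof. by rewrite /integers /= abs0. Qed.

Lemma integersN x : integers abs x -> integers abs (- x).
Proof. by rewrite /integers /= absN. Qed.

Lemma integersM x y : integers abs x -> integers abs y -> integers abs (x * y).
Proof. by rewrite /integers /= absM => x1 y1; rewrite mulr_ile1// abs_ge0. Qed.

Lemma integersB x y : integers abs x -> integers abs y -> integers abs (x - y).
Proof. by move=> Ix Iy; apply: integersD => //; exact: integersN. Qed.

(** Integers absorb small elements by [integersD], hence are open and closed. *)
Lemma integers_nbhs x : integers abs x -> nbhs x (integers abs).
Proof.
move=> Ix; have := nbhs0_shift x (abs_near0 K_local mu_haar abs_modulus).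
apply: filterS => _ [w w2 <-]; apply: integersD => //.
apply: le_trans w2 _; lra.
Qed.

Lemma integers_open : open (integers abs).
Proof. by rewrite openE => x; exact: integers_nbhs. Qed.

Lemma integers_closed : closed (integers abs).
Proof.
rewrite -[integers abs]setCK; apply: open_closedC; rewrite openE => x nx.
have := nbhs0_shift x (abs_near0 K_local mu_haar abs_modulus).
apply: filterS => _ [w w2 <-] Ixw; apply: nx.
rewrite -(addrK w x); apply: integersB => //.
apply: le_trans w2 _; lra.
Qed.

Lemma integers_compact : compact (integers abs).
Proof.
have [Z cZ sZ] := integers_in_compact.
exact: subclosed_compact integers_closed cZ sZ.
Qed.

Lemma integers_measurable : measurable (integers abs : set (borel K)).
Proof. exact: open_measurable_borel integers_open. Qed.

Variable varpi : K.
Hypothesis varpi_prime : prime_element abs varpi.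

Lemma varpi_neq0 : varpi != 0.
Proof.
have [w w0 w2] := nbhs0_nonzero K_local (abs_near0 K_local mu_haar abs_modulus).
apply/eqP => v0; have : abs w <= abs varpi.
  by apply: varpi_prime.2; apply: le_lt_trans w2 _; lra.
by rewrite v0 abs0 leNgt abs_gt0.
Qed.

Lemma max_idealE : max_ideal abs = [set varpi * x | x in integers abs].
Proof.
have v0 := varpi_neq0.
apply/seteqP; split => [x mx|_ [x Ix <-]].
  exists (varpi^-1 * x); last by rewrite mulVKf.
  rewrite /integers /= absM absV// mulrC ler_pdivrMr ?abs_gt0// mul1r.
  exact: varpi_prime.2.
rewrite /max_ideal /= absM.
by rewrite (le_lt_trans (ler_piMr (abs_ge0 _) Ix))//; exact: varpi_prime.1.
Qed.

Lemma max_ideal_integers : max_ideal abs `<=` integers abs.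
Proof. by move=> x /ltW. Qed.

Hypothesis mu_normalized : mu (integers abs) = 1%E.
Variable q : nat.
Hypothesis K_residue : residue_field_card abs q.

(** The integers are the disjoint union of q translates of varpi O, each of
    measure |varpi|. *)
Lemma abs_varpi : abs varpi = q%:R^-1.
Proof.
have [F [f [Fq [f1 fDM fsurj fker]]]] := K_residue.
have f0 : f 0 = 0 by apply/fker; rewrite /max_ideal /= ?abs0//; exact: integers0.
have fN x : integers abs x -> f (- x) = - f x.
  move=> Ix; apply/eqP; rewrite -addr_eq0 addrC.
  by rewrite -(fDM _ _ Ix (integersN Ix)).1 subrr f0.
pose rep (z : F) : K := sval (cid2 (fsurj z)).
have repP z : integers abs (rep z) /\ f (rep z) = z.
  by rewrite /rep; case: cid2.
pose A (z : F) := [set rep z + x | x in max_ideal abs].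
have fA z x : A z x -> integers abs x /\ f x = z.
  have [Iz fz] := repP z.
  move=> [w mw <-]; have Iw := max_ideal_integers mw.
  split; first exact: integersD.
  by rewrite (fDM _ _ Iz Iw).1 fz (fker _ Iw).2 ?addr0.
have mm : measurable (max_ideal abs : set (borel K)).
  apply: compact_measurable_borel => //; rewrite max_idealE.
  by apply: compact_scale; exact: integers_compact.
have mA z : measurable (A z : set (borel K)).
  apply: compact_measurable_borel => //; apply: compact_shift; rewrite max_idealE.
  by apply: compact_scale; exact: integers_compact.
have cover : integers abs = \bigcup_(z in [set: F]) A z.
  apply/seteqP; split => [x Ix|x [z _ /fA[]]//].
  exists (f x) => //; exists (x - rep (f x)); last by rewrite addrC subrK.
  have [Iz fz] := repP (f x).
  apply/fker; first exact: integersB.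
  by rewrite (fDM _ _ Ix (integersN Iz)).1 fN// fz subrr.
have : mu (integers abs : set (borel K)) = (\sum_(z \in [set: F]) mu (A z : set (borel K)))%E.
  rewrite cover measure_fin_bigcup//; first exact: finite_finset.
  by move=> z z' _ _ [x [/fA[_ <-] /fA[_ <-]]].
rewrite mu_normalized (eq_fsbigr (fun=> (abs varpi)%:E)); last first.
  move=> z _; rewrite (haar_translate mu_haar)// max_idealE.
  rewrite (modulus_scale abs_modulus) ?varpi_neq0//; last exact: integers_measurable.
  by rewrite mu_normalized mule1.
rewrite (fsbigE (enum F)) ?enum_uniq//=; last by move=> z _; rewrite mem_enum.
under eq_bigl do rewrite in_setT.
rewrite big_enum sumEFin sumr_const Fq => -[] /esym.
move=> h; rewrite -[LHS]mulr_natr in h.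
have q0 : (q%:R : R) != 0.
  by apply/eqP => q0; move: h; rewrite q0 mulr0 => /eqP; rewrite eq_sym oner_eq0.
by apply: (mulIf q0); rewrite mulVf.
Qed.

End IntegerRing.

(** * Coset representatives and the standard character *)
Section Digits.
Variable b : nat.
Hypothesis b_gt1 : (1 < b)%N.

Lemma digit0 n : digit b n 0 = (n %% b)%N.
Proof. by rewrite /digit expn0 divn1. Qed.

Lemma digitS n k : digit b n k.+1 = digit b (n %/ b) k.
Proof. by rewrite /digit expnS divnMA. Qed.

Lemma digit_cons0 s n : (s < b)%N -> digit b (s + b * n) 0 = s.
Proof. by move=> sb; rewrite digit0 addnC mulnC modnMDl modn_small. Qed.

Lemma digit_consS s n k : (s < b)%N -> digit b (s + b * n) k.+1 = digit b n k.
Proof.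
by move=> sb; rewrite digitS addnC mulnC divnMDl ?(ltnW b_gt1)// divn_small// addn0.
Qed.

Lemma digit_small n k : (n <= k)%N -> digit b n k = 0%N.
Proof.
move=> nk; rewrite /digit divn_small ?mod0n//.
by apply: leq_ltn_trans nk _; exact: ltn_expl.
Qed.

Lemma digit_undigit c (a : 'I_c -> nat) : (forall i, a i < b)%N ->
  exists2 s, (s < b ^ c)%N & forall i : 'I_c, digit b s i = a i.
Proof.
elim: c a => [|c ih] a ab; first by exists 0%N => // -[].
have [s sc sa] := ih (fun i => a (lift ord0 i)) (fun i => ab _).
exists (a ord0 + b * s)%N.
  rewrite expnS; apply: (@leq_trans (b * s.+1)%N); last by rewrite leq_mul2l sc orbT.
  by rewrite mulnS ltn_add2r.
move=> i; case: (unliftP ord0 i) => [j|] ->; last by rewrite digit_cons0.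
by rewrite digit_consS// sa.
Qed.

End Digits.

Section CosetReps.
Context {R : realType} {K : topologicalFieldType} {p c : nat}.
Variables (varpi : K) (eps : 'I_c -> K) (F : finFieldType) (f : {rmorphism F -> K}).
Hypothesis K_char : p \in [pchar K].
Hypothesis varpi0 : varpi != 0.
Local Notation q := (p ^ c)%N.
Hypothesis F_card : #|F| = q.
Hypothesis f_range : range f = prime_span eps.
Local Notation u := (coset_rep p varpi eps).

(** The Teichmueller representatives: the elements of the copy of GF(q) inside K,
    numbered by their coordinates in the basis eps. *)
Definition teich (n : nat) : K := \sum_(i < c) eps i *+ digit p n i.

Let p_gt1 : (1 < p)%N.
Proof. by rewrite prime_gt1// (pcharf_prime K_char). Qed.

Lemma q_gt1 : (1 < q)%N.
Proof. by rewrite -F_card card_finNzRing_gt1. Qed.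

Let q_gt0 : (0 < q)%N. Proof. exact: ltnW q_gt1. Qed.

Lemma teich0 : teich 0 = 0.
Proof. by rewrite /teich big1// => i _; rewrite /digit div0n mod0n mulr0n. Qed.

Lemma teich_range n : exists y, f y = teich n.
Proof.
have : prime_span eps (teich n) by exists (fun i : 'I_c => digit p n i).
by rewrite -f_range => -[y _ yn]; exists y.
Qed.

(** In characteristic p the coordinates may be reduced modulo p, and are then the
    base p digits of some n < q. *)
Lemma teich_surj y : exists2 s, (s < q)%N & teich s = f y.
Proof.
have : range f (f y) by exists y.
rewrite f_range => -[a fya].
have [s sq sa] := @digit_undigit p p_gt1 c (fun i => a i %% p)%N (fun i => ltn_pmod _ (ltnW p_gt1)).
exists s => //; rewrite fya /teich; apply: eq_bigr => i _.
rewrite sa [in RHS](divn_eq (a i) p) mulrnDr mulnC mulrnA.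
by rewrite (mulrn_pchar K_char) mul0rn add0r.
Qed.

Lemma teich_bij : exists2 g : 'I_q -> F, bijective g & forall s : 'I_q, f (g s) = teich s.
Proof.
pose h (y : F) : 'I_q := Ordinal (s2valP (cid2 (teich_surj y))).
have hP y : teich (h y) = f y by exact: (s2valP' (cid2 (teich_surj y))).
have h_inj : injective h.
  by move=> y z yz; apply: (fmorph_inj f); rewrite -!hP yz.
have [g hK gK] : bijective h by apply: inj_card_bij; rewrite ?card_ord ?F_card.
by exists g; [exists h|move=> s; rewrite -hP gK].
Qed.

Lemma teich_inj s t : (s < q)%N -> (t < q)%N -> teich s = teich t -> s = t.
Proof.
move=> sq tq st; have [g /bij_inj gi gP] := teich_bij.
have : g (Ordinal sq) = g (Ordinal tq) by apply: (fmorph_inj f); rewrite !gP.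
by move=> /gi [].
Qed.

(** The vanishing digits of large index contribute nothing, which frees the
    number of terms from n. *)
Lemma coset_rep_widen n M : (n < M)%N ->
  u n = \sum_(k < M) coset_rep0 p varpi eps (digit q n k) * varpi ^- k.
Proof.
move=> nM; rewrite /coset_rep.
rewrite (big_ord_widen _ (fun k : nat => coset_rep0 p varpi eps (digit q n k) * varpi ^- k) nM).
rewrite big_mkcond /=; apply: eq_bigr => k _; case: ltnP => // nk.
rewrite digit_small ?q_gt1 //; last exact: ltnW.
by rewrite /coset_rep0 -/(teich 0) teich0 !mul0r.
Qed.

(** Splitting off the last base q digit: the recursion behind all facts on u. *)
Lemma coset_rep_cons s n : (s < q)%N -> u (s + q * n) = varpi^-1 * (teich s + u n).
Proof.
move=> sq.
have big : (s + q * n < (s + q * n + n).+2)%N by rewrite ltnS leqW// leq_addr.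
rewrite (coset_rep_widen big) big_ord_recl digit_cons0 ?q_gt1// expr0 invr1 mulr1.
rewrite mulrDr /coset_rep0 -/(teich s) mulrC; congr (_ + _).
have nM : (n < (s + q * n + n).+1)%N by rewrite ltnS leq_addl.
rewrite (coset_rep_widen nM) mulr_sumr; apply: eq_bigr => k _.
by rewrite /coset_rep0 digit_consS ?q_gt1// exprS invfM; ring.
Qed.

Lemma coset_rep_0 : u 0 = 0.
Proof.
rewrite (@coset_rep_widen 0 1)// big_ord1 digit_small ?q_gt1//.
by rewrite /coset_rep0 -/(teich 0) teich0 !mul0r.
Qed.

Lemma coset_rep_small s : (s < q)%N -> varpi * u s = teich s.
Proof.
move=> sq; have := coset_rep_cons 0 sq.
by rewrite muln0 addn0 coset_rep_0 addr0 => ->; rewrite mulVKf.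
Qed.

Lemma coset_rep_shift n : u (q * n) = varpi^-1 * u n.
Proof. by have := coset_rep_cons n q_gt0; rewrite add0n teich0 add0r. Qed.

Lemma coset_ind (P : nat -> Prop) : P 0%N ->
  (forall s n, (s < q)%N -> (0 < s + q * n)%N -> P n -> P (s + q * n)%N) ->
  forall n, P n.
Proof.
move=> P0 PS; elim/ltn_ind => n ih.
have [->//|n0] := posnP n.
rewrite (divn_eq n q) addnC mulnC; apply: PS; first by rewrite ltn_mod.
  by rewrite mulnC addnC -divn_eq.
by apply: ih; rewrite ltn_Pdiv// q_gt1.
Qed.

Let split_q n : n = (n %% q + q * (n %/ q))%N.
Proof. by rewrite addnC mulnC -divn_eq. Qed.

(** The representatives form a group because there are no carries: digits are
    subtracted in GF(q), one position at a time. *)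
Lemma coset_rep_sub m n : exists k, u k = u m - u n.
Proof.
elim/coset_ind: m n => [|s m sq _ ih] n.
  elim/coset_ind: n => [|t n tq _ [k ih]].
    by exists 0%N; rewrite coset_rep_0 subr0.
  have [y ty] := teich_range t; have [r rq ry] := teich_surj (- y).
  exists (r + q * k)%N; rewrite !coset_rep_cons// ih ry rmorphN ty.
  by rewrite coset_rep_0; ring.
rewrite (split_q n).
set t := (n %% q)%N; have tq : (t < q)%N by rewrite ltn_mod.
have [k ihk] := ih (n %/ q)%N.
have [y ty] := teich_range t; have [z sz] := teich_range s.
have [r rq ry] := teich_surj (z - y).
exists (r + q * k)%N; rewrite !coset_rep_cons// ihk ry rmorphB ty sz.
ring.
Qed.

Lemma coset_rep_add m n : exists k, u k = u m + u n.
Proof.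
have [k0 h0] := coset_rep_sub 0 n; have [k h] := coset_rep_sub m k0.
by exists k; rewrite h h0 coset_rep_0 sub0r opprK.
Qed.

Variable chi : K -> R[i].
Hypothesis chi_standard : standard_character p varpi eps chi.

Let chiD := charD chi_standard.

Lemma chi_neq0 x : chi x != 0.
Proof. by rewrite -normr_eq0 (char_unitary chi_standard) oner_eq0. Qed.

Lemma chi0 : chi 0 = 1.
Proof. by apply: (mulfI (chi_neq0 0)); rewrite -chiD addr0 mulr1. Qed.

Lemma chi_conj x : (chi x)^* = chi (- x).
Proof.
apply: (mulfI (chi_neq0 x)); rewrite -chiD subrr chi0.
have := char_unitary chi_standard x; rewrite normc_def => h.
have : nsq (chi x) = 1.
  by move: h => [/(congr1 (fun r => r ^+ 2))]; rewrite sqr_sqrtr ?addr_ge0 ?sqr_ge0// expr1n nsqE.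
by rewrite mulrJ => ->.
Qed.

Lemma nsq_chi x : nsq (chi x) = 1.
Proof. by apply: (@complexI R); rewrite -mulrJ chi_conj -chiD subrr chi0. Qed.

Lemma chi_sum (I : Type) (r : seq I) (g : I -> K) :
  chi (\sum_(i <- r) g i) = \prod_(i <- r) chi (g i).
Proof.
elim: r => [|i r ih]; first by rewrite !big_nil chi0.
by rewrite !big_cons chiD ih.
Qed.

Lemma chi_mulrn x n : chi (x *+ n) = chi x ^+ n.
Proof. by elim: n => [|n ih]; rewrite ?mulr0n ?chi0// mulrS chiD ih exprS. Qed.

Lemma chi_trivial y (j : int) : j != 1 -> chi (f y * varpi ^ (- j)) = 1.
Proof.
move=> j1; have : range f (f y) by exists y.
rewrite f_range => -[a ->]; rewrite mulr_suml chi_sum big1// => i _.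
rewrite mulrnAl chi_mulrn (char_value chi_standard) (negbTE j1) andbF.
by rewrite expr1n.
Qed.

Lemma chi_trivial_nonneg y m : chi (f y * varpi ^+ m) = 1.
Proof.
rewrite (_ : varpi ^+ m = varpi ^ (- - m%:Z)); last by rewrite opprK.
by apply: chi_trivial; case: m.
Qed.

Hypothesis eps0 : forall i : 'I_c, i = 0%N :> nat -> eps i = 1.

(** Its real part is cos(2 pi / p) with 0 < 2 pi / p <= pi, where the cosine is
    injective. *)
Lemma chi_varpiV_neq1 : chi varpi^-1 != 1.
Proof.
have c0 : (0 < c)%N.
  by have := q_gt1; case: (c) => //; rewrite expn0.
have := char_value chi_standard (Ordinal c0) 1.
rewrite eps0// mul1r /= exprN1 => ->.
apply/eqP => -[h _]; have {}h : cos (2 * pi / p%:R) = cos 0 :> R by rewrite cos0.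
have p2 : (2 : R) <= p%:R by rewrite ler_nat.
have p0 : (0 : R) < p%:R by apply: lt_le_trans p2; lra.
have pi0 := pi_gt0 R.
have : 2 * pi / p%:R = 0 :> R.
  apply: cos_inj h; rewrite in_itv /= ?lexx ?pi_ge0//.
  rewrite divr_ge0 ?mulr_ge0 ?(ltW pi0) ?(ltW p0)//=.
  by rewrite ler_pdivrMr// mulrC ler_pM2l.
by apply/eqP; rewrite gt_eqF// divr_gt0// mulr_gt0.
Qed.

(** Multiplying by a power of varpi moves all the digits but the leading one to
    places where chi is trivial, and the leading one can be made 1. *)
Lemma chi_nontrivial k : k != 0%N ->
  exists y m, chi (u k * (f y * varpi ^+ m)) != 1.
Proof.
elim/coset_ind: k => // s k sq _ ih sk0.
rewrite coset_rep_cons//; have [k0|/ih[y [m h]]] := eqVneq k 0%N.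
  move: sk0; rewrite k0 muln0 addn0 coset_rep_0 addr0 => s0.
  have [y ys] := teich_range s.
  have y0 : y != 0.
    apply: contra s0 => /eqP y0; apply/eqP/(teich_inj sq q_gt0).
    by rewrite -ys y0 rmorph0 teich0.
  exists y^-1, 0%N; rewrite expr0 mulr1 -ys -mulrA -rmorphM divff//.
  by rewrite rmorph1 mulr1 chi_varpiV_neq1.
exists y, m.+1; have [z zs] := teich_range s.
rewrite exprS (_ : _ * _ = f (z * y) * varpi ^+ m + u k * (f y * varpi ^+ m)).
  by rewrite chiD chi_trivial_nonneg mul1r.
by rewrite rmorphM /= zs; field.
Qed.

(** Removing the last digits from u(m) = u(n) leaves an element of GF(q) of the
    form u(k); chi being trivial on GF(q) varpi^j for j >= 0, [chi_nontrivial]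
    gives k = 0. *)
Lemma coset_rep_inj : injective u.
Proof.
move=> m n; elim/coset_ind: m n => [|s m sq _ ih] n.
  rewrite coset_rep_0 => /esym un0; apply/eqP/negPn/negP; rewrite eq_sym => /chi_nontrivial.
  by move=> [y [k]]; rewrite un0 mul0r chi0 eqxx.
rewrite (split_q n).
set t := (n %% q)%N; have tq : (t < q)%N by rewrite ltn_mod.
set n' := (n %/ q)%N; rewrite !coset_rep_cons// => /(mulfI (invr_neq0 varpi0)) h.
have [k hk] := coset_rep_sub n' m.
have [y ty] := teich_range t; have [z sz] := teich_range s.
have hfy : f (z - y) = u k.
  rewrite hk rmorphB /= ty sz; apply/eqP.
  by rewrite subr_eq addrAC eq_sym subr_eq h addrC.
have k0 : k = 0%N.
  apply/eqP/negPn/negP => /chi_nontrivial[x [j]].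
  by rewrite -hfy mulrA -rmorphM chi_trivial_nonneg eqxx.
have st : s = t.
  apply: teich_inj => //; rewrite -ty -sz; apply/eqP.
  by rewrite -subr_eq0 -rmorphB /= hfy k0 coset_rep_0.
congr (_ + q * _)%N => //; apply: ih.
by move: h; rewrite st => /addrI.
Qed.

(** All the terms have order at most -2 in varpi, and chi only sees order -1. *)
Lemma chi_low n j y : chi (varpi ^- j.+1 * u n * f y) = 1.
Proof.
elim/coset_ind: n j => [|s n sq _ ih] j.
  by rewrite coset_rep_0 mulr0 mul0r chi0.
have [z zs] := teich_range s.
rewrite coset_rep_cons// [X in chi X](_ : _ = f (z * y) * varpi ^ (- j.+2%:Z) + varpi ^- j.+2 * u n * f y).
  by rewrite chiD ih mulr1 chi_trivial.
by rewrite rmorphM /= zs -exprnN !exprS; field; rewrite expf_neq0.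
Qed.

(** Orthogonality of additive characters on GF(q): only the last digit of t
    matters, and x |-> chi(x / varpi) is a nontrivial character of GF(q). *)
Lemma chi_sum_teich t :
  \sum_(s < q) chi (u t * teich s) = if (q %| t)%N then q%:R else 0.
Proof.
rewrite (split_q t).
set r := (t %% q)%N; have rq : (r < q)%N by rewrite ltn_mod.
set n := (t %/ q)%N.
have [g gb gP] := teich_bij.
have [z zr] := teich_range r.
have E (s : 'I_q) : chi (u (r + q * n) * teich s) = chi (varpi^-1 * f (z * g s)).
  rewrite coset_rep_cons// -gP [X in chi X](_ : _ = varpi^-1 * f (z * g s) + varpi ^- 1 * u n * f (g s)).
    by rewrite chiD chi_low mulr1.
  rewrite rmorphM /= zr expr1; ring.
under eq_bigr do rewrite E.
rewrite -(reindex g (F := fun x => chi (varpi^-1 * f (z * x))) (P := xpredT)) /=; last exact: onW_bij.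
rewrite dvdn_addl ?dvdn_mulr//.
have [r0|r0] := posnP r.
  have -> : z = 0 by apply: (fmorph_inj f); rewrite zr r0 teich0 rmorph0.
  rewrite r0 dvdn0 (eq_bigr (fun=> 1)); first by rewrite sumr_const F_card.
  by move=> x _; rewrite mul0r rmorph0 mulr0 chi0.
rewrite gtnNdvd//.
have z0 : z != 0.
  apply/eqP => z0; move: r0; rewrite (_ : r = 0%N)//.
  by apply: teich_inj => //; rewrite teich0 -zr z0 rmorph0.
set S := \sum_x _; apply/eqP/negPn/negP => S0.
(* Translating the summation variable by 1 / z multiplies the sum by chi(1 / varpi). *)
have : chi varpi^-1 * S = S.
  rewrite /S mulr_sumr [RHS](reindex (fun x => z^-1 + x)); last first.
    by apply: onW_bij; exists (fun x => - z^-1 + x) => x; rewrite ?addKr ?addNKr.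
  apply: eq_bigr => x _; rewrite -chiD; congr chi.
  by rewrite mulrDr divff// rmorphD rmorph1 mulrDr mulr1.
move=> h; have := chi_varpiV_neq1; rewrite -(inj_eq (mulIf S0)) h mul1r.
by rewrite eqxx.
Qed.

Variable abs : K -> R.
Hypotheses (abs0 : abs 0 = 0) (absM : forall x y, abs (x * y) = abs x * abs y)
  (abs_gt0 : forall x, x != 0 -> 0 < abs x).

(** The powers of f(y) return to f(y), by Fermat's theorem in GF(q). *)
Lemma abs_unit y : y != 0 -> abs (f y) = 1.
Proof.
move=> y0; have a0 : 0 < abs (f y) by rewrite abs_gt0// fmorph_eq0.
have absX n : abs (f y ^+ n.+1) = abs (f y) ^+ n.+1.
  by elim: n => // n ih; rewrite exprS absM ih -exprS.
have : abs (f y) ^+ q = abs (f y).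
  case: (q) q_gt0 F_card => // n _ Fn; rewrite -absX -rmorphXn -Fn finfield.expf_card//.
have : (1 < q)%N by exact: q_gt1.
case: (q) => // -[//|n] _; rewrite exprS => h.
have : abs (f y) ^+ n.+1 = 1.
  by apply: (mulfI (lt0r_neq0 a0)); rewrite h mulr1.
by move=> /eqP; rewrite pexpr_eq1 ?(ltW a0)// => /eqP.
Qed.

End CosetReps.

(** * Change of variables *)
Section Transport.
Context {R : realType} {d : measure_display} {T : measurableType d}.
Variable mu : {measure set T -> \bar R}.
Variables (phi : T -> T) (k : R).
Hypothesis mphi : measurable_fun [set: T] phi.
Hypothesis k_ge0 : 0 <= k.
Hypothesis phi_scale : forall A, measurable A -> mu (phi @^-1` A) = (k%:E * mu A)%E.
Let mphi_mixin := isMeasurableFun.Build _ _ _ _ _ mphi.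
Let mphi_pack : {mfun T >-> T} := HB.pack phi mphi_mixin.

(** A map that scales the measure by k scales integrals by k; affine maps of the
    field are the case of interest. *)
Lemma ge0_integral_transport D (f : T -> \bar R) : measurable D ->
  measurable_fun D f -> (forall x, D x -> (0 <= f x)%E) ->
  (\int[mu]_(x in phi @^-1` D) f (phi x) = k%:E * \int[mu]_(x in D) f x)%E.
Proof.
move=> mD mf f0.
have := ge0_integral_pushforward mphi mu mD mf (fun x xD => f0 x (set_mem xD)).
rewrite /comp => <-.
rewrite (@eq_measure_integral _ _ _ D (mscale (NngNum k_ge0) mu) (pushforward mu mphi_pack)).
  by rewrite ge0_integral_mscale.
by move=> A mA _; exact: phi_scale.
Qed.

Lemma complex_measurable_comp (f : T -> R[i]) : complex_measurable f ->
  complex_measurable (fun x => f (phi x)).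
Proof. by move=> [fr fi]; split; [exact: (measurableT_comp fr mphi)|exact: (measurableT_comp fi mphi)]. Qed.

Lemma sqnorm_on_transport D (f : T -> R[i]) : measurable D -> complex_measurable f ->
  sqnorm_on mu (phi @^-1` D) (fun x => f (phi x)) = (k%:E * sqnorm_on mu D f)%E.
Proof.
move=> mD mf; rewrite /sqnorm_on.
rewrite (ge0_integral_transport (f := fun x => (Normc.normc (f x) ^+ 2)%:E))//.
  apply/measurable_EFinP; apply: measurable_funS (measurable_nsq mf) => //.
by move=> x _; rewrite lee_fin nsq_ge0.
Qed.

Lemma L2on_transport D (f : T -> R[i]) : measurable D -> L2on mu D f ->
  L2on mu (phi @^-1` D) (fun x => f (phi x)).
Proof.
move=> mD [mf foo]; split; first exact: complex_measurable_comp.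
by rewrite sqnorm_on_transport// lte_mul_pinfty.
Qed.

Let Rintegral_transport D (f : T -> R) : measurable D ->
  mu.-integrable D (EFin \o f) ->
  \int[mu]_(x in phi @^-1` D) f (phi x) = k * \int[mu]_(x in D) f x.
Proof.
move=> mD fi; have mf := measurable_int mu fi.
rewrite /Rintegral integralE.
rewrite (_ : (fun x => (f (phi x))%:E) = (EFin \o f) \o phi)//.
rewrite funepos_comp funeneg_comp /comp.
rewrite ge0_integral_transport//; last exact: measurable_funepos.
rewrite ge0_integral_transport//; last exact: measurable_funeneg.
have -> : (\int[mu]_(x in D) (f x)%:E = \int[mu]_(x in D) (EFin \o f)^\+ x -
    \int[mu]_(x in D) (EFin \o f)^\- x)%E by exact: integralE.
have fp := integrable_pos_fin_num mD fi; have fn := integrable_neg_fin_num mD fi.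
rewrite -[k in RHS]/(fine k%:E) -fineM//; last by rewrite fin_numB fp fn.
by rewrite [in RHS]muleBr// fin_num_adde_defl// fin_numN.
Qed.

Lemma complex_integral_transport D (f : T -> R[i]) : measurable D ->
  complex_integrable mu D f ->
  complex_integral mu (phi @^-1` D) (fun x => f (phi x)) =
    k%:C * complex_integral mu D f.
Proof.
move=> mD [fr fi]; rewrite /complex_integral.
rewrite (Rintegral_transport mD fr) (Rintegral_transport mD fi).
by apply/eqP; rewrite eq_complex /= !mul0r subr0 addr0 !eqxx.
Qed.

Lemma ip_transport D (f g : T -> R[i]) : measurable D -> L2on mu D f -> L2on mu D g ->
  ip mu (phi @^-1` D) (fun x => f (phi x)) (fun x => g (phi x)) = k%:C * ip mu D f g.
Proof.
move=> mD Lf Lg; rewrite /ip.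
rewrite (complex_integral_transport (f := fun x => f x * (g x)^*))//.
exact: L2onM_integrable.
Qed.

End Transport.

Section Affine.
Context {R : realType} {K : topologicalFieldType}.
Variable mu : {measure set (borel K) -> \bar R}.
Variable abs : K -> R.
Hypothesis K_local : local_field K.
Hypothesis mu_haar : haar_measure mu.
Hypothesis abs_modulus : modulus mu abs.
Variables (a b : K).
Hypothesis a0 : a != 0.

Definition affine (x : borel K) : borel K := (a * (x : K) + b : K).

Lemma continuous_measurable_borel (g : K -> K) : continuous g ->
  measurable_fun [set: borel K] (g : borel K -> borel K).
Proof.
move=> cg; apply: (@measurability _ _ (borel K) (borel K) _ _ (@open K)) => //.
move=> _ [A oA <-].
rewrite setTI; apply: open_measurable_borel.
by apply: open_comp => // x _; exact: cg.
Qed.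

Lemma affine_measurable : measurable_fun [set: borel K] affine.
Proof.
apply: continuous_measurable_borel => x.
apply: (@continuous_comp K K K (fun x => a * x) (fun x => x + b)).
  exact: mull_continuous.
move: (a * x) => {}x.
have -> : (fun x : K => x + b) = (fun x => b + x) by apply/funext => y; rewrite addrC.
exact: addl_continuous.
Qed.

Lemma affine_haar (A : set (borel K)) : measurable A ->
  mu (affine @^-1` A) = (((abs a)^-1)%:E * mu A)%E.
Proof.
move=> mA.
have mA' : measurable ([set - b + x | x in (A : set K)] : set (borel K)).
  have := continuous_measurable_borel (@addl_continuous K b) (@measurableT _ (borel K)) mA.
  by rewrite setTI shift_preimage opprK.
rewrite (_ : affine @^-1` A = [set a^-1 * x | x in [set - b + x | x in (A : set K)]]).
  rewrite (modulus_scale abs_modulus) ?invr_neq0//.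
  by rewrite (haar_translate mu_haar)// (absV K_local mu_haar abs_modulus).
rewrite scale_preimage ?invr_neq0// shift_preimage !opprK invrK.
by apply/seteqP; split => x /=; rewrite /affine addrC.
Qed.

End Affine.

(** * Operations on convergent sequences; square summable sequences *)
Section L2convergence.
Context {R : realType} {d : measure_display} {T : measurableType d}.
Variables (mu : {measure set T -> \bar R}) (D : set T).
Hypothesis mD : measurable D.
Implicit Types (f g : T -> R[i]) (F G : nat -> T -> R[i]).

Lemma complex_measurableB f g : complex_measurable f -> complex_measurable g ->
  complex_measurable (fun x => f x - g x).
Proof.
move=> mf mg; apply: complex_measurableD => //.
under eq_fun do rewrite -mulN1r.
by apply: complex_measurableM => //; exact: complex_measurable_cst.
Qed.

Lemma squeeze_L2_cvg F f (e : nat -> \bar R) :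
  (forall n, (sqnorm_on mu D (fun x => F n x - f x)%R <= e n)%E) ->
  e @ \oo --> 0%E -> L2_cvg_on mu D F f.
Proof.
move=> le_e e0; apply: (@squeeze_cvge _ _ _ _ (fun=> 0%E) _ e) => //.
  by apply: nearW => n; rewrite sqnorm_on_ge0 le_e.
exact: cvg_cst.
Qed.

Lemma eq_L2_cvg F f G g : (forall n x, F n x = G n x) -> (forall x, f x = g x) ->
  L2_cvg_on mu D F f -> L2_cvg_on mu D G g.
Proof.
move=> FG fg; rewrite (_ : F = G); last by apply/funext => n; apply/funext.
by rewrite (_ : f = g)//; apply/funext.
Qed.

Lemma L2_cvg_cst f : L2_cvg_on mu D (fun=> f) f.
Proof.
apply: (@squeeze_L2_cvg _ _ (fun=> 0%E)); last exact: cvg_cst.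
move=> n; under eq_fun do rewrite subrr.
by rewrite /sqnorm_on integral0_eq// => x _; rewrite -/(nsq _) nsq0.
Qed.

Lemma L2_cvgD F f G g : (forall n, complex_measurable (F n)) -> complex_measurable f ->
  (forall n, complex_measurable (G n)) -> complex_measurable g ->
  L2_cvg_on mu D F f -> L2_cvg_on mu D G g ->
  L2_cvg_on mu D (fun n x => F n x + G n x) (fun x => f x + g x).
Proof.
move=> mF mf mG mg Ff Gg.
apply: (@squeeze_L2_cvg _ _ (fun n => 2%:E * (sqnorm_on mu D (fun x => F n x - f x)%R +
   sqnorm_on mu D (fun x => G n x - g x)%R))%E).
  move=> n; under eq_fun do rewrite opprD addrACA.
  by apply: sqnorm_onD_le => //; exact: complex_measurableB.
have -> : (0 = 2%:E * (0 + 0) :> \bar R)%E by rewrite adde0 mule0.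
apply: cvgeZl => //; exact: cvgeD.
Qed.

Lemma L2_cvg_sum (I : Type) (s : seq I) (P : pred I) (F : I -> nat -> T -> R[i])
    (f : I -> T -> R[i]) :
  (forall i n, complex_measurable (F i n)) -> (forall i, complex_measurable (f i)) ->
  (forall i, L2_cvg_on mu D (F i) (f i)) ->
  L2_cvg_on mu D (fun n x => \sum_(i <- s | P i) F i n x) (fun x => \sum_(i <- s | P i) f i x).
Proof.
move=> mF mf Ff; elim: s => [|i s ih].
  by apply: (eq_L2_cvg (F := fun _ _ => 0) (f := fun=> 0)) (L2_cvg_cst _) => *; rewrite big_nil.
apply: (eq_L2_cvg (F := fun n x => (if P i then F i n x else 0) + \sum_(j <- s | P j) F j n x)
  (f := fun x => (if P i then f i x else 0) + \sum_(j <- s | P j) f j x)).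
- by move=> n x; rewrite big_cons; case: ifP => // _; rewrite add0r.
- by move=> x; rewrite big_cons; case: ifP => // _; rewrite add0r.
apply: L2_cvgD => //.
- by case: (P i) => // n; exact: complex_measurable_cst.
- by case: (P i) => //; exact: complex_measurable_cst.
- by move=> n; exact: complex_measurable_sum.
- exact: complex_measurable_sum.
- by case: (P i) => //; exact: L2_cvg_cst.
Qed.

Lemma L2_cvgZ w F f : (forall n, complex_measurable (F n)) -> complex_measurable f ->
  L2_cvg_on mu D F f -> L2_cvg_on mu D (fun n x => w * F n x) (fun x => w * f x).
Proof.
move=> mF mf Ff.
apply: (@squeeze_L2_cvg _ _ (fun n => (nsq w)%:E * sqnorm_on mu D (fun x => F n x - f x)%R)%E).
  move=> n; rewrite -sqnorm_onZ//; last exact: complex_measurableB.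
  by under eq_fun do rewrite -mulrBr.
have -> : (0 = (nsq w)%:E * 0 :> \bar R)%E by rewrite mule0.
exact: cvgeZl.
Qed.

Lemma L2_cvg_mul_bounded F f g (C : R) : (forall n, complex_measurable (F n)) ->
  complex_measurable f -> complex_measurable g -> (forall x, nsq (g x) <= C) ->
  L2_cvg_on mu D F f ->
  L2_cvg_on mu D (fun n x => F n x * g x) (fun x => f x * g x).
Proof.
move=> mF mf mg gC Ff.
have C0 : 0 <= C by apply: le_trans (gC point); exact: nsq_ge0.
pose w : R[i] := (Num.sqrt C)%:C.
have wC : nsq w = C by rewrite nsq_real sqr_sqrtr.
apply: (@squeeze_L2_cvg _ _ (fun n => (nsq w)%:E * sqnorm_on mu D (fun x => F n x - f x)%R)%E).
  move=> n; rewrite -sqnorm_onZ//; last exact: complex_measurableB.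
  apply: le_sqnorm_on => //.
  - by apply: complex_measurableB; exact: complex_measurableM.
  - by apply: complex_measurableM; [exact: complex_measurable_cst|exact: complex_measurableB].
  - by move=> x _; rewrite -mulrBl !nsqM wC mulrC ler_wpM2r// nsq_ge0.
have -> : (0 = (nsq w)%:E * 0 :> \bar R)%E by rewrite mule0.
exact: cvgeZl.
Qed.

Lemma L2_cvgJ F f : L2_cvg_on mu D F f ->
  L2_cvg_on mu D (fun n x => (F n x)^*) (fun x => (f x)^*).
Proof.
apply: squeeze_L2_cvg => n; rewrite le_eqVlt; apply/orP; left; apply/eqP.
by apply: eq_sqnorm_on => x _; rewrite -rmorphB nsqJ.
Qed.

Lemma L2onJ f : L2on mu D f -> L2on mu D (fun x => (f x)^*).
Proof.
move=> [mf foo]; split; first exact: complex_measurableJ.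
by rewrite (@eq_sqnorm_on _ _ _ mu D _ f)// => x _; rewrite nsqJ.
Qed.

Lemma L2onM_bounded f g (C : R) : complex_measurable g -> (forall x, nsq (g x) <= C) ->
  L2on mu D f -> L2on mu D (fun x => f x * g x).
Proof.
move=> mg gC [mf foo]; split; first exact: complex_measurableM.
have C0 : 0 <= C by apply: le_trans (gC point); exact: nsq_ge0.
pose w : R[i] := (Num.sqrt C)%:C.
have wC : nsq w = C by rewrite nsq_real sqr_sqrtr.
apply: (@le_lt_trans _ _ (sqnorm_on mu D (fun x => w * f x))).
  apply: le_sqnorm_on => //; first exact: complex_measurableM.
    by apply: complex_measurableM => //; exact: complex_measurable_cst.
  by move=> x _; rewrite !nsqM wC mulrC ler_wpM2r// nsq_ge0.
by rewrite sqnorm_onZ// lte_mul_pinfty// lee_fin nsq_ge0.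
Qed.

End L2convergence.

Section SquareSummable.
Context {R : realType}.
Implicit Types (a b : nat -> R[i]) (rho : nat -> nat).

Definition cnt : {measure set nat -> \bar R} := [the measure _ _ of counting].

Definition sqn a : \bar R := sqnorm_on cnt [set: nat] a.
(** Square summable sequences are the square integrable functions for counting
    measure, so the results on those apply to them. *)
Definition l2 a : Prop := L2on cnt [set: nat] a.

Lemma complex_measurable_nat a : complex_measurable a.
Proof. by split. Qed.

Lemma sqnE a : sqn a = (\esum_(k in [set: nat]) (nsq (a k))%:E)%E.
Proof.
rewrite /sqn /sqnorm_on ge0_integral_count; last by move=> k; rewrite lee_fin nsq_ge0.
rewrite nneseries_esum; last by move=> k _; rewrite lee_fin nsq_ge0.
by congr esum; apply/seteqP; split.
Qed.

Lemma l2P a : l2 a <-> (sqn a < +oo)%E.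
Proof. by split => [[]//|aoo]; split => //; exact: complex_measurable_nat. Qed.

Lemma sqn_partial a n : ((\sum_(k < n) nsq (a k))%:E <= sqn a)%E.
Proof.
rewrite sqnE -nneseries_esumT; last by move=> k; rewrite lee_fin nsq_ge0.
rewrite -sumEFin.
rewrite -(big_mkord xpredT (fun k => (nsq (a k))%:E)).
by apply: nneseries_lim_ge => k _; rewrite lee_fin nsq_ge0.
Qed.

Lemma sqn_le a (C : R) : (forall n, \sum_(k < n) nsq (a k) <= C) -> (sqn a <= C%:E)%E.
Proof.
move=> aC; rewrite sqnE -nneseries_esumT; last by move=> k; rewrite lee_fin nsq_ge0.
apply: lime_le; first by apply: is_cvg_nneseries => k _ _; rewrite lee_fin nsq_ge0.
by apply: nearW => n; rewrite big_mkord sumEFin lee_fin.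
Qed.

Lemma sqn_finite a M : (forall k, (M <= k)%N -> a k = 0) ->
  sqn a = (\sum_(k < M) nsq (a k))%:E.
Proof.
move=> aM; apply/eqP; rewrite eq_le sqn_partial andbT; apply: sqn_le => n.
have [nM|/ltnW Mn] := leqP n M.
  rewrite -(subnKC nM) big_split_ord /= lerDl sumr_ge0// => i _; exact: nsq_ge0.
rewrite -(subnKC Mn) big_split_ord /= gerDl big1// => i _.
by rewrite aM ?leq_addr// nsq0.
Qed.

Lemma sqn_comp a rho : injective rho -> (sqn (a \o rho) <= sqn a)%E.
Proof.
move=> inj_rho; rewrite !sqnE.
rewrite -(@esum_image _ _ _ [set: nat] rho (fun k => (nsq (a k))%:E)).
  by rewrite esum_mkcond; apply: le_esum => k _; case: ifP => // _; rewrite lee_fin nsq_ge0.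
exact: in2W.
Qed.

Lemma l2_comp a rho : injective rho -> l2 a -> l2 (a \o rho).
Proof. by move=> ir /l2P aoo; apply/l2P; apply: le_lt_trans aoo; exact: sqn_comp. Qed.

Definition trunc n a : nat -> R[i] := fun k => if (k < n)%N then a k else 0.

Lemma l2_finite a M : (forall k, (M <= k)%N -> a k = 0) -> l2 a.
Proof. by move=> aM; apply/l2P; rewrite (sqn_finite aM) ltry. Qed.

Lemma l2_trunc n a : l2 (trunc n a).
Proof. by apply: (@l2_finite _ n) => k nk; rewrite /trunc ltnNge nk. Qed.

Lemma cvg_partial_sqn a : l2 a ->
  (fun n => \sum_(k < n) nsq (a k)) @ \oo --> nrm2 cnt [set: nat] a.
Proof.
move=> La; suff : (fun n => (\sum_(k < n) nsq (a k))%:E) @ \oo --> (nrm2 cnt [set: nat] a)%:E.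
  by move/fine_cvg.
rewrite -L2on_nrm2// -/(sqn a) sqnE -nneseries_esumT; last first.
  by move=> k; rewrite lee_fin nsq_ge0.
rewrite (_ : (fun n => _) = (fun n => (\sum_(0 <= k < n) (nsq (a k))%:E)%E)).
  by apply: is_cvg_nneseries => k _ _; rewrite lee_fin nsq_ge0.
by apply/funext => n; rewrite big_mkord sumEFin.
Qed.

Lemma cvg_trunc a : l2 a -> L2_cvg_on cnt [set: nat] (fun n => trunc n a) a.
Proof.
move=> La.
have sa := cvg_partial_sqn La.
have E n : nrm2 cnt [set: nat] (fun k => trunc n a k - a k) =
    nrm2 cnt [set: nat] a - \sum_(k < n) nsq (a k).
  apply/eqP; rewrite eq_sym subr_eq; apply/eqP.
  have Lt := l2_trunc n a.
  have Ld : l2 (fun k => trunc n a k - a k) by exact: L2onB.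
  apply: EFin_inj; rewrite EFinD -!L2on_nrm2// -/(sqn _) -/(sqn _).
  have -> : (\sum_(k < n) nsq (a k))%:E = sqn (trunc n a).
    rewrite (sqn_finite (M := n)); last by move=> k nk; rewrite /trunc ltnNge nk.
    by congr EFin; apply: eq_bigr => k _; rewrite /trunc ltn_ord.
  rewrite !sqnE -esumD; try by move=> *; rewrite lee_fin nsq_ge0.
  apply: eq_esum => k _; rewrite -EFinD /trunc; case: ifP => _.
    by rewrite subrr nsq0 add0r.
  by rewrite sub0r nsqN nsq0 addr0.
apply: nrm2_L2_cvg => //; first by move=> n; exact: l2_trunc.
under eq_fun do rewrite E.
have h := cvgB (cvg_cst (nrm2 cnt [set: nat] a)) sa.
by rewrite subrr in h; exact: h.
Qed.

(** Coefficient families are compared through their moduli, which disregards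
    conjugations and unimodular factors. *)
Lemma l2_scaled (v w : nat -> R[i]) (e : R) : 0 <= e ->
  (forall m, nsq (v m) = e * nsq (w m)) -> l2 w ->
  l2 v /\ nrm2 cnt [set: nat] v = e * nrm2 cnt [set: nat] w.
Proof.
move=> e0 vw Lw; pose z : R[i] := (Num.sqrt e)%:C.
have ze : nsq z = e by rewrite nsq_real sqr_sqrtr.
have E : sqn v = sqn (fun m => z * w m).
  by rewrite !sqnE; apply: eq_esum => m _; rewrite vw -ze -nsqM.
split; first by apply/l2P; rewrite E; apply/l2P; exact: (L2onZ measurableT z Lw).
by rewrite -ze -(nrm2Z measurableT z Lw) /nrm2 -/(sqn v) E.
Qed.

End SquareSummable.

(** * The normalized setting *)

(** The standing data of the field, bundled so that what follows rests on one
    hypothesis. *)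
Record normalized_local_field {R : realType} {K : topologicalFieldType} (p c : nat)
    (mu : {measure set (borel K) -> \bar R}) (abs : K -> R) (varpi : K)
    (eps : 'I_c -> K) (chi : K -> R[i]) : Prop := NormalizedLocalField {
  nlf_local : local_field K ;
  nlf_char : p \in [pchar K] ;
  nlf_haar : haar_measure mu ;
  nlf_modulus : modulus mu abs ;
  nlf_normalized : mu (integers abs) = 1%E ;
  nlf_prime : prime_element abs varpi ;
  nlf_residue : residue_field_card abs (p ^ c) ;
  nlf_basis : residue_basis abs (p ^ c) eps ;
  nlf_chi : standard_character p varpi eps chi }.

Section NormalizedLocalField.
Context {R : realType} {K : topologicalFieldType} {p c : nat}.
Variables (mu : {measure set (borel K) -> \bar R}) (abs : K -> R) (varpi : K)
  (eps : 'I_c -> K) (chi : K -> R[i]).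
Hypothesis S : normalized_local_field p mu abs varpi eps chi.
Local Notation q := (p ^ c)%N.
Local Notation u := (coset_rep p varpi eps).
Local Notation O := (integers abs).
Local Notation teich := (teich (p := p) eps).

Let K_local := nlf_local S.
Let K_char := nlf_char S.
Let mu_haar := nlf_haar S.
Let abs_modulus := nlf_modulus S.
Let mu_normalized := nlf_normalized S.
Let varpi_prime := nlf_prime S.
Let chi_standard := nlf_chi S.

Lemma nlf_varpi0 : varpi != 0.
Proof. exact: (varpi_neq0 K_local mu_haar abs_modulus varpi_prime). Qed.
Let varpi0 := nlf_varpi0.

Lemma nlf_absM x y : abs (x * y) = abs x * abs y.
Proof. exact: (absM K_local mu_haar abs_modulus). Qed.

Lemma nlf_abs_gt0 x : x != 0 -> 0 < abs x.
Proof. exact: (abs_gt0 K_local mu_haar abs_modulus). Qed.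

Lemma nlf_abs_varpi : abs varpi = q%:R^-1.
Proof.
exact: (abs_varpi K_local mu_haar abs_modulus K_char varpi_prime mu_normalized (nlf_residue S)).
Qed.

Lemma nlf_OD x y : O x -> O y -> O (x + y).
Proof. exact: (integersD K_local mu_haar abs_modulus K_char). Qed.

Lemma nlf_ON x : O x -> O (- x).
Proof. exact: (integersN K_local mu_haar abs_modulus). Qed.

Lemma nlf_OB x y : O x -> O y -> O (x - y).
Proof. by move=> Ox Oy; apply: nlf_OD => //; exact: nlf_ON. Qed.

Lemma nlf_OM x y : O x -> O y -> O (x * y).
Proof. exact: (integersM K_local mu_haar abs_modulus). Qed.

Lemma nlf_compactO : compact O.
Proof. exact: (integers_compact K_local mu_haar abs_modulus K_char). Qed.

Lemma nlf_measurableO : measurable (O : set (borel K)).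
Proof. exact: (integers_measurable K_local mu_haar abs_modulus K_char). Qed.

Let teichmuller : exists (F : finFieldType) (f : {rmorphism F -> K}),
  #|F| = q /\ range f = prime_span eps.
Proof. by have [_ _] := nlf_basis S. Qed.

Let eps0 : forall i : 'I_c, i = 0%N :> nat -> eps i = 1.
Proof. by have [] := nlf_basis S. Qed.

Lemma nlf_q_gt1 : (1 < q)%N.
Proof. by have [F [f [Fq _]]] := teichmuller; exact: (q_gt1 Fq). Qed.
Let q_gt1 := nlf_q_gt1.

Lemma nlf_q_gt0 : (0 < q)%N. Proof. exact: ltnW q_gt1. Qed.

Lemma nlf_varpiO : O varpi.
Proof. by apply/ltW; exact: varpi_prime.1. Qed.

Lemma nlf_varpiXO n : O (varpi ^+ n).
Proof.
elim: n => [|n ih]; last by rewrite exprS; apply: nlf_OM => //; exact: nlf_varpiO.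
by rewrite /integers /= (abs1 K_local mu_haar abs_modulus).
Qed.

Let f_abs (F : finFieldType) (f : {rmorphism F -> K}) y : #|F| = q -> y != 0 -> abs (f y) = 1.
Proof.
move=> Fq; apply: (abs_unit f Fq); [exact: nlf_absM|exact: nlf_abs_gt0].
Qed.

Let f_O (F : finFieldType) (f : {rmorphism F -> K}) y : #|F| = q -> O (f y).
Proof.
move=> Fq; have [->|y0] := eqVneq y 0; last by rewrite /integers /= f_abs.
by rewrite rmorph0 /integers /= (abs0 abs_modulus).
Qed.

Lemma nlf_teichO n : O (teich n).
Proof.
have [F [f [Fq fr]]] := teichmuller; have [y <-] := teich_range (p := p) fr n.
exact: f_O.
Qed.

Lemma nlf_u0 : u 0 = 0.
Proof. by have [F [f [Fq fr]]] := teichmuller; exact: (coset_rep_0 varpi eps Fq). Qed.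

Lemma nlf_u_cons s n : (s < q)%N -> u (s + q * n) = varpi^-1 * (teich s + u n).
Proof. by have [F [f [Fq fr]]] := teichmuller; exact: (coset_rep_cons varpi eps Fq). Qed.

Lemma nlf_u_small s : (s < q)%N -> varpi * u s = teich s.
Proof. by have [F [f [Fq fr]]] := teichmuller; exact: (coset_rep_small eps varpi0 Fq). Qed.

Lemma nlf_u_shift n : u (q * n) = varpi^-1 * u n.
Proof. by have [F [f [Fq fr]]] := teichmuller; exact: (coset_rep_shift varpi eps Fq). Qed.

Lemma nlf_u_sub m n : exists k, u k = u m - u n.
Proof. by have [F [f [Fq fr]]] := teichmuller; exact: (coset_rep_sub varpi K_char Fq fr). Qed.

Lemma nlf_u_add m n : exists k, u k = u m + u n.
Proof. by have [F [f [Fq fr]]] := teichmuller; exact: (coset_rep_add varpi K_char Fq fr). Qed.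

Lemma nlf_u_inj : injective u.
Proof.
have [F [f [Fq fr]]] := teichmuller.
exact: (coset_rep_inj K_char varpi0 Fq fr chi_standard eps0).
Qed.

Lemma nlf_chiD x y : chi (x + y) = chi x * chi y.
Proof. exact: (charD chi_standard). Qed.

Lemma nlf_chi_conj x : (chi x)^* = chi (- x).
Proof. exact: (chi_conj chi_standard). Qed.

Lemma nlf_nsq_chi x : nsq (chi x) = 1.
Proof. exact: (nsq_chi chi_standard). Qed.

Lemma nlf_chi0 : chi 0 = 1.
Proof. exact: (chi0 chi_standard). Qed.

Lemma nlf_chi_sum t :
  \sum_(s < q) chi (u t * teich s) = if (q %| t)%N then q%:R else 0.
Proof.
have [F [f [Fq fr]]] := teichmuller.
exact: (chi_sum_teich K_char varpi0 Fq fr chi_standard eps0).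
Qed.

Lemma nlf_chi_nontrivial k : k != 0%N -> exists2 x, O x & chi (u k * x) != 1.
Proof.
have [F [f [Fq fr]]] := teichmuller.
move=> /(chi_nontrivial K_char varpi0 Fq fr chi_standard eps0)[y [m h]].
exists (f y * varpi ^+ m) => //.
by apply: nlf_OM; [exact: f_O|exact: nlf_varpiXO].
Qed.

(** If u(n) is an integer, then removing the last digit s leaves an integer, so
    by induction only s is left; but nonzero elements of GF(q) are units. *)
Lemma nlf_u_notO k : O (u k) -> k = 0%N.
Proof.
have [F [f [Fq fr]]] := teichmuller.
elim/(coset_ind Fq): k => [//|s n sq _ ih].
rewrite nlf_u_cons// => Ou.
have h : max_ideal abs (teich s + u n).
  rewrite (max_idealE K_local mu_haar abs_modulus varpi_prime).
  by exists (varpi^-1 * (teich s + u n)) => //; rewrite mulVKf.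
have n0 : n = 0%N.
  apply: ih; rewrite -(addKr (teich s) (u n)) addrC; apply: nlf_OB.
    exact: (max_ideal_integers h).
  exact: nlf_teichO.
move: h; rewrite n0 nlf_u0 addr0 muln0 addn0 => h.
have [y ys] := teich_range (p := p) fr s.
have y0 : y = 0.
  apply/eqP/negPn/negP => y0; move: h; rewrite -ys /max_ideal /= f_abs//.
  by rewrite ltxx.
apply: (teich_inj K_char Fq fr sq nlf_q_gt0).
by rewrite -ys y0 rmorph0 (@teich0 _ p c eps).
Qed.

(** Reduction is injective on the copy of GF(q) in K, because its nonzero elements
    are units; by cardinality it is onto the residue field. *)
Lemma nlf_residue_rep x : O x -> exists2 s, (s < q)%N & O (varpi^-1 * (x - teich s)).
Proof.
move=> Ox; have [F [f [Fq fr]]] := teichmuller.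
have [F' [g [F'q [g1 gDM gsurj gker]]]] := nlf_residue S.
have g0 : g 0 = 0.
  by apply/gker; rewrite /integers /max_ideal /= (abs0 abs_modulus).
have gN y : O y -> g (- y) = - g y.
  move=> Oy; apply/eqP; rewrite -addr_eq0 addrC.
  by rewrite -(gDM _ _ Oy (nlf_ON Oy)).1 subrr g0.
have gfi : injective (g \o f).
  move=> y z /= gyz; apply/eqP; rewrite -subr_eq0; apply/negPn/negP => yz.
  have := f_abs f Fq yz.
  suff : max_ideal abs (f (y - z)) by rewrite /max_ideal /= => /[swap] ->; rewrite ltxx.
  apply/(gker _ (f_O f _ Fq)); rewrite rmorphB.
  by rewrite (gDM _ _ (f_O f _ Fq) (nlf_ON (f_O f _ Fq))).1 gN ?gyz ?subrr//; exact: f_O.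
have [h hK Kh] : bijective (g \o f) by apply: inj_card_bij => //; rewrite Fq F'q.
have [s sq sE] := teich_surj K_char fr (h (g x)).
exists s => //; rewrite sE.
have : max_ideal abs (x - f (h (g x))).
  have Of := f_O f (h (g x)) Fq.
  apply/gker; first exact: nlf_OB.
  by rewrite (gDM _ _ Ox (nlf_ON Of)).1 gN// -[g (f _)]/((g \o f) _) Kh subrr.
rewrite (max_idealE K_local mu_haar abs_modulus varpi_prime) => -[y Oy <-].
by rewrite mulKf.
Qed.

(** Some varpi^m x is an integer; dividing by varpi again and again, the digits
    of the representative are read off with [nlf_residue_rep]. *)
Lemma nlf_cover x : exists n, O (x - u n).
Proof.
have absm m y : O (varpi ^+ m * y) -> exists n, O (y - u n).
  elim: m y => [|m ih] y.
    by rewrite expr0 mul1r => Oy; exists 0%N; rewrite nlf_u0 subr0.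
  rewrite exprSr -mulrA => /ih[n On].
  have [s sq Os] := nlf_residue_rep On.
  exists (s + q * n)%N; rewrite nlf_u_cons//.
  rewrite (_ : _ - _ = varpi^-1 * (varpi * y - u n - teich s))//.
  by field.
have q1 : (1 : R) < q%:R by rewrite ltr1n.
have [m hm] : exists m, abs x < q%:R ^+ m.
  exists (Num.bound (abs x)).
  apply: lt_trans (archi_boundP (abs_ge0 K_local mu_haar abs_modulus x)) _.
  by rewrite -natrX ltr_nat ltn_expl.
apply: (absm m); rewrite /integers /= nlf_absM (absX K_local mu_haar abs_modulus).
rewrite nlf_abs_varpi exprVn mulrC ler_pdivrMr ?mul1r ?ltW// exprn_gt0//.
by rewrite (lt_trans ltr01).
Qed.

Lemma chi_measurable (t : K) : complex_measurable (fun x : borel K => chi (t * (x : K))).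
Proof.
have cont (g : K -> R) : continuous g -> measurable_fun [set: borel K] (g : borel K -> R).
  move=> cg; apply: (measurability _ (RGenOInfty.measurableE R)) => _ [_ [a ->] <-].
  rewrite setTI; apply: open_measurable_borel.
  by apply: open_comp => // x _; exact: cg.
have cc : continuous (chi : K -> R[i]^o) := char_continuous chi_standard.
have near_chi x (e : R) : 0 < e -> \forall y \near x, nsq (chi (t * x) - chi (t * y)) < e ^+ 2.
  move=> e0; pose g : K -> R[i]^o := fun y => chi (t * y).
  have gx : g y @[y --> x] --> g x.
    by apply: (continuous_comp (f := fun y => t * y)); [exact: mull_continuous|exact: cc].
  move/cvgrPdist_lt : gx => /(_ e%:C).
  rewrite ltcR => /(_ e0); apply: filterS => y; rewrite normc_def ltcR => h.
  rewrite nsqE -(@sqr_sqrtr _ (_ + _)); last by rewrite addr_ge0// sqr_ge0.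
  by rewrite ltrXn2r// ?sqrtr_ge0// ltW.
split; apply: cont => x; apply/cvgrPdist_lt => e e0; have := near_chi x e e0;
  apply: filterS => y; rewrite nsqE => h.
  rewrite -(ltr_pXn2r (n := 2)) ?nnegrE ?(ltW e0)// real_normK ?num_real//.
  apply: le_lt_trans h; case: (chi _) (chi _) => [a b] [a' b'] /=.
  by rewrite lerDl sqr_ge0.
rewrite -(ltr_pXn2r (n := 2)) ?nnegrE ?(ltW e0)// real_normK ?num_real//.
apply: le_lt_trans h; case: (chi _) (chi _) => [a b] [a' b'] /=.
by rewrite lerDr sqr_ge0.
Qed.

End NormalizedLocalField.

(** * Parseval's identity on the integers *)
Section Parseval.
Context {R : realType} {K : topologicalFieldType} {p c : nat}.
Variables (mu : {measure set (borel K) -> \bar R}) (abs : K -> R) (varpi : K)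
  (eps : 'I_c -> K) (chi : K -> R[i]).
Hypothesis S : normalized_local_field p mu abs varpi eps chi.
Local Notation u := (coset_rep p varpi eps).
Local Notation O := (integers abs : set (borel K)).
Local Notation teich := (teich (p := p) eps).
Let mO := nlf_measurableO S.
Implicit Types (f g : borel K -> R[i]).

Section Shift.
Variables (a b : K).
Hypothesis a0 : a != 0.

Let scale := affine_haar (nlf_local S) (nlf_haar S) (nlf_modulus S) b a0.

Let k_ge0 : 0 <= (abs a)^-1.
Proof. by rewrite invr_ge0 ltW// (nlf_abs_gt0 S). Qed.

Lemma affine_sqnorm f : complex_measurable f ->
  sqnorm mu (fun x : borel K => f (a * (x : K) + b : K)) =
    ((abs a)^-1%:E * sqnorm mu f)%E.
Proof.
exact: (sqnorm_on_transport (affine_measurable a b) k_ge0 scale measurableT).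
Qed.

Lemma affine_square_integrable f : square_integrable mu f ->
  square_integrable mu (fun x : borel K => f (a * (x : K) + b : K)).
Proof.
exact: (L2on_transport (affine_measurable a b) k_ge0 scale measurableT).
Qed.

Lemma affine_inner f g : square_integrable mu f -> square_integrable mu g ->
  inner mu (fun x : borel K => f (a * (x : K) + b : K))
           (fun x : borel K => g (a * (x : K) + b : K)) =
    (abs a)^-1%:C * inner mu f g.
Proof.
exact: (ip_transport (affine_measurable a b) k_ge0 scale measurableT).
Qed.

End Shift.

Section ShiftO.
Variable t : K.
Hypothesis Ot : O t.

Let abs1V : (abs 1)^-1 = 1.
Proof. by rewrite (abs1 (nlf_local S) (nlf_haar S) (nlf_modulus S)) invr1. Qed.

Let affine1 : affine 1 t = (fun x : borel K => (x : K) + t : K).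
Proof. by apply/funext => x; rewrite /affine mul1r. Qed.

Let preO : affine 1 t @^-1` O = O.
Proof.
rewrite affine1; apply/seteqP; split => x /= Ox; last exact: (nlf_OD S).
by rewrite -(addrK t (x : K)); exact: (nlf_OB S).
Qed.

Let scale A : measurable A -> mu (affine 1 t @^-1` A) = (1%:E * mu A)%E.
Proof.
by move=> mA; rewrite (affine_haar (nlf_local S) (nlf_haar S) (nlf_modulus S)) ?oner_neq0// abs1V.
Qed.

Lemma shift_complex_measurable f : complex_measurable f ->
  complex_measurable (fun x : borel K => f ((x : K) + t : K)).
Proof.
move=> mf; have := complex_measurable_comp (affine_measurable 1 t) mf.
by rewrite affine1.
Qed.

Lemma shift_sqnorm_on f : complex_measurable f ->
  sqnorm_on mu O (fun x : borel K => f ((x : K) + t : K)) = sqnorm_on mu O f.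
Proof.
move=> mf; have := sqnorm_on_transport (affine_measurable 1 t) ler01 scale mO mf.
by rewrite preO mul1e affine1.
Qed.

Lemma shift_L2on f : L2on mu O f -> L2on mu O (fun x : borel K => f ((x : K) + t : K)).
Proof.
move=> [mf foo]; split; first exact: shift_complex_measurable.
by rewrite shift_sqnorm_on.
Qed.

Lemma shift_complex_integral f : complex_integrable mu O f ->
  complex_integral mu O (fun x : borel K => f ((x : K) + t : K)) = complex_integral mu O f.
Proof.
move=> fi; have := complex_integral_transport (affine_measurable 1 t) ler01 scale mO fi.
by rewrite preO mul1r affine1.
Qed.

End ShiftO.

Definition coset_char (k : nat) (x : borel K) : R[i] := chi (u k * (x : K)).
Local Notation chi_ := coset_char.

Lemma bounded_L2onO f (C : R) : complex_measurable f -> (forall x, nsq (f x) <= C) ->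
  L2on mu O f.
Proof.
move=> mf fC; split => //.
have C0 : 0 <= C by apply: le_trans (fC point); exact: nsq_ge0.
apply: (@le_lt_trans _ _ (\int[mu]_(x in O) C%:E)%E).
  apply: ge0_le_integral => //.
  - by move=> x _; rewrite lee_fin nsq_ge0.
  - by apply/measurable_EFinP; apply: measurable_funS (measurable_nsq mf).
  - by move=> x _; rewrite lee_fin; exact: fC.
by rewrite integral_cst// (nlf_normalized S) mule1 ltry.
Qed.

Lemma chi_L2on k : L2on mu O (chi_ k).
Proof.
apply: (@bounded_L2onO _ 1); first exact: (chi_measurable S).
by move=> x; rewrite (nlf_nsq_chi S).
Qed.

(** For m <> n the integral of the nontrivial character chi_m / chi_n is unchanged
    by a shift of the variable that multiplies it by a factor other than 1. *)
Lemma ip_chi m n : ip mu O (chi_ m) (chi_ n) = (m == n)%:R.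
Proof.
have [k uk] := nlf_u_sub S m n.
have E : ip mu O (chi_ m) (chi_ n) = complex_integral mu O (chi_ k).
  apply: eq_complex_integral => x _.
  by rewrite /coset_char (nlf_chi_conj S) -(nlf_chiD S) uk mulrBl.
have chi_int : complex_integrable mu O (chi_ k).
  have := L2onM_integrable mO (chi_L2on k) (chi_L2on 0).
  rewrite (_ : (fun x => _) = chi_ k)//; apply/funext => x.
  by rewrite {2}/coset_char (nlf_u0 S) mul0r (nlf_chi0 S) rmorph1 mulr1.
have [mn|mn] := eqVneq m n.
  have k0 : k = 0%N.
    by apply: (nlf_u_inj S); rewrite uk mn subrr (nlf_u0 S).
  rewrite E k0 /complex_integral.
  have chi01 x : chi_ 0 x = 1 by rewrite /coset_char (nlf_u0 S) mul0r (nlf_chi0 S).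
  under [X in X +i* _]eq_Rintegral do rewrite chi01.
  under [X in _ +i* X]eq_Rintegral do rewrite chi01.
  by rewrite /= !Rintegral_cst// (nlf_normalized S) mulr1 mul0r.
have k0 : k != 0%N.
  apply: contra mn => /eqP k0; apply/eqP/(nlf_u_inj S)/eqP.
  by rewrite -subr_eq0 -uk k0 (nlf_u0 S).
have [t Ot chit] := nlf_chi_nontrivial S k0.
have := shift_complex_integral Ot chi_int.
rewrite (@eq_complex_integral _ _ _ mu O _ (fun x => chi (u k * t) * chi_ k x)); last first.
  by move=> x _; rewrite /coset_char mulrDr (nlf_chiD S) mulrC.
rewrite (complex_integralZ mO _ chi_int) -E => h.
apply/eqP; rewrite -(mulrI_eq0 _ (x := chi (u k * t) - 1)).
  by rewrite mulrBl h mul1r subrr.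
by apply: lregP; rewrite subr_eq0.
Qed.

(** The injection t is needed twice: the identity for input sequences, and
    multiplication by q for decimated ones. *)
Lemma nrm2_trig M (w : nat -> R[i]) (t : nat -> nat) : injective t ->
  nrm2 mu O (fun x => \sum_(k < M) w k * chi_ (t k) x) = \sum_(k < M) nsq (w k).
Proof.
move=> ti; elim: M => [|M ih].
  rewrite big_ord0 (_ : (fun x => _) = (fun x => 0 * chi_ 0 x)).
    by rewrite nrm2Z ?nsq0 ?mul0r//; exact: chi_L2on.
  by apply/funext => x; rewrite big_ord0 mul0r.
have Lw (k : nat) : L2on mu O (fun x => w k * chi_ (t k) x).
  by apply: L2onZ => //; exact: chi_L2on.
rewrite (_ : (fun x => _) = (fun x => \sum_(k < M) w k * chi_ (t k) x + w M * chi_ (t M) x)).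
  rewrite nrm2D//; last by apply: L2on_sum => // k; exact: Lw.
  rewrite ih nrm2Z//; last exact: chi_L2on.
  have -> : nrm2 mu O (chi_ (t M)) = 1.
    apply: (@complexI R); rewrite -ip_self//; last exact: chi_L2on.
    by rewrite ip_chi eqxx.
  rewrite (ipC mO (Lw M)); last by apply: L2on_sum => // k; exact: Lw.
  rewrite ip_sumr//.
  have h0 : \sum_(i < M) ip mu O (fun x => w M * chi_ (t M) x) (fun x => w i * chi_ (t i) x) = 0.
    apply: big1 => k _.
    rewrite ipZl//; try exact: chi_L2on.
    rewrite ipZr//; try exact: chi_L2on.
    by rewrite ip_chi (inj_eq ti) gtn_eqF ?mulr0.
  by rewrite h0 rmorph0 /= mulr0 addr0 mulr1 big_ord_recr.
by apply/funext => x; rewrite big_ord_recr.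
Qed.

End Parseval.

(** * Filtering and decimation *)
Section Convolution.
Context {R : realType} {K : topologicalFieldType} {p c : nat}.
Variables (mu : {measure set (borel K) -> \bar R}) (abs : K -> R) (varpi : K)
  (eps : 'I_c -> K) (chi : K -> R[i]).
Hypothesis S : normalized_local_field p mu abs varpi eps chi.
Local Notation q := (p ^ c)%N.
Local Notation u := (coset_rep p varpi eps).
Local Notation O := (integers abs : set (borel K)).
Local Notation teich := (teich (p := p) eps).
Local Notation chi_ := (coset_char (p := p) varpi eps chi).
Let mO := nlf_measurableO S.

(** The addition and subtraction of the group of representatives, on indices. *)
Definition addu (m n : nat) : nat := sval (cid (nlf_u_add S m n)).
Definition subu (m n : nat) : nat := sval (cid (nlf_u_sub S m n)).

Lemma adduE m n : u (addu m n) = u m + u n.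
Proof. by rewrite /addu; case: cid. Qed.

Lemma subuE m n : u (subu m n) = u m - u n.
Proof. by rewrite /subu; case: cid. Qed.

Lemma subu_sym m n k : subu m n = k -> subu m k = n.
Proof. by move=> <-; apply: (nlf_u_inj S); rewrite !subuE subKr. Qed.

Lemma subu_add k m n : subu n k = m -> addu k m = n.
Proof. by move=> <-; apply: (nlf_u_inj S); rewrite adduE subuE addrC subrK. Qed.

Lemma adduK k m : subu (addu k m) k = m.
Proof. by apply: (nlf_u_inj S); rewrite subuE adduE addrAC subrr add0r. Qed.

Lemma addu_inj k : injective (addu k).
Proof. by move=> m n /(congr1 (fun x => subu x k)); rewrite !adduK. Qed.

Lemma subu_injr m : injective (subu m).
Proof. by move=> n k e; rewrite -(subu_sym (erefl (subu m k))) -(subu_sym (erefl (subu m n))) e. Qed.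

(** The points varpi u(s) run through GF(q), so summing over these shifts projects
    onto the frequencies divisible by q. *)
Lemma sum_chi_shift t x :
  \sum_(s < q) chi_ t ((x : K) + varpi * u s : K) =
    if (q %| t)%N then q%:R * chi_ t x else 0.
Proof.
under eq_bigr => s _ do rewrite /coset_char mulrDr (nlf_chiD S) (nlf_u_small S)//.
rewrite -mulr_sumr (nlf_chi_sum S); case: ifP => _; last by rewrite mulr0.
by rewrite mulrC.
Qed.

Definition root_q : R := Num.sqrt q%:R.

Lemma root_q_gt0 : 0 < root_q.
Proof. by rewrite sqrtr_gt0 ltr0n (nlf_q_gt0 S). Qed.

Lemma root_q_sqr : root_q ^+ 2 = q%:R.
Proof. by rewrite sqr_sqrtr. Qed.

Lemma root_qVM : (root_q^-1)%:C * q%:R = root_q%:C :> R[i].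
Proof.
rewrite -[q%:R](rmorph_nat (real_complex R)) -rmorphM; congr (_%:C).
by rewrite -root_q_sqr expr2 mulKf// lt0r_neq0// root_q_gt0.
Qed.

Variable N : nat.
Variables (a : 'I_N -> nat -> R[i]) (h : 'I_N -> borel K -> R[i]).
Hypothesis h_symbol : forall j, fourier_symbol mu p varpi eps chi (a j) (h j).
Hypothesis a_l2 : forall j, l2 (a j).
Variables (M : nat) (b : 'I_N -> nat -> R[i]).

Definition trig (j : 'I_N) (x : borel K) : R[i] := \sum_(m < M) b j m * chi_ m x.

Let hn (n : nat) (j : 'I_N) (x : borel K) : R[i] :=
  \sum_(m < n) (root_q^-1)%:C * a j m * (chi (u m * (x : K)))^*.

(** When g is a row of the symbol matrix H_r, this is the corresponding entry of
    the block matrix applied to the shifted trigonometric polynomials. *)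
Definition folded (g : 'I_N -> borel K -> R[i]) (x : borel K) : R[i] :=
  \sum_(s < q) \sum_(j < N) g j ((x : K) + varpi * u s : K) * trig j ((x : K) + varpi * u s : K).

(** Up to the factor q^(1/2), the Fourier coefficient of the folded product at
    the frequency q k. *)
Definition conv_coef (k : nat) : R[i] :=
  \sum_(j < N) \sum_(m < M) b j m * a j (subu m (q * k)).

Let conv_coefn (n k : nat) : R[i] :=
  \sum_(j < N) \sum_(m < M) b j m * trunc n (a j) (subu m (q * k)).

(** A bound for the frequencies occurring with the n-th partial sums. *)
Let Q n := (\max_(m' < M) \max_(m < n) subu m' m).+1.

Let ltQ n m' m : (m' < M)%N -> (m < n)%N -> (subu m' m < Q n)%N.
Proof.
move=> m'M mn; rewrite ltnS.
apply: leq_trans (leq_bigmax (Ordinal m'M)) => /=.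
exact: (leq_bigmax (F := fun m : 'I_n => subu m' m) (Ordinal mn)).
Qed.

(** The terms are regrouped by the k with u(m') - u(m) = u(q k). *)
Let sum_reindex n j (m' : 'I_M) x :
  \sum_(m < n) a j m * (if (q %| subu m' m)%N then chi_ (subu m' m) x else 0) =
  \sum_(k < Q n) trunc n (a j) (subu m' (q * k)) * chi_ (q * k) x.
Proof.
transitivity (\sum_(k < Q n) \sum_(m < n)
    if (m == subu m' (q * k) :> nat) then a j m * chi_ (q * k) x else 0); last first.
  apply: eq_bigr => k _; rewrite /trunc; case: ifP => [mn|mn].
    rewrite (bigD1 (Ordinal mn)) //= eqxx big1 ?addr0// => m.
    by rewrite -val_eqE /= => /negbTE ->.
  rewrite mul0r big1// => m _; case: eqP => // mk.
  by move: mn; rewrite -mk ltn_ord.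
rewrite exchange_big /=; apply: eq_bigr => m _.
case: ifP => [/dvdnP[k tk]|qt].
  have kQ : (k < Q n)%N.
    apply: leq_ltn_trans (ltQ (ltn_ord m') (ltn_ord m)).
    by rewrite tk leq_pmulr// (nlf_q_gt0 S).
  rewrite (bigD1 (Ordinal kQ)) //= big1 ?addr0.
    by rewrite mulnC in tk; rewrite (subu_sym tk) eqxx tk.
  move=> k'; rewrite -val_eqE /= => kk; case: eqP => // /esym/subu_sym e.
  by move: kk; rewrite -(eqn_pmul2l (nlf_q_gt0 S)) -e tk mulnC eqxx.
rewrite mulr0 big1// => k _; case: eqP => // /esym/subu_sym e.
by move: qt; rewrite e dvdn_mulr.
Qed.

Let folded_hn n x : folded (hn n) x =
  \sum_(k < Q n) (root_q%:C * conv_coefn n k) * chi_ (q * k) x.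
Proof.
transitivity (\sum_(j < N) \sum_(m' < M) root_q%:C * b j m' *
    (\sum_(m < n) a j m * (if (q %| subu m' m)%N then chi_ (subu m' m) x else 0))).
  rewrite /folded exchange_big /=; apply: eq_bigr => j _.
  transitivity (\sum_(s < q) \sum_(m' < M) \sum_(m < n)
      (root_q^-1)%:C * b j m' * a j m * chi_ (subu m' m) ((x : K) + varpi * u s : K)).
    apply: eq_bigr => s _; rewrite /trig mulr_sumr; apply: eq_bigr => m' _.
    rewrite mulr_suml; apply: eq_bigr => m _.
    rewrite /coset_char subuE mulrBl (nlf_chiD S) (nlf_chi_conj S); ring.
  rewrite exchange_big /=; apply: eq_bigr => m' _.
  rewrite exchange_big /= mulr_sumr; apply: eq_bigr => m _.
  rewrite -mulr_sumr sum_chi_shift; case: ifP => _; last by rewrite !mulr0.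
  by rewrite -root_qVM; ring.
under [RHS]eq_bigr => k _ do rewrite -mulrA mulr_suml mulr_sumr.
rewrite [RHS]exchange_big /=; apply: eq_bigr => j _.
under [RHS]eq_bigr => k _ do rewrite mulr_suml mulr_sumr.
rewrite [RHS]exchange_big /=; apply: eq_bigr => m' _.
rewrite sum_reindex mulr_sumr; apply: eq_bigr => k _; ring.
Qed.

Let qinj : injective (fun k => (q * k)%N).
Proof. by move=> k k' /eqP; rewrite eqn_pmul2l ?(nlf_q_gt0 S)// => /eqP. Qed.

Let conv_coefn0 n k : (Q n <= k)%N -> conv_coefn n k = 0.
Proof.
move=> Qk; rewrite /conv_coefn big1// => j _; rewrite big1// => m' _.
rewrite /trunc; case: ifP => [mn|_]; last by rewrite mulr0.
have := ltQ (ltn_ord m') mn.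
rewrite (subu_sym (erefl _)) ltnNge => /negP[]; apply: leq_trans Qk _.
by rewrite leq_pmull// (nlf_q_gt0 S).
Qed.

Let nrm2_folded_hn n : nrm2 mu O (folded (hn n)) = q%:R * nrm2 cnt [set: nat] (conv_coefn n).
Proof.
have -> : folded (hn n) =
    (fun x => \sum_(k < Q n) (root_q%:C * conv_coefn n k) * chi_ (q * k) x).
  by apply/funext => x; exact: folded_hn.
rewrite (nrm2_trig S _ (fun k => root_q%:C * conv_coefn n k) qinj) /nrm2 -/(sqn (conv_coefn n)).
rewrite (sqn_finite (@conv_coefn0 n)) /= mulr_sumr; apply: eq_bigr => k _.
by rewrite nsqM nsq_real root_q_sqr.
Qed.

Lemma trig_bounded j : exists C, forall x, nsq (trig j x) <= C.
Proof.
rewrite /trig; elim: M => [|m [C hC]].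
  by exists 0 => x; rewrite big_ord0 nsq0.
exists (2 * (C + nsq (b j m))) => x; rewrite big_ord_recr /=.
apply: le_trans (nsqD_le _ _) _; rewrite ler_pM2l// lerD//.
by rewrite nsqM (nlf_nsq_chi S) mulr1.
Qed.

Lemma trig_measurable j : complex_measurable (trig j).
Proof.
rewrite /trig; apply: complex_measurable_sum => m; apply: complex_measurableM.
  exact: complex_measurable_cst.
exact: (chi_measurable S).
Qed.

Let hn_measurable n j : complex_measurable (hn n j).
Proof.
rewrite /hn; apply: complex_measurable_sum => m; apply: complex_measurableM.
  exact: complex_measurable_cst.
by apply: complex_measurableJ; exact: (chi_measurable S).
Qed.

Let hn_L2 n j : L2on mu O (hn n j).
Proof.
rewrite /hn; apply: L2on_sum => // m; apply: L2onZ => //.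
by apply: L2onJ => //; exact: (chi_L2on S).
Qed.

Let hn_cvg j : L2_cvg_on mu O (fun n => hn n j) (h j).
Proof. by apply: (h_symbol j).2; exact: (nlf_compactO S). Qed.

Lemma symbol_L2on j : L2on mu O (h j).
Proof. exact: (L2_cvg_on_L2 mO (fun n => hn_L2 n j) (h_symbol j).1 (@hn_cvg j)). Qed.

Let Ot (s : 'I_q) : O (varpi * u s).
Proof. by rewrite (nlf_u_small S)//; exact: (nlf_teichO S). Qed.

Lemma folded_L2on g : (forall j, L2on mu O (g j)) -> L2on mu O (folded g).
Proof.
move=> Lg; rewrite /folded; apply: L2on_sum => // s; apply: L2on_sum => // j.
have [C hC] := trig_bounded j.
apply: (L2onM_bounded mO (C := C)).
- exact: (shift_complex_measurable (varpi * u s) (trig_measurable j)).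
- by move=> x; exact: hC.
- exact: (shift_L2on S (Ot s) (Lg j)).
Qed.

Let folded_cvg : L2_cvg_on mu O (fun n => folded (hn n)) (folded h).
Proof.
have mh j := (h_symbol j).1.
have mshift (s : 'I_q) (g : borel K -> R[i]) : complex_measurable g ->
    complex_measurable (fun x : borel K => g ((x : K) + varpi * u s : K)).
  exact: (shift_complex_measurable (varpi * u s)).
apply: L2_cvg_sum => //.
- move=> s n; apply: complex_measurable_sum => j; apply: complex_measurableM.
    exact: (mshift _ _ (hn_measurable n j)).
  exact: (mshift _ _ (trig_measurable j)).
- move=> s; apply: complex_measurable_sum => j; apply: complex_measurableM.
    exact: (mshift _ _ (mh j)).
  exact: (mshift _ _ (trig_measurable j)).
move=> s; apply: L2_cvg_sum => //.
- move=> j n; apply: complex_measurableM.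
    exact: (mshift _ _ (hn_measurable n j)).
  exact: (mshift _ _ (trig_measurable j)).
- move=> j; apply: complex_measurableM.
    exact: (mshift _ _ (mh j)).
  exact: (mshift _ _ (trig_measurable j)).
move=> j; have [C hC] := trig_bounded j.
apply: (L2_cvg_mul_bounded mO (C := C)).
- by move=> n; exact: (mshift _ _ (hn_measurable n j)).
- exact: (mshift _ _ (mh j)).
- exact: (mshift _ _ (trig_measurable j)).
- by move=> x; exact: hC.
apply: (squeeze_L2_cvg (e := fun n => sqnorm_on mu O (fun x => hn n j x - h j x))).
  move=> n; have mB := complex_measurableB (hn_measurable n j) (mh j).
  by rewrite -(shift_sqnorm_on S (Ot s) mB).
exact: hn_cvg.
Qed.

Lemma conv_coef_l2 : l2 conv_coef.
Proof.
rewrite /conv_coef; apply: L2on_sum => // j; apply: L2on_sum => // m; apply: L2onZ => //.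
apply: (@l2_comp _ (a j) (fun k => subu m (q * k))) => //.
by apply: inj_comp qinj; exact: subu_injr.
Qed.

Let conv_coef_cvg : L2_cvg_on cnt [set: nat] (fun n => conv_coefn n) conv_coef.
Proof.
apply: L2_cvg_sum => // j.
apply: L2_cvg_sum => // m.
apply: L2_cvgZ => //.
apply: (squeeze_L2_cvg (e := fun n => sqn (fun k => trunc n (a j) k - a j k))).
  move=> n; apply: (@sqn_comp _ (fun k => trunc n (a j) k - a j k) (fun k => subu m (q * k))).
  by apply: inj_comp qinj; exact: subu_injr.
exact: cvg_trunc.
Qed.

(** For partial sums of the symbols this is Parseval.  Both sides depend
    continuously on the symbols and on their coefficients: the trigonometric
    polynomials are bounded, and each k |-> a(m' - q k) is a subfamily of a. *)
Lemma nrm2_folded : nrm2 mu O (folded h) = q%:R * nrm2 cnt [set: nat] conv_coef.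
Proof.
have Lconvn n : l2 (conv_coefn n) by apply: l2_finite (@conv_coefn0 n).
have c1 := nrm2_cvg mO (fun n => folded_L2on (hn_L2 n)) (folded_L2on symbol_L2on) folded_cvg.
have c2 := nrm2_cvg measurableT Lconvn conv_coef_l2 conv_coef_cvg.
have c3 : (fun n => nrm2 mu O (folded (hn n))) @ \oo --> q%:R * nrm2 cnt [set: nat] conv_coef.
  under eq_fun do rewrite nrm2_folded_hn.
  by apply: cvgM => //; exact: cvg_cst.
by rewrite -(cvg_lim _ c1)//; exact: cvg_lim c3.
Qed.

End Convolution.

(** * Rayleigh quotients *)
Section RayleighQuotient.
Context {R : realType} {n : nat}.
Implicit Types (A H : 'M[R[i]]_n) (v : 'cV[R[i]]_n).

Definition cnorm2 v : R := \sum_i nsq (v i 0).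

Lemma cnorm2E v : ((v ^t*)%sesqui *m v) 0 0 = (cnorm2 v)%:C.
Proof.
rewrite mxE rmorph_sum /=; apply: eq_bigr => i _.
by rewrite !mxE mulrC mulrJ.
Qed.

Section Hermitian.
Variable A : 'M[R[i]]_n.
Hypothesis A_herm : A \is hermsymmx.

Let P := spectralmx A.
Let dg (i : 'I_n) : R := complex.Re (spectral_diag A 0 i).

Let dgE i : spectral_diag A 0 i = (dg i)%:C.
Proof.
have := hermitian_spectral_diag_real A_herm => /mxOverP/(_ 0 i) /complex_realP[k kE].
by rewrite /dg kE.
Qed.

Let AE : A = (P ^t*)%sesqui *m diag_mx (spectral_diag A) *m P.
Proof.
rewrite -invmx_unitary ?spectral_unitarymx//.
exact/orthomx_spectralP/hermitian_normalmx.
Qed.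

Let P_unit : P \in unitmx. Proof. exact: spectral_unit. Qed.

Let PPt : P *m (P ^t*)%sesqui = 1%:M.
Proof. by apply/unitarymxP; exact: spectral_unitarymx. Qed.

Let dg_eigenvalue i : eigenvalue A (dg i)%:C.
Proof.
apply/eigenvalueP; exists (row i P).
  rewrite [in LHS]AE !mulmxA -row_mul PPt row1 -rowE.
  apply/rowP => j; rewrite -dgE [LHS]mxE [RHS]mxE.
  rewrite (bigD1 i) //= big1 ?addr0; first by rewrite !mxE eqxx mulr1n.
  by move=> k ki; rewrite !mxE eq_sym (negbTE ki) mulr0n mul0r.
apply/eqP => Pi0; have : row i (1%:M : 'M[R[i]]_n) = 0 by rewrite -PPt row_mul Pi0 mul0mx.
by move=> /rowP/(_ i); rewrite !mxE eqxx => /eqP; rewrite oner_eq0.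
Qed.

(** The real eigenvalues are among finitely many diagonal entries, so that their
    infimum and supremum are bounds. *)
Let eigenvalue_dg (a : R) : eigenvalue A a%:C -> exists i, a = dg i.
Proof.
move=> /eigenvalueP[v vA v0].
pose w := v *m (P ^t*)%sesqui.
have wD : w *m diag_mx (spectral_diag A) = a%:C *: w.
  rewrite /w scalemxAl -vA [in RHS]AE -!mulmxA PPt mulmx1.
  by rewrite !mulmxA.
have w0 : w != 0.
  apply: contra v0 => /eqP w0; rewrite -(mulmx1 v).
  rewrite -(mulVmx P_unit) invmx_unitary ?spectral_unitarymx// mulmxA.
  by rewrite -/w w0 mul0mx.
clearbody w.
have [i wi] : exists i, w 0 i != 0.
  apply: contrapT => nw; move/eqP: w0; apply; apply/rowP => i; rewrite [RHS]mxE.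
  by apply/eqP/negPn/negP => wi; apply: nw; exists i.
exists i; apply: (@complexI R); rewrite -dgE.
move/rowP: wD => /(_ i); rewrite mxE (bigD1 i) //= big1 ?addr0; last first.
  by move=> k ki; rewrite !mxE (negbTE ki) mulr0n mulr0.
by rewrite !mxE eqxx mulr1n mulrC => /(mulIf wi) ->.
Qed.

Let dg_bound i : `|dg i| <= \sum_k `|dg k|.
Proof. by rewrite (bigD1 i) //= lerDl sumr_ge0. Qed.

Let min_le_dg i : min_eigenvalue A <= dg i.
Proof.
apply: ge_inf; last exact: dg_eigenvalue.
exists (- \sum_k `|dg k|) => _ /eigenvalue_dg[k ->].
by have := dg_bound k; rewrite ler_norml => /andP[].
Qed.

Let dg_le_max i : dg i <= max_eigenvalue A.
Proof.
apply: ub_le_sup; last exact: dg_eigenvalue.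
exists (\sum_k `|dg k|) => _ /eigenvalue_dg[k ->].
by have := dg_bound k; rewrite ler_norml => /andP[].
Qed.

(** In an orthonormal basis of eigenvectors the quadratic form is a combination of
    the |w_i|^2 with the eigenvalues as weights. *)
Lemma rayleigh_bounds v (r := complex.Re (((v ^t*)%sesqui *m A *m v) 0 0)) :
  min_eigenvalue A * cnorm2 v <= r <= max_eigenvalue A * cnorm2 v.
Proof.
pose w := P *m v.
have wt : (w ^t*)%sesqui = (v ^t*)%sesqui *m (P ^t*)%sesqui.
  by rewrite /w trmx_mul map_mxM.
have <- : cnorm2 w = cnorm2 v.
  apply: (@complexI R); rewrite -!cnorm2E wt -mulmxA /w (mulmxA _ P).
  rewrite -invmx_unitary ?spectral_unitarymx// mulVmx//.
  by rewrite mul1mx.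
have -> : r = \sum_i dg i * nsq (w i 0).
  rewrite /r [in LHS]AE !mulmxA -wt -!mulmxA -/w.
  apply: (@complexI R); rewrite [in RHS]rmorph_sum /=.
  have -> : ((w ^t*)%sesqui *m (diag_mx (spectral_diag A) *m w)) 0 0 =
      \sum_i (dg i * nsq (w i 0))%:C.
    rewrite mxE; apply: eq_bigr => i _; move: (w) => w'.
    rewrite mul_diag_mx !mxE dgE.
    have -> : (dg i * nsq (w' i 0))%:C = (dg i)%:C * (nsq (w' i 0))%:C.
      by rewrite -rmorphM.
    by rewrite -mulrJ; ring.
  by rewrite -rmorph_sum.
by apply/andP; split; rewrite /cnorm2 mulr_sumr; apply: ler_sum => i _;
  rewrite ler_wpM2r ?nsq_ge0 ?min_le_dg ?dg_le_max.
Qed.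

End Hermitian.

Lemma gram_herm H : (H ^t*)%sesqui *m H \is hermsymmx.
Proof.
apply/is_hermitianmxP; rewrite expr0 scale1r.
by rewrite trmx_mul map_mxM /= trmxCK.
Qed.

Lemma gram_bounds H v :
  min_eigenvalue ((H ^t*)%sesqui *m H) * cnorm2 v <= cnorm2 (H *m v) <=
  max_eigenvalue ((H ^t*)%sesqui *m H) * cnorm2 v.
Proof.
have := rayleigh_bounds (gram_herm H) v.
have -> : (v ^t*)%sesqui *m ((H ^t*)%sesqui *m H) *m v =
    ((H *m v) ^t*)%sesqui *m (H *m v).
  by rewrite trmx_mul map_mxM /= !mulmxA.
by rewrite cnorm2E.
Qed.

End RayleighQuotient.

(** * Frame bounds of the filter bank *)
Section Preliminaries.
Context {R : realType}.

Lemma ae_le_sum_nrm2 d (T : measurableType d) (mu : {measure set T -> \bar R})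
    (D : set T) (I J : finType) (f : I -> T -> R[i]) (g : J -> T -> R[i]) (c1 c2 : R) :
  measurable D -> 0 <= c1 -> 0 <= c2 ->
  (forall i, L2on mu D (f i)) -> (forall j, L2on mu D (g j)) ->
  (\forall x \ae mu, c1 * (\sum_i nsq (f i x)) <= c2 * (\sum_j nsq (g j x))) ->
  c1 * (\sum_i nrm2 mu D (f i)) <= c2 * (\sum_j nrm2 mu D (g j)).
Proof.
move=> mD c10 c20 Lf Lg ae_le.
have mnsq (k : T -> R[i]) : complex_measurable k ->
    measurable_fun D (fun x => (nsq (k x))%:E).
  by move=> mk; apply/measurable_EFinP; apply: measurable_funS (measurable_nsq mk).
have E (L : finType) (k : L -> T -> R[i]) (e : R) : 0 <= e -> (forall i, L2on mu D (k i)) ->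
    measurable_fun D (fun x => (e * \sum_i nsq (k i x))%:E) /\
    (e * (\sum_i nrm2 mu D (k i)))%:E = (\int[mu]_(x in D) (e * \sum_i nsq (k i x))%:E)%E.
  move=> e0 Lk.
  have msum : measurable_fun D (fun x => (\sum_i (nsq (k i x))%:E)%E).
    by apply: emeasurable_sum => i; apply: mnsq; exact: (Lk i).1.
  split.
    under eq_fun do rewrite EFinM -sumEFin.
    exact: measurable_funeM.
  under eq_integral do rewrite EFinM -sumEFin.
  rewrite ge0_integralZl//; last by move=> x _; apply: sume_ge0 => i _; rewrite lee_fin nsq_ge0.
  rewrite ge0_integral_sum//; first last.
    by move=> i x _; rewrite lee_fin nsq_ge0.
    by move=> i; apply: mnsq; exact: (Lk i).1.
  rewrite EFinM -sumEFin; congr (_ * _)%E; apply: eq_bigr => i _.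
  by rewrite -L2on_nrm2.
have [mf Ef] := E _ f c1 c10 Lf; have [mg Eg] := E _ g c2 c20 Lg.
rewrite -lee_fin Ef Eg; apply: ae_ge0_le_integral => //.
- by move=> x _; rewrite lee_fin mulr_ge0// sumr_ge0// => i _; exact: nsq_ge0.
- by move=> x _; rewrite lee_fin mulr_ge0// sumr_ge0// => i _; exact: nsq_ge0.
- by apply: filterS ae_le => x h _; rewrite lee_fin.
Qed.

Lemma cnorm2_mxcol n (p_ : 'I_n -> nat) (V : forall i, 'cV[R[i]]_(p_ i)) :
  cnorm2 (\mxcol_i V i) = \sum_i \sum_j nsq (V i j 0).
Proof.
rewrite /cnorm2 sig_big_dep/= [RHS](reindex _ tagnat.sig_bij_on)/=.
by apply: eq_bigr=> l _; rewrite !mxE.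
Qed.

Implicit Types a b : nat -> R[i].

Lemma nrm2_trunc_le n a : l2 a -> nrm2 cnt [set: nat] (trunc n a) <= nrm2 cnt [set: nat] a.
Proof.
move=> La; rewrite -lee_fin -!L2on_nrm2//; last exact: l2_trunc.
apply: le_sqnorm_on => // k _; rewrite /trunc; case: ifP => // _.
by rewrite nsq0 nsq_ge0.
Qed.

Definition unitseq n : nat -> R[i] := fun k => (k == n)%:R.

Lemma counting_set1 n : @counting nat R [set n] = 1%E.
Proof.
rewrite /counting; case: ifPn => [|/asboolPn]; last by move=> /(_ (finite_set1 n)).
by rewrite fset_set1 finmap.cardfs1.
Qed.

Lemma l2_unitseq n : l2 (unitseq n).
Proof. by apply: (@l2_finite _ _ n.+1) => k nk; rewrite /unitseq gtn_eqF. Qed.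

Lemma ip_unitseq a n : ip cnt [set: nat] a (unitseq n) = a n.
Proof.
have E (w : nat -> R) : (forall k, k != n -> w k = 0) ->
    \int[cnt]_(k in [set: nat]) w k = w n.
  move=> wn; rewrite /Rintegral.
  rewrite (@eq_integral _ _ _ _ _ ((fun=> (w n)%:E) \_ [set n])); last first.
    move=> k _; rewrite patchE; case: ifPn => [|].
      by rewrite inE => /= ->.
    by rewrite notin_setE /= => /eqP kn; rewrite wn.
  rewrite -integral_mkcond integral_cst//.
  by rewrite [X in (_ * X)%E]counting_set1 mule1.
rewrite /ip /complex_integral !E.
- by rewrite /unitseq eqxx rmorph1 mulr1; case: (a n).
- by move=> k /negbTE kn; rewrite /unitseq kn rmorph0 mulr0.
- by move=> k /negbTE kn; rewrite /unitseq kn rmorph0 mulr0.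
Qed.

End Preliminaries.

Lemma cvg_finite_sum {R : realType} (I : Type) (s : seq I) (F : I -> nat -> R) (l : I -> R) :
  (forall i, F i @ \oo --> l i) ->
  (fun n => \sum_(i <- s) F i n) @ \oo --> \sum_(i <- s) l i.
Proof.
move=> Fl; elim: s => [|i s ih].
  by under eq_fun do rewrite big_nil; rewrite big_nil; exact: cvg_cst.
by under eq_fun do rewrite big_cons; rewrite big_cons; exact: cvgD.
Qed.

Section FilterBank.
Context {R : realType} {K : topologicalFieldType} {p c : nat}.
Variables (mu : {measure set (borel K) -> \bar R}) (abs : K -> R) (varpi : K)
  (eps : 'I_c -> K) (chi : K -> R[i]).
Hypothesis S : normalized_local_field p mu abs varpi eps chi.
Local Notation q := (p ^ c)%N.
Local Notation u := (coset_rep p varpi eps).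
Local Notation O := (integers abs : set (borel K)).
Local Notation norm2 := (nrm2 cnt [set: nat]).
Let mO := nlf_measurableO S.
Variable N : nat.
Variables (a : 'I_q -> 'I_N -> 'I_N -> nat -> R[i])
  (h : 'I_q -> 'I_N -> 'I_N -> borel K -> R[i]).
Hypothesis h_symbol : forall r l j, fourier_symbol mu p varpi eps chi (a r l j) (h r l j).
Hypothesis a_l2 : forall r l j, l2 (a r l j).
Variables lambda Lambda : R.
Hypothesis lambda_ge0 : 0 <= lambda.
Hypothesis Lambda_ge0 : 0 <= Lambda.
Hypothesis block_bounds : \forall xi \ae mu, forall v,
  let H := block_symbol_mx p varpi eps h xi in
  lambda * cnorm2 v <= cnorm2 (H *m v) <= Lambda * cnorm2 v.

(** The operator T that the packet recursion induces on coefficients.  The series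
    over m is expressed as a pairing of square summable sequences, which gives it
    a meaning for every such b. *)
Definition filter_out (b : 'I_N -> nat -> R[i]) (r : 'I_q) (l : 'I_N) (k : nat) : R[i] :=
  \sum_(j < N) ip cnt [set: nat] (a r l j) (fun m => (b j (addu S (q * k) m))^*).

Let q_gt0 := nlf_q_gt0 S.
Let ae_filter : Filter (almost_everywhere mu) := ae_filter_ringOfSetsType mu.

Section FiniteInput.
Variables (M : nat) (b : 'I_N -> nat -> R[i]).
Hypothesis b_fin : forall j m, (M <= m)%N -> b j m = 0.

Local Notation tr := (trig (p := p) varpi eps chi M b).

Let tr_shift (s : 'I_q) (j : 'I_N) (x : borel K) : R[i] := tr j ((x : K) + varpi * u s : K).

Let tr_L2 j : L2on mu O (tr j).
Proof.
have [C hC] := trig_bounded S M b j.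
by apply: (bounded_L2onO S (C := C)) => //; exact: (trig_measurable S).
Qed.

Let Ot (s : 'I_q) : O (varpi * u s).
Proof. by rewrite (nlf_u_small S)//; exact: (nlf_teichO S). Qed.

Let nrm2_tr j : nrm2 mu O (tr j) = norm2 (b j).
Proof.
rewrite (nrm2_trig S M (b j) (t := fun k => k))// /nrm2 -/(sqn (b j)).
by rewrite (sqn_finite (M := M))// => m; exact: b_fin.
Qed.

(** The block matrix performs the folding of all the rows at once. *)
Let block_mul (x : borel K) :
  block_symbol_mx p varpi eps h x *m (\mxcol_(s < q) \col_(j < N) tr_shift s j x) =
  \mxcol_(r < q) \col_(l < N) folded (p := p) varpi eps chi M b (h r l) x.
Proof.
rewrite /block_symbol_mx mul_mxblock_mxrow; apply: eq_mxcol => r.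
apply/colP => l; rewrite summxE [RHS]mxE; apply: eq_bigr => s _.
by rewrite mxE; apply: eq_bigr => j _; rewrite !mxE.
Qed.

(** A finitely supported b expands in unit sequences, on which the pairing reads
    off one coefficient of a. *)
Lemma filter_out_finite r l : filter_out b r l = conv_coef S (a r l) M b.
Proof.
apply/funext => k; apply: eq_bigr => j _.
rewrite (_ : (fun m => _) = (fun m =>
    \sum_(m' < M) (b j m')^* * unitseq (subu S m' (q * k)) m)); last first.
  apply/funext => m; rewrite /unitseq; set n := addu S (q * k) m.
  have nE m' : (m == subu S m' (q * k)) = (m' == n :> nat).
    apply/eqP/eqP => [e|->]; last by rewrite /n adduK.
    by rewrite /n e (subu_add (erefl _)).
  have [nM|Mn] := ltnP n M.
    rewrite (bigD1 (Ordinal nM)) //= nE eqxx mulr1 big1 ?addr0// => m'.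
    by rewrite nE -val_eqE /= => /negbTE ->; rewrite mulr0.
  rewrite b_fin// rmorph0 big1// => m' _; rewrite nE.
  by rewrite ltn_eqF ?mulr0// (leq_trans (ltn_ord m')).
have La : L2on cnt [set: nat] (a r l j) := a_l2 r l j.
rewrite ip_sumr//; last first.
  by move=> m'; apply: L2onZ => //; exact: l2_unitseq.
apply: eq_bigr => m' _; rewrite ipZr//; last exact: l2_unitseq.
by rewrite conjCK ip_unitseq.
Qed.

(** Integrate the pointwise bounds for H(xi) v(xi) over the integers, with v the
    vector of shifted trigonometric polynomials.  By Parseval both sides pick up
    the same factor q: the left from the q shifts, the right from
    [nrm2_folded]. *)
Lemma filter_finite_bounds :
  lambda * (\sum_j norm2 (b j)) <= \sum_r \sum_l norm2 (filter_out b r l) /\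
  \sum_r \sum_l norm2 (filter_out b r l) <= Lambda * (\sum_j norm2 (b j)).
Proof.
pose f (i : 'I_q * 'I_N) := tr_shift i.1 i.2.
pose cols x := \mxcol_(s < q) \col_(j < N) tr_shift s j x.
pose g (i : 'I_q * 'I_N) := folded (p := p) varpi eps chi M b (h i.1 i.2).
have Lf i : L2on mu O (f i) by exact: (shift_L2on S (Ot i.1) (tr_L2 i.2)).
have Lg i : L2on mu O (g i).
  apply: (folded_L2on S) => j; exact: (symbol_L2on S (h_symbol i.1 i.2)).
have q0 : 0 < q%:R :> R by rewrite ltr0n.
have sf : \sum_i nrm2 mu O (f i) = q%:R * (\sum_j norm2 (b j)).
  rewrite -(pair_bigA _ (fun s j => nrm2 mu O (tr_shift s j))) /=.
  rewrite (eq_bigr (fun=> \sum_j norm2 (b j))); first by rewrite sumr_const card_ord mulr_natl.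
  move=> s _; apply: eq_bigr => j _; rewrite -nrm2_tr /nrm2.
  by rewrite (shift_sqnorm_on S (Ot s) (tr_L2 j).1).
have sg : \sum_i nrm2 mu O (g i) = q%:R * (\sum_r \sum_l norm2 (filter_out b r l)).
  rewrite -(pair_bigA _ (fun r l => nrm2 mu O (folded (p := p) varpi eps chi M b (h r l)))) /=.
  rewrite mulr_sumr; apply: eq_bigr => r _; rewrite mulr_sumr; apply: eq_bigr => l _.
  by rewrite (nrm2_folded S (h_symbol r l) (a_l2 r l)) filter_out_finite.
have Hx x : cnorm2 (block_symbol_mx p varpi eps h x *m cols x) =
    \sum_i nsq (g i x) /\
    cnorm2 (cols x) = \sum_i nsq (f i x).
  rewrite /cols block_mul !cnorm2_mxcol !pair_bigA /=.
  by split; apply: eq_bigr => i _; rewrite mxE.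
split.
  rewrite -(ler_pM2l q0) -[leRHS]mul1r -sg mulrCA -sf.
  apply: ae_le_sum_nrm2 => //.
  apply: (@filterS _ _ ae_filter _ _ _ block_bounds) => x /(_ (cols x)) /andP[+ _].
  by have [-> ->] := Hx x; rewrite mul1r.
rewrite -(ler_pM2l q0) -[leLHS]mul1r -sg [leRHS]mulrCA -sf.
apply: ae_le_sum_nrm2 => //.
apply: (@filterS _ _ ae_filter _ _ _ block_bounds) => x /(_ (cols x)) /andP[_].
by have [-> ->] := Hx x; rewrite mul1r.
Qed.

End FiniteInput.

Section SquareSummableInput.
Variable b : 'I_N -> nat -> R[i].
Hypothesis b_l2 : forall j, l2 (b j).

Let shifted (w : nat -> R[i]) k m := (w (addu S (q * k) m))^*.

Let shifted_l2 w k : l2 w -> l2 (shifted w k).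
Proof.
move=> Lw; apply: L2onJ => //.
apply: (@l2_comp _ w (addu S (q * k))) => //; exact: addu_inj.
Qed.

Let trb M j := trunc M (b j).

Let filter_cvg r l k : ccvg (fun M => filter_out (trb M) r l k) (filter_out b r l k).
Proof.
apply: ccvg_sum => j; apply: ip_cvg => //.
- by move=> M; apply: (shifted_l2 k); exact: l2_trunc.
- exact: (shifted_l2 k (b_l2 j)).
- exact: (a_l2 r l j).
apply: (@L2_cvgJ _ _ _ cnt [set: nat] (fun M m => trb M j (addu S (q * k) m))
  (fun m => b j (addu S (q * k) m))).
apply: (squeeze_L2_cvg (e := fun n => sqn (fun m => trunc n (b j) m - b j m))).
  move=> n; apply: (@sqn_comp _ (fun m => trunc n (b j) m - b j m) (addu S (q * k))).
  exact: addu_inj.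
exact: cvg_trunc.
Qed.

Let trb_bounds M := @filter_finite_bounds M (trb M)
  (fun j m (Mm : (M <= m)%N) => ltac:(by rewrite /trb /trunc ltnNge Mm)).

(** Finitely many output coefficients depend continuously on b, so the bound for
    truncations passes to the limit; no convergence of the whole output is
    available yet. *)
Lemma filter_out_partial Q :
  \sum_r \sum_l \sum_(k < Q) nsq (filter_out b r l k) <= Lambda * (\sum_j norm2 (b j)).
Proof.
have c1 : (fun M => \sum_r \sum_l \sum_(k < Q) nsq (filter_out (trb M) r l k)) @ \oo -->
    \sum_r \sum_l \sum_(k < Q) nsq (filter_out b r l k).
  apply: cvg_finite_sum => r; apply: cvg_finite_sum => l; apply: cvg_finite_sum => k.
  by apply: ccvg_nsq; exact: filter_cvg.
rewrite -(cvg_lim _ c1)//; apply: limr_le; first by apply/cvgP: c1.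
apply: nearW => M; apply: le_trans (le_trans (trb_bounds M).2 _).
  apply: ler_sum => r _; apply: ler_sum => l _.
  rewrite -lee_fin -L2on_nrm2; first exact: sqn_partial.
  rewrite (@filter_out_finite M); last by move=> j m Mm; rewrite /trb /trunc ltnNge Mm.
  exact: conv_coef_l2.
rewrite ler_wpM2l//; apply: ler_sum => j _; exact: nrm2_trunc_le.
Qed.

Lemma filter_out_l2 r l : l2 (filter_out b r l).
Proof.
apply/l2P; apply: (@le_lt_trans _ _ (Lambda * (\sum_j norm2 (b j)))%:E); last exact: ltry.
apply: sqn_le => n; apply: le_trans (filter_out_partial n).
rewrite (bigD1 r) //= (bigD1 l) //= -addrA lerDl addr_ge0//.
  by apply: sumr_ge0 => i _; apply: sumr_ge0 => k _; exact: nsq_ge0.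
apply: sumr_ge0 => i _; apply: sumr_ge0 => l' _; apply: sumr_ge0 => k _; exact: nsq_ge0.
Qed.

Lemma filter_out_upper :
  \sum_r \sum_l norm2 (filter_out b r l) <= Lambda * (\sum_j norm2 (b j)).
Proof.
have c1 : (fun n => \sum_r \sum_l \sum_(k < n) nsq (filter_out b r l k)) @ \oo -->
    \sum_r \sum_l norm2 (filter_out b r l).
  apply: cvg_finite_sum => r; apply: cvg_finite_sum => l.
  exact/cvg_partial_sqn/filter_out_l2.
rewrite -(cvg_lim _ c1)//; apply: limr_le; first by apply/cvgP: c1.
by apply: nearW => n; exact: filter_out_partial.
Qed.

Lemma filter_outB (b' : 'I_N -> nat -> R[i]) r l k : (forall j, l2 (b' j)) ->
  filter_out (fun j m => b j m - b' j m) r l k = filter_out b r l k - filter_out b' r l k.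
Proof.
move=> Lb'; rewrite /filter_out -sumrB; apply: eq_bigr => j _.
rewrite -ipBr//; [|exact: (a_l2 r l j)|exact: (shifted_l2 k (b_l2 j))|exact: (shifted_l2 k (Lb' j))].
by congr ip; apply/funext => m; rewrite rmorphB.
Qed.

End SquareSummableInput.

(** The upper bound makes T continuous, so that the lower bound extends from
    truncated inputs. *)
Lemma filter_out_bounds b : (forall j, l2 (b j)) ->
  lambda * (\sum_j norm2 (b j)) <= \sum_r \sum_l norm2 (filter_out b r l) /\
  \sum_r \sum_l norm2 (filter_out b r l) <= Lambda * (\sum_j norm2 (b j)).
Proof.
move=> Lb; split; last exact: filter_out_upper.
pose tb M j := trunc M (b j).
have Ltb M j : l2 (tb M j) by exact: l2_trunc.
have cb : (fun M => \sum_j norm2 (fun m => tb M j m - b j m)) @ \oo --> (0 : R).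
  rewrite -[X in _ --> X](@big1_eq _ _ +%R _ (index_enum 'I_N) xpredT).
  by apply: cvg_finite_sum => j; apply: L2_cvg_nrm2; exact: cvg_trunc.
have cT r l : L2_cvg_on cnt [set: nat] (fun M => filter_out (tb M) r l) (filter_out b r l).
  have LT M := filter_out_l2 (Ltb M) r l; have LTb := filter_out_l2 Lb r l.
  apply: nrm2_L2_cvg => //.
  apply: (@squeeze_cvgr _ _ _ _ (fun=> 0)
     (fun M => Lambda * (\sum_j norm2 (fun m => tb M j m - b j m)))).
  - apply: nearW => M; rewrite nrm2_ge0 /=.
    have LB j : l2 (fun m => tb M j m - b j m) by exact: (L2onB measurableT (Ltb M j) (Lb j)).
    apply: le_trans (filter_out_upper LB).
    rewrite (_ : (fun x => _) = filter_out (fun j m => tb M j m - b j m) r l); last first.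
      by apply/funext => k; rewrite filter_outB.
    rewrite (bigD1 r) //= (bigD1 l) //= -addrA lerDl addr_ge0//.
      by apply: sumr_ge0 => i _; exact: nrm2_ge0.
    by apply: sumr_ge0 => i _; apply: sumr_ge0 => l' _; exact: nrm2_ge0.
  - exact: cvg_cst.
  - by rewrite -[X in _ --> X](mulr0 Lambda); apply: cvgM => //; exact: cvg_cst.
have c1 : (fun M => lambda * (\sum_j norm2 (tb M j))) @ \oo --> lambda * (\sum_j norm2 (b j)).
  apply: cvgM; first exact: cvg_cst.
  apply: cvg_finite_sum => j; apply: (nrm2_cvg measurableT (fun M => Ltb M j) (Lb j)); exact: cvg_trunc.
have c2 : (fun M => \sum_r \sum_l norm2 (filter_out (tb M) r l)) @ \oo -->
    \sum_r \sum_l norm2 (filter_out b r l).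
  apply: cvg_finite_sum => r; apply: cvg_finite_sum => l; apply: nrm2_cvg => //.
    by move=> M; exact: filter_out_l2.
  exact: filter_out_l2.
apply: (ler_cvg_to c1 c2); apply: nearW => M.
by apply: (filter_finite_bounds (M := M) _).1 => j m Mm; rewrite /tb /trunc ltnNge Mm.
Qed.

End FilterBank.

(** * Closed spans and sums over frames *)
Lemma sum_ord_mul (V : nmodType) (q M : nat) (F : nat -> V) :
  \sum_(n < q * M) F n = \sum_(r < M) \sum_(s < q) F (s + q * r)%N.
Proof.
elim: M => [|M ih]; first by rewrite muln0 !big_ord0.
rewrite mulnS addnC big_split_ord /= big_ord_recr /= -ih; congr (_ + _).
by apply: eq_bigr => s _; rewrite addnC.
Qed.

Section ClosedSpan.
Context {R : realType} {d : measure_display} {T : measurableType d}.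
Variable mu : {measure set T -> \bar R}.
Context {I : choiceType}.
Variable x : I -> T -> R[i].
Hypothesis x_L2 : forall i, square_integrable mu (x i).
Local Notation CS := (closed_linear_span mu x).

Lemma linear_span_L2 g : linear_span x g -> square_integrable mu g.
Proof.
move=> [s ->]; apply: (L2on_sum measurableT) => i.
by apply: (L2onZ measurableT); exact: x_L2.
Qed.

Lemma linear_spanD f g : linear_span x f -> linear_span x g ->
  linear_span x (fun t => f t + g t).
Proof.
move=> [s ->] [s' ->]; exists (s ++ s').
by apply/funext => t; rewrite big_cat.
Qed.

Lemma linear_spanZ w g : linear_span x g -> linear_span x (fun t => w * g t).
Proof.
move=> [s ->]; exists [seq (w * a.1, a.2) | a <- s].
apply/funext => t; rewrite big_map mulr_sumr; apply: eq_bigr => a _ /=.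
by rewrite mulrA.
Qed.

(** Since |x + y|^2 <= 2 |x|^2 + 2 |y|^2, quarters of e suffice. *)
Lemma sqnormB_trans f g h (e : R) : square_integrable mu f -> square_integrable mu g ->
  square_integrable mu h ->
  (sqnorm mu (fun t => f t - g t)%R < (e / 4)%:E)%E ->
  (sqnorm mu (fun t => g t - h t)%R < (e / 4)%:E)%E ->
  (sqnorm mu (fun t => f t - h t)%R < e%:E)%E.
Proof.
move=> Lf Lg Lh fg gh.
have Lfg := L2onB measurableT Lf Lg; have Lgh := L2onB measurableT Lg Lh.
rewrite (_ : (fun t => _) = (fun t => (f t - g t) + (g t - h t))); last first.
  by apply/funext => t; rewrite addrA subrK.
apply: le_lt_trans (sqnorm_onD_le _ _ Lfg.1 Lgh.1) _; first exact: measurableT.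
move: fg gh; rewrite /sqnorm (L2on_nrm2 Lfg) (L2on_nrm2 Lgh) !lte_fin => fg gh.
lra.
Qed.

Lemma closed_span_limit (F : nat -> T -> R[i]) f : (forall n, CS (F n)) ->
  square_integrable mu f -> L2_cvg_on mu [set: T] F f -> CS f.
Proof.
move=> CF Lf Ff; split => // e e0.
have e4 : 0 < e / 4 by rewrite divr_gt0.
have [n nF] : exists n, nrm2 mu [set: T] (fun t => F n t - f t) < e / 4.
  have /cvgrPdist_lt/(_ _ e4)[n _ hn] := L2_cvg_nrm2 Ff.
  exists n; have := hn n (leqnn n).
  by rewrite /= sub0r normrN ger0_norm// nrm2_ge0.
have [LF /(_ _ e4)[g gs Fg]] := CF n.
exists g => //; apply: (sqnormB_trans Lf LF (linear_span_L2 gs)) Fg.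
rewrite (_ : sqnorm _ _ = sqnorm mu (fun t => F n t - f t)).
  by rewrite /sqnorm (L2on_nrm2 (L2onB measurableT LF Lf)) lte_fin.
by apply: eq_sqnorm_on => t _; rewrite -nsqN opprB.
Qed.

Lemma closed_span_linear_span g : linear_span x g -> CS g.
Proof.
move=> gs; split; first exact: linear_span_L2.
move=> e e0; exists g => //; under eq_fun do rewrite subrr.
rewrite (_ : sqnorm _ _ = 0%E) ?lte_fin//.
by rewrite /sqnorm /sqnorm_on integral0_eq// => t _; rewrite -/(nsq _) nsq0.
Qed.

Lemma closed_span_ae f g : CS f -> square_integrable mu g ->
  (sqnorm mu (fun t => g t - f t)%R = 0)%E -> CS g.
Proof.
move=> [Lf Cf] Lg gf; split => // e e0.
have e4 : 0 < e / 4 by rewrite divr_gt0.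
have [k ks fk] := Cf _ e4.
by exists k => //; apply: (sqnormB_trans Lg Lf (linear_span_L2 ks)) fk; rewrite gf lte_fin.
Qed.

Lemma closed_spanD f g : CS f -> CS g -> CS (fun t => f t + g t).
Proof.
move=> [Lf Cf] [Lg Cg]; split; first exact: (L2onD measurableT Lf Lg).
move=> e e0; have e4 : 0 < e / 4 by rewrite divr_gt0.
have [f' f's ff'] := Cf _ e4; have [g' g's gg'] := Cg _ e4.
exists (fun t => f' t + g' t); first exact: linear_spanD.
have Lff := L2onB measurableT Lf (linear_span_L2 f's).
have Lgg := L2onB measurableT Lg (linear_span_L2 g's).
rewrite (_ : (fun t => _) = (fun t => (f t - f' t) + (g t - g' t))); last first.
  by apply/funext => t; rewrite opprD addrACA.
apply: le_lt_trans (sqnorm_onD_le _ _ Lff.1 Lgg.1) _; first exact: measurableT.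
move: ff' gg'; rewrite /sqnorm (L2on_nrm2 Lff) (L2on_nrm2 Lgg) !lte_fin => fg gh.
lra.
Qed.

Lemma closed_spanZ w f : CS f -> CS (fun t => w * f t).
Proof.
move=> [Lf Cf]; split; first exact: (L2onZ measurableT w Lf).
move=> e e0; have w0 := nsq_ge0 w.
have e' : 0 < e / (nsq w + 1) by rewrite divr_gt0// ltr_wpDl.
have [f' f's ff'] := Cf _ e'.
exists (fun t => w * f' t); first exact: linear_spanZ.
have Lff := L2onB measurableT Lf (linear_span_L2 f's).
under eq_fun do rewrite -mulrBr.
rewrite /sqnorm sqnorm_onZ//; last exact: Lff.1.
move: ff'; rewrite /sqnorm (L2on_nrm2 Lff) lte_fin ltr_pdivlMr ?ltr_wpDl// => h.
have := nrm2_ge0 mu [set: T] (fun t => f t - f' t).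
by rewrite -EFinM lte_fin; lra.
Qed.

Lemma closed_span_sum (J : Type) (s : seq J) (P : pred J) (F : J -> T -> R[i]) :
  (forall j, CS (F j)) -> CS (fun t => \sum_(j <- s | P j) F j t).
Proof.
move=> CF; elim: s => [|j s ih].
  apply: closed_span_linear_span; exists [::].
  by apply/funext => t; rewrite !big_nil.
under eq_fun do rewrite big_cons.
by case: (P j) => //; exact: closed_spanD.
Qed.

End ClosedSpan.

Section FrameSums.
Context {R : realType}.

Lemma esum_fin_prod (I : finType) (F : I * nat -> \bar R) : (forall i, (0 <= F i)%E) ->
  (\esum_(i in [set: I * nat]) F i = \sum_(i : I) \esum_(k in [set: nat]) F (i, k))%E.
Proof.
move=> F0.
have := @esum_esum R I nat [set: I] (fun=> [set: nat]) (fun i k => F (i, k))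
  (fun _ _ _ _ => F0 _).
rewrite (_ : [set: I] `*`` (fun=> [set: nat]) = [set: I * nat]); last first.
  by apply/seteqP; split.
under [X in _ = X -> _]eq_esum do rewrite -surjective_pairing.
move=> <-; rewrite esum_fset; [|exact: finite_finset|]; last first.
  by move=> i _; apply: esum_ge0 => k _; exact: F0.
rewrite (fsbigE (enum I)) ?enum_uniq//=; last by move=> z _; rewrite mem_enum.
under eq_bigl do rewrite in_setT.
by rewrite big_enum.
Qed.

Lemma ip_trunc (a w : nat -> R[i]) n : l2 w ->
  ip cnt [set: nat] (trunc n a) w = \sum_(m < n) a m * (w m)^*.
Proof.
move=> Lw.
have E : trunc n a = (fun k => \sum_(m < n) a m * unitseq m k).
  apply/funext => k; rewrite /trunc /unitseq; case: ltnP => kn.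
    rewrite (bigD1 (Ordinal kn)) //= eqxx mulr1 big1 ?addr0// => m.
    by rewrite -val_eqE /= eq_sym => /negbTE ->; rewrite mulr0.
  by rewrite big1// => m _; rewrite gtn_eqF ?mulr0// (leq_trans (ltn_ord m)).
have Lu (m : 'I_n) : l2 (fun k => a m * unitseq m k).
  by apply: (L2onZ measurableT); exact: l2_unitseq.
rewrite E (ipC measurableT Lw); last by apply: (L2on_sum measurableT) => m; exact: Lu.
rewrite (ip_sumr measurableT _ _ Lw Lu) rmorph_sum; apply: eq_bigr => m _.
rewrite (ipZr measurableT _ Lw (l2_unitseq m)) ip_unitseq rmorphM /= conjCK.
by [].
Qed.

End FrameSums.

(** * Dilations, translations and refinement *)
Section Packets.
Context {R : realType} {K : topologicalFieldType} {p c : nat}.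
Variables (mu : {measure set (borel K) -> \bar R}) (abs : K -> R) (varpi : K)
  (eps : 'I_c -> K) (chi : K -> R[i]).
Hypothesis S : normalized_local_field p mu abs varpi eps chi.
Local Notation q := (p ^ c)%N.
Local Notation u := (coset_rep p varpi eps).
Local Notation L2 := (square_integrable mu).
Implicit Types f g : borel K -> R[i].

Let varpi0 := nlf_varpi0 S.
Let varpiV0 : varpi^-1 != 0. Proof. by rewrite invr_neq0// nlf_varpi0. Qed.
Let q_gt0 : 0 < q%:R :> R. Proof. by rewrite ltr0n (nlf_q_gt0 S). Qed.

Definition dilate (m : nat) f : borel K -> R[i] := fun x => f (varpi^-1 * (x : K) - u m : K).
Definition translate (t : K) f : borel K -> R[i] := fun x => f ((x : K) - t : K).

Let translateE t f : translate t f = (fun x : borel K => f (1 * (x : K) + (- t) : K)).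
Proof. by apply/funext => x; rewrite /translate mul1r. Qed.

Let abs1V : (abs 1)^-1 = 1.
Proof. by rewrite (abs1 (nlf_local S) (nlf_haar S) (nlf_modulus S)) invr1. Qed.

Let one0 : (1 : K) != 0 := oner_neq0 K.

Lemma translate_L2 t f : L2 f -> L2 (translate t f).
Proof. by rewrite translateE; exact: (affine_square_integrable S). Qed.

Lemma dilate_L2 m f : L2 f -> L2 (dilate m f).
Proof. exact: (affine_square_integrable S). Qed.

Lemma translate_sqnorm t f : complex_measurable f -> sqnorm mu (translate t f) = sqnorm mu f.
Proof. by move=> mf; rewrite translateE (affine_sqnorm S _ one0)// abs1V mul1e. Qed.

Lemma translate_cvg t (F : nat -> borel K -> R[i]) f : (forall n, complex_measurable (F n)) ->
  complex_measurable f -> L2_cvg_on mu [set: borel K] F f ->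
  L2_cvg_on mu [set: borel K] (fun n => translate t (F n)) (translate t f).
Proof.
move=> mF mf Ff.
apply: (squeeze_L2_cvg (e := fun n => sqnorm mu (fun x => F n x - f x))) => // n.
by rewrite -(translate_sqnorm t (complex_measurableB (mF n) mf)).
Qed.

(** As u(k) / varpi = u(q k), a translation after a dilation is absorbed by the
    translation parameter of the dilation. *)
Lemma dilate_translate m k f : translate (u k) (dilate m f) = dilate (addu S (q * k) m) f.
Proof.
apply/funext => x; rewrite /translate /dilate adduE (nlf_u_shift S).
by congr (f _); rewrite mulrBr opprD addrA.
Qed.

Variable N : nat.

Section Refinement.
Variables (a : 'I_N -> 'I_N -> nat -> R[i]) (F G : 'I_N -> borel K -> R[i]).
Hypothesis a_l2 : forall l j, l2 (a l j).
Hypothesis F_L2 : forall j, L2 (F j).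
Hypothesis G_L2 : forall l, L2 (G l).
Hypothesis FG : refines mu p varpi eps a F G.

Let part l n (x : borel K) : R[i] :=
  \sum_(j < N) \sum_(m < n) (@root_q R p c)%:C * a l j m * dilate m (F j) x.

Let part_L2 l n : L2 (part l n).
Proof.
apply: (L2on_sum measurableT) => j; apply: (L2on_sum measurableT) => m.
by apply: (L2onZ measurableT); exact: dilate_L2.
Qed.

Lemma refined_cvg l t : L2_cvg_on mu [set: borel K]
  (fun n => translate t (part l n)) (translate t (G l)).
Proof.
apply: translate_cvg; [by move=> n; exact: (part_L2 l n).1|exact: (G_L2 l).1|].
exact: (FG l).
Qed.

Variable f : borel K -> R[i].
Hypothesis f_L2 : L2 f.

(** Normalized and conjugated so as to be the input of the filter in
    [refined_coef]. *)
Definition refine_coef (j : 'I_N) (m : nat) : R[i] :=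
  ((@root_q R p c)%:C * inner mu f (dilate m (F j)))^*.

Hypothesis coef_l2 : forall j, l2 (refine_coef j).

(** Pair f with the partial sums of the refinement equation: on one side they
    converge in L2, on the other they are pairings with truncations of a. *)
Lemma refined_coef l k : (inner mu f (translate (u k) (G l)))^* =
  \sum_(j < N) ip cnt [set: nat] (a l j) (fun m => (refine_coef j (addu S (q * k) m))^*).
Proof.
have Lw j : l2 (fun m => (refine_coef j (addu S (q * k) m))^*).
  apply: (L2onJ (f := fun m => refine_coef j (addu S (q * k) m))).
  apply: (@l2_comp _ (refine_coef j) (addu S (q * k))) => //; exact: addu_inj.
apply: (@ccvg_unique _ (fun n => (ip mu [set: borel K] f (translate (u k) (part l n)))^*)).
  apply: ccvgJ; apply: (ip_cvg measurableT) => //.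
  - by move=> n; apply: translate_L2; exact: part_L2.
  - exact: translate_L2.
  - exact: refined_cvg.
apply: (@ccvg_eq _ (fun n => \sum_(j < N) ip cnt [set: nat] (trunc n (a l j))
    (fun m => (refine_coef j (addu S (q * k) m))^*))); last first.
  apply: ccvg_sum => j.
  apply: (@ccvg_eq _ (fun n => (ip cnt [set: nat]
      (fun m => (refine_coef j (addu S (q * k) m))^*) (trunc n (a l j)))^*)).
    by move=> n; rewrite (ipC measurableT (Lw j) (l2_trunc n (a l j))) .
  rewrite (ipC measurableT (Lw j) (a_l2 l j)).
  apply: ccvgJ; apply: (ip_cvg measurableT) => //.
  - by move=> n; exact: l2_trunc.
  - exact: (a_l2 l j).
  - exact: (Lw j).
  - exact: cvg_trunc.
move=> n.
rewrite (_ : translate (u k) (part l n) = (fun x => \sum_(j < N) \sum_(m < n)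
    ((@root_q R p c)%:C * a l j m) * dilate (addu S (q * k) m) (F j) x)); last first.
  apply/funext => x; rewrite /translate /part; apply: eq_bigr => j _; apply: eq_bigr => m _.
  by rewrite -dilate_translate.
have Ld j m : L2 (dilate (addu S (q * k) m) (F j)) by exact: dilate_L2.
have Lz j (m : 'I_n) : L2 (fun x => ((@root_q R p c)%:C * a l j m) * dilate (addu S (q * k) m) (F j) x).
  by apply: (L2onZ measurableT); exact: Ld.
rewrite (ip_sumr measurableT _ _ f_L2); last by move=> j; apply: (L2on_sum measurableT) => m; exact: Lz.
rewrite rmorph_sum; apply: eq_bigr => j _.
rewrite (ip_sumr measurableT _ _ f_L2); last by move=> m; exact: Lz.
rewrite rmorph_sum (ip_trunc _ _ (Lw j)); apply: eq_bigr => m _.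
rewrite (ipZr measurableT _ f_L2 (Ld j m)) conjCK /refine_coef.
rewrite !rmorphM /= !conjCK.
have -> : ((@root_q R p c)%:C)^* = (@root_q R p c)%:C by exact: conjc_real.
rewrite -/(inner mu f (dilate (addu S (q * k) m) (F j))).
by ring.
Qed.

End Refinement.

Lemma dilate_inner f g m : L2 f -> L2 g ->
  inner mu (dilate 0 f) (dilate m g) = q%:R^-1%:C * inner mu f (translate (u m) g).
Proof.
move=> Lf Lg.
have e0 h : dilate 0 h = (fun x : borel K => h (varpi^-1 * (x : K) + 0 : K)).
  by apply/funext => x; rewrite /dilate (nlf_u0 S) subr0 addr0.
have -> : dilate m g = (fun x : borel K => translate (u m) g (varpi^-1 * (x : K) + 0 : K)).
  by apply/funext => x; rewrite /translate /dilate addr0.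
rewrite e0 (affine_inner S _ varpiV0 Lf (translate_L2 (u m) Lg)).
rewrite (absV (nlf_local S) (nlf_haar S) (nlf_modulus S) varpi0).
by rewrite invrK (nlf_abs_varpi S).
Qed.

Lemma refine_coef_dilate (F : 'I_N -> borel K -> R[i]) f j m : L2 f -> L2 (F j) ->
  nsq (refine_coef F (dilate 0 f) j m) = q%:R^-1 * nsq (inner mu f (translate (u m) (F j))).
Proof.
move=> Lf LF; rewrite /refine_coef nsqJ (dilate_inner m Lf LF) !nsqM !nsq_real mulrA.
congr (_ * _); rewrite (@root_q_sqr R p c) expr2 mulrA divff ?mul1r//.
exact: lt0r_neq0.
Qed.

Definition undilate f : borel K -> R[i] := fun x => f (varpi * (x : K) : K).

Let undilateE f : undilate f = (fun x : borel K => f (varpi * (x : K) + 0 : K)).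
Proof. by apply/funext => x; rewrite /undilate addr0. Qed.

Lemma undilate_L2 f : L2 f -> L2 (undilate f).
Proof. by rewrite undilateE; exact: (affine_square_integrable S _ varpi0). Qed.

Lemma undilate_sqnorm f : complex_measurable f ->
  sqnorm mu (undilate f) = (q%:R%:E * sqnorm mu f)%E.
Proof.
by move=> mf; rewrite undilateE (affine_sqnorm S 0 varpi0 mf) (nlf_abs_varpi S) invrK.
Qed.

Lemma undilateK f : dilate 0 (undilate f) = f.
Proof.
by apply/funext => x; rewrite /dilate /undilate (nlf_u0 S) subr0 mulVKf.
Qed.

End Packets.

(** * Injectivity of refinement *)
Section Cut.
Context {R : realType} {d : measure_display} {T : measurableType d}.
Variable mu : {measure set T -> \bar R}.
Implicit Types (f g : T -> R[i]) (W : set T).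
Local Notation L2 := (square_integrable mu).

Definition cut W f : T -> R[i] := fun x => f x * (\1_W x : R)%:C.

Lemma nsq_cut W f x : nsq (cut W f x) = \1_W x * nsq (f x).
Proof.
rewrite nsqM nsq_real mulrC indicE; case: (x \in W); by rewrite ?expr1n ?expr0n.
Qed.

Lemma cut_L2 W f : measurable W -> L2 f -> L2 (cut W f).
Proof.
move=> mW Lf; apply: (L2onM_bounded measurableT (C := 1)) => //.
  by split; [exact: measurable_indic|exact: measurable_cst].
by move=> x; rewrite nsq_real indicE; case: (x \in W); rewrite ?expr1n ?expr0n.
Qed.

Lemma inner_cut W f g : inner mu (cut W f) g = inner mu (cut W f) (cut W g).
Proof.
apply: eq_complex_integral => x _; rewrite /cut rmorphM /=.
have -> : ((\1_W x : R)%:C)^* = (\1_W x : R)%:C by exact: conjc_real.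
rewrite indicE; case: (x \in W) => /=; first by rewrite !rmorph1 !mulr1.
by rewrite !rmorph0 !mulr0 mul0r.
Qed.

Lemma cover_sqnorm_eq0 (W : nat -> set T) f : (forall n, measurable (W n)) ->
  trivIset [set: nat] W -> \bigcup_n W n = [set: T] -> L2 f ->
  (forall n, nrm2 mu [set: T] (cut (W n) f) = 0) -> sqnorm mu f = 0%E.
Proof.
move=> mW tW cW Lf cut0.
have mf : measurable_fun [set: T] (fun x => (Normc.normc (f x) ^+ 2)%:E).
  by apply/measurable_EFinP; exact: (measurable_nsq Lf.1).
rewrite /sqnorm /sqnorm_on -cW ge0_integral_bigcup//=; last 2 first.
- by rewrite cW.
- by move=> x _; rewrite lee_fin nsq_ge0.
rewrite eseries0// => n _ _; rewrite integral_mkcond.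
have <- : sqnorm mu (cut (W n) f) = 0%E.
  by rewrite /sqnorm (L2on_nrm2 (cut_L2 (mW n) Lf)) cut0.
apply: eq_integral => x _; rewrite -/(nsq _) nsq_cut patchE indicE.
by case: (x \in W n); rewrite ?mul1r ?mul0r.
Qed.

End Cut.

Section Uniqueness.
Context {R : realType} {K : topologicalFieldType} {p c : nat}.
Variables (mu : {measure set (borel K) -> \bar R}) (abs : K -> R) (varpi : K)
  (eps : 'I_c -> K) (chi : K -> R[i]).
Hypothesis S : normalized_local_field p mu abs varpi eps chi.
Local Notation q := (p ^ c)%N.
Local Notation u := (coset_rep p varpi eps).
Local Notation norm2 := (nrm2 cnt [set: nat]).
Local Notation L2 := (square_integrable mu).
Local Notation dilate := (dilate (p := p) varpi eps).
Implicit Types f g : borel K -> R[i].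

Definition coset_O (t : K) : set (borel K) := [set x | integers abs ((x : K) - t)].

Lemma coset_O_measurable t : measurable (coset_O t).
Proof.
have := continuous_measurable_borel (@addl_continuous K (- t)) (@measurableT _ (borel K))
  (nlf_measurableO S).
rewrite setTI (_ : _ @^-1` _ = coset_O t)//.
by apply/seteqP; split => x /=; rewrite /coset_O /= addrC.
Qed.

Lemma coset_O_disjoint t m n x : coset_O (t - u m) x -> coset_O (t - u n) x -> m = n.
Proof.
rewrite /coset_O /= => xm xn; have h := nlf_OB S xm xn.
have [k uk] := nlf_u_sub S m n.
have k0 : k = 0%N.
  apply: (nlf_u_notO S); rewrite uk.
  rewrite (_ : u m - u n = (x : K) - (t - u m) - ((x : K) - (t - u n)))//.
  by ring.
by apply: (nlf_u_inj S); apply/eqP; rewrite -subr_eq0 -uk k0 (nlf_u0 S).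
Qed.

(** On the coset t + O the translate of g by u(m) only sees g on the coset
    t - u(m) + O.  These cosets are disjoint, so by Cauchy-Schwarz the squared
    coefficients add up to at most |f|^2 |g|^2. *)
Lemma translates_bessel t f g : L2 f -> L2 g ->
  l2 (fun m => inner mu (cut (coset_O t) f) (translate (u m) g)).
Proof.
move=> Lf Lg; apply/l2P.
have Lcf : L2 (cut (coset_O t) f) by apply: cut_L2 => //; exact: coset_O_measurable.
have Ltg m : L2 (translate (u m) g) by exact: (translate_L2 S).
have Lcg m : L2 (cut (coset_O (t - u m)) g) by apply: cut_L2 => //; exact: coset_O_measurable.
have cut_translate m : cut (coset_O t) (translate (u m) g) = translate (u m) (cut (coset_O (t - u m)) g).
  apply/funext => x; rewrite /cut /translate; congr (_ * (_ %:R)%:C).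
  congr (nat_of_bool _); apply/idP/idP; rewrite !inE /coset_O /=.
    by rewrite opprB addrA subrK.
  by rewrite opprB addrA subrK.
apply: (@le_lt_trans _ _ (nrm2 mu setT (cut (coset_O t) f) * nrm2 mu setT g)%:E); last exact: ltry.
apply: sqn_le => M.
apply: (@le_trans _ _ (\sum_(m < M) nrm2 mu setT (cut (coset_O t) f) *
    nrm2 mu setT (cut (coset_O (t - u m)) g))).
  apply: ler_sum => m _; rewrite inner_cut.
  apply: le_trans (cauchy_schwarz measurableT Lcf _) _.
    by apply: cut_L2 => //; exact: coset_O_measurable.
  rewrite ler_wpM2l ?nrm2_ge0// cut_translate le_eqVlt; apply/orP; left; apply/eqP.
  exact: (congr1 fine (translate_sqnorm S (u m) (Lcg m).1)).
rewrite -mulr_sumr ler_wpM2l ?nrm2_ge0//.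
have := @ae_le_sum_nrm2 R _ (borel K) mu setT 'I_M unit
  (fun m => cut (coset_O (t - u m)) g) (fun=> g) 1 1 measurableT ler01 ler01
  (fun m => Lcg m) (fun=> Lg).
rewrite !mul1r (eq_bigl (pred1 tt)) ?big_pred1_eq; last by case.
apply; apply: aeW => x; rewrite !mul1r (eq_bigl (pred1 tt)) ?big_pred1_eq; last by case.
have [[m0 m0x]|nx] := pselect (exists m : 'I_M, coset_O (t - u m) x).
  rewrite (bigD1 m0) //= big1 ?addr0.
    by rewrite nsq_cut ler_piMl ?nsq_ge0// indicE; case: (x \in _).
  move=> m mm0; rewrite nsq_cut indicE memNset ?mul0r// => mx.
  by move: mm0; rewrite -val_eqE /= (coset_O_disjoint mx m0x) eqxx.
rewrite big1 ?nsq_ge0// => m _; rewrite nsq_cut indicE memNset ?mul0r// => mx.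
by apply: nx; exists m.
Qed.

Variable N : nat.
Variable a : 'I_q -> 'I_N -> 'I_N -> nat -> R[i].
Hypothesis a_l2 : forall r l j, l2 (a r l j).
Variable lambda : R.
Hypothesis lambda_gt0 : 0 < lambda.
Hypothesis filter_lower : forall b : 'I_N -> nat -> R[i], (forall j, l2 (b j)) ->
  lambda * (\sum_j norm2 (b j)) <= \sum_r \sum_l norm2 (filter_out S a b r l).

Let q_gt0 : 0 < q%:R :> R. Proof. by rewrite ltr0n (nlf_q_gt0 S). Qed.

(** Test against f, a dilate of the restriction of F_i to a coset of the integers.
    Its coefficients are square summable by [translates_bessel] and T maps them
    to 0, so they vanish; one of them is |F_i|^2 over the coset, up to a
    factor. *)
Lemma refines_null (F : 'I_N -> borel K -> R[i]) : (forall j, L2 (F j)) ->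
  (forall s, refines mu p varpi eps (a s) F (fun _ _ => 0)) ->
  forall i, sqnorm mu (F i) = 0%E.
Proof.
move=> LF F0 i.
apply: (cover_sqnorm_eq0 (W := fun n => coset_O (u n))) => //.
- by move=> n; exact: coset_O_measurable.
- move=> m n _ _ [x [xm xn]].
  apply: (nlf_u_inj S); have [k uk] := nlf_u_sub S n m.
  have k0 : k = 0%N.
    apply: (nlf_u_notO S); rewrite uk (_ : u n - u m = (x : K) - u m - ((x : K) - u n)); last by ring.
    exact: (nlf_OB S).
  by apply/esym/eqP; rewrite -subr_eq0 -uk k0 (nlf_u0 S).
- apply/seteqP; split => // x _; have [n xn] := nlf_cover S x.
  by exists n.
move=> n; pose W := coset_O (u n).
have mW : measurable W by exact: coset_O_measurable.
pose g := cut W (F i); have Lg : L2 g by exact: cut_L2.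
pose f := dilate 0 g; have Lf : L2 f by exact: (dilate_L2 S).
have coefE j m : nsq (refine_coef (p := p) mu varpi eps F f j m) =
    q%:R^-1 * nsq (inner mu g (translate (u m) (F j))).
  exact: (refine_coef_dilate S m Lg (LF j)).
have Lb j : l2 (refine_coef (p := p) mu varpi eps F f j).
  have inv_q : 0 <= q%:R^-1 :> R by rewrite invr_ge0.
  exact: (l2_scaled inv_q (coefE j) (translates_bessel (u n) (LF i) (LF j))).1.
have T0 s l : norm2 (filter_out S a (refine_coef (p := p) mu varpi eps F f) s l) = 0.
  rewrite (_ : filter_out _ _ _ _ _ = fun=> 0).
    rewrite /nrm2 -/(sqn (fun=> 0)) (sqn_finite (M := 0))//.
    by rewrite big_ord0.
  apply/funext => k; rewrite /filter_out.
  have L0 : L2 (fun=> 0) by exact: L2on0.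
  have := @refined_coef _ _ _ _ _ _ _ _ _ S N (a s) F (fun _ _ => 0) (a_l2 s) LF (fun _ => L0)
    (F0 s) f Lf Lb l k.
  move=> <-; rewrite (_ : translate _ _ = fun=> 0)//.
  have -> : inner mu f (fun=> 0) = 0 by exact: (ip0r measurableT Lf).
  exact: rmorph0.
have := filter_lower Lb.
rewrite [leRHS]big1 => [|s _]; last by rewrite big1.
rewrite pmulr_rle0// => b0.
have bi0 : norm2 (refine_coef (p := p) mu varpi eps F f i) = 0.
  apply/eqP; rewrite eq_le nrm2_ge0 andbT; apply: le_trans b0.
  by rewrite (bigD1 i) //= lerDl sumr_ge0// => j _; exact: nrm2_ge0.
have : nsq (refine_coef (p := p) mu varpi eps F f i 0) = 0.
  apply/eqP; rewrite eq_le nsq_ge0 andbT -bi0.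
  rewrite -lee_fin -(L2on_nrm2 (Lb i)); have := sqn_partial (refine_coef (p := p) mu varpi eps F f i) 1.
  by rewrite big_ord1.
rewrite coefE => /eqP; rewrite mulf_eq0 invr_eq0 (gt_eqF q_gt0) /= => /eqP/nsq_eq0.
rewrite (_ : translate (u 0) (F i) = F i); last first.
  by apply/funext => x; rewrite /translate (nlf_u0 S) subr0.
rewrite inner_cut -/g => gg.
by apply: (@complexI R); rewrite -(ip_self measurableT Lg).
Qed.

(** Refinement is linear, so that [refines_null] applies to the difference. *)
Lemma refines_unique (F F' : 'I_N -> borel K -> R[i]) (G : 'I_q -> 'I_N -> borel K -> R[i]) :
  (forall j, L2 (F j)) -> (forall j, L2 (F' j)) -> (forall s l, L2 (G s l)) ->
  (forall s, refines mu p varpi eps (a s) F (G s)) ->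
  (forall s, refines mu p varpi eps (a s) F' (G s)) ->
  forall j, sqnorm mu (fun x => F j x - F' j x) = 0%E.
Proof.
move=> LF LF' LG FG F'G; apply: refines_null.
  by move=> j; exact: (L2onB measurableT (LF j) (LF' j)).
move=> s l.
have mpart (H : 'I_N -> borel K -> R[i]) n : (forall j, L2 (H j)) ->
    complex_measurable (fun x : borel K => \sum_(j < N) \sum_(k < n)
      (Num.sqrt (q%:R : R))%:C * a s l j k * H j (varpi^-1 * (x : K) - u k)).
  move=> LH; apply: complex_measurable_sum => j; apply: complex_measurable_sum => m.
  apply: complex_measurableM; first exact: complex_measurable_cst.
  exact: (dilate_L2 S m (LH j)).1.
have c2 := L2_cvgZ measurableT (-1) (fun n => mpart F' n LF') (LG s l).1 (F'G s l).
have mN (h : borel K -> R[i]) : complex_measurable h -> complex_measurable (fun x => -1 * h x).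
  by move=> mh; apply: complex_measurableM => //; exact: complex_measurable_cst.
have := L2_cvgD measurableT (fun n => mpart F n LF) (LG s l).1
  (fun n => mN _ (mpart F' n LF')) (mN _ (LG s l).1) (FG s l) c2.
apply: eq_L2_cvg => [n x|x]; last by rewrite mulN1r subrr.
rewrite mulN1r -sumrB; apply: eq_bigr => j _; rewrite -sumrB; apply: eq_bigr => m _.
by rewrite mulrBr.
Qed.

End Uniqueness.

(** * The packet frames *)
Section PacketFrames.
Context {R : realType} {K : topologicalFieldType} {p c : nat}.
Variables (mu : {measure set (borel K) -> \bar R}) (abs : K -> R) (varpi : K)
  (eps : 'I_c -> K) (chi : K -> R[i]).
Hypothesis S : normalized_local_field p mu abs varpi eps chi.
Local Notation q := (p ^ c)%N.
Local Notation u := (coset_rep p varpi eps).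
Local Notation norm2 := (nrm2 cnt [set: nat]).
Local Notation L2 := (square_integrable mu).
Implicit Types f g : borel K -> R[i].

Variable N : nat.
Variable a : 'I_q -> 'I_N -> 'I_N -> nat -> R[i].
Hypothesis a_l2 : forall r l j, l2 (a r l j).
Variables lambda Lambda : R.
Hypothesis lambda_gt0 : 0 < lambda.
Hypothesis lambda_Lambda : lambda <= Lambda.
Hypothesis filter_frame : forall b : 'I_N -> nat -> R[i], (forall j, l2 (b j)) ->
  [/\ forall r l, l2 (filter_out S a b r l),
      lambda * (\sum_j norm2 (b j)) <= \sum_r \sum_l norm2 (filter_out S a b r l)
    & \sum_r \sum_l norm2 (filter_out S a b r l) <= Lambda * (\sum_j norm2 (b j))].

Variable phi : 'I_N -> borel K -> R[i].
Hypothesis phi_L2 : forall l, L2 (phi l).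
Local Notation V0 := (closed_linear_span mu (translates p varpi eps phi)).
Variables C1 C2 : R.
Hypothesis phi_frame : frame_with_bounds mu (translates p varpi eps phi) V0 C1 C2.
Variable psi : nat -> 'I_N -> borel K -> R[i].
Hypothesis psi_packets : wavelet_frame_packets mu p varpi eps a phi psi.

Let psi_L2 := packet_L2 psi_packets.
Let q_gt0 : 0 < q%:R :> R. Proof. by rewrite ltr0n (nlf_q_gt0 S). Qed.
Let Lambda_ge0 : 0 <= Lambda.
Proof. exact: le_trans (ltW lambda_gt0) lambda_Lambda. Qed.

(** Both phi and psi^0 refine to the psi^s with s < q. *)
Lemma packet0 l : sqnorm mu (fun x => phi l x - psi 0 l x) = 0%E.
Proof.
have lower b (Lb : forall j, l2 (b j)) : lambda * (\sum_j norm2 (b j)) <=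
    \sum_r \sum_l norm2 (filter_out S a b r l).
  by have [] := filter_frame Lb.
have rec0 (s : 'I_q) : refines mu p varpi eps (a s) (psi 0) (psi s).
  by have := packet_rec psi_packets 0 s; rewrite muln0 addn0.
exact: (refines_unique a_l2 lambda_gt0 lower phi_L2 (psi_L2 0)
  (fun s : 'I_q => psi_L2 s) (packet_start psi_packets) rec0 l).
Qed.

Definition packet_coef f n l (k : nat) : R[i] := inner mu f (translate (u k) (psi n l)).

Let packet_coef0 f l k : L2 f -> packet_coef f 0 l k = inner mu f (translate (u k) (phi l)).
Proof.
move=> Lf; have Lp := translate_L2 S (u k) (phi_L2 l); have Ls := translate_L2 S (u k) (psi_L2 0 l).
apply/esym/eqP; rewrite -subr_eq0 -(ipBr measurableT Lf Lp Ls); apply/eqP/nsq_eq0.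
have Ld := L2onB measurableT Lp Ls.
apply/eqP; rewrite eq_le nsq_ge0 andbT.
apply: le_trans (cauchy_schwarz measurableT Lf Ld) _.
have LD := L2onB measurableT (phi_L2 l) (psi_L2 0 l).
rewrite (_ : nrm2 mu _ (fun x => _ - _) = 0) ?mulr0//.
exact: (congr1 fine (etrans (translate_sqnorm S (u k) LD.1) (packet0 l))).
Qed.

Let exp0E f : (fun x : borel K => f (varpi ^+ 0 * (x : K) : K)) = f.
Proof. by apply/funext => x; rewrite expr0 mul1r. Qed.

Definition packet_sum f M : R := \sum_(n < M) \sum_(l < N) norm2 (packet_coef f n l).

(** The induction step splits n = s + q r: for each r the coefficients for the q
    values of s are the output of the filter on the coefficients for r.  The
    factor 1/q between these inputs and the coefficients of g = f(varpi x) cancels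
    the factor q between |g|^2 and |f|^2. *)
Lemma packet_bounds j f : dilated_space mu varpi V0 j f ->
  [/\ forall n l, (n < q ^ j)%N -> l2 (packet_coef f n l),
      lambda ^+ j * C1 * nrm2 mu setT f <= packet_sum f (q ^ j)
    & packet_sum f (q ^ j) <= Lambda ^+ j * C2 * nrm2 mu setT f].
Proof.
elim: j f => [|j ih] f [Lf Vf].
  rewrite exp0E in Vf; have [_ _ /(_ f Vf)] := phi_frame.
  rewrite esum_fin_prod; last by move=> i; rewrite lee_fin nsq_ge0.
  have E l : (\esum_(k in [set: nat])
      (Normc.normc (inner mu f (translates p varpi eps phi (l, k))) ^+ 2)%:E =
      sqn (packet_coef f 0 l))%E.
    rewrite sqnE; apply: eq_esum => k _; rewrite -/(nsq _); congr (nsq _)%:E.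
    by rewrite packet_coef0.
  under eq_bigr do rewrite E.
  rewrite /sqnorm (L2on_nrm2 Lf) => -[h1 h2].
  have L0 l : l2 (packet_coef f 0 l).
    apply/l2P; apply: le_lt_trans (ltry (C2 * nrm2 mu setT f)).
    rewrite EFinM; apply: le_trans h2; rewrite (bigD1 l) //= leeDl//.
    by apply: sume_ge0 => i _; exact: sqnorm_on_ge0.
  have sE : (\sum_(l < N) sqn (packet_coef f 0 l))%E = (packet_sum f 1)%:E.
    rewrite /packet_sum big_ord1 -sumEFin; apply: eq_bigr => l _.
    exact: (L2on_nrm2 (L0 l)).
  rewrite expn0 !expr0 !mul1r; split.
  - by move=> [|n] l // _.
  - by rewrite -lee_fin -sE EFinM.
  - by rewrite -lee_fin -sE EFinM.
have Lg := undilate_L2 S Lf; pose g := undilate varpi f.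
have Vg : dilated_space mu varpi V0 j g.
  split; first exact: Lg.
  rewrite (_ : (fun x => _) = (fun x : borel K => f (varpi ^+ j.+1 * (x : K) : K)))//.
  by apply/funext => x; rewrite /g /undilate mulrA -exprS.
have [gl2 glow gup] := ih g Vg.
pose b r := refine_coef (p := p) mu varpi eps (psi r) f.
have bE r i m : nsq (b r i m) = q%:R^-1 * nsq (packet_coef g r i m).
  rewrite /b -(undilateK S f); exact: (refine_coef_dilate S m Lg (psi_L2 r i)).
have inv_q : 0 <= q%:R^-1 :> R by rewrite invr_ge0 ltW.
have bP r i (rj : (r < q ^ j)%N) := l2_scaled inv_q (bE r i) (gl2 r i rj).
have cE r (s : 'I_q) l k : (r < q ^ j)%N ->
    nsq (packet_coef f (s + q * r) l k) = 1 * nsq (filter_out S a (b r) s l k).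
  move=> rj; rewrite mul1r /filter_out.
  rewrite -(refined_coef S (a_l2 s) (psi_L2 r) (psi_L2 (s + q * r))
    (packet_rec psi_packets r s) Lf (fun i => (bP r i rj).1) l k).
  by rewrite nsqJ.
have cP r (s : 'I_q) l (rj : (r < q ^ j)%N) :
    l2 (packet_coef f (s + q * r) l) /\
    norm2 (packet_coef f (s + q * r) l) = norm2 (filter_out S a (b r) s l).
  have [Lout _ _] := filter_frame (fun i => (bP r i rj).1).
  have [h1 h2] := l2_scaled ler01 (fun k => cE r s l k rj) (Lout s l).
  by split => //; rewrite h2 mul1r.
have sumE : packet_sum f (q ^ j.+1) =
    \sum_(r < q ^ j) \sum_(s < q) \sum_(l < N) norm2 (filter_out S a (b r) s l).
  rewrite /packet_sum expnS (sum_ord_mul q (q ^ j) (fun n => \sum_(l < N) norm2 (packet_coef f n l))).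
  apply: eq_bigr => r _; apply: eq_bigr => s _; apply: eq_bigr => l _.
  exact: (cP r s l (ltn_ord r)).2.
have bsum : \sum_(r < q ^ j) \sum_i norm2 (b r i) = q%:R^-1 * packet_sum g (q ^ j).
  rewrite /packet_sum mulr_sumr; apply: eq_bigr => r _; rewrite mulr_sumr.
  by apply: eq_bigr => i _; exact: (bP r i (ltn_ord r)).2.
have gf : nrm2 mu setT g = q%:R * nrm2 mu setT f.
  apply: EFin_inj; rewrite EFinM -(L2on_nrm2 Lg) -(L2on_nrm2 Lf).
  exact: (undilate_sqnorm S Lf.1).
split.
- move=> n l; rewrite expnS => nq.
  have rj : (n %/ q < q ^ j)%N by rewrite ltn_divLR ?(nlf_q_gt0 S)// mulnC.
  have sq : (n %% q < q)%N by rewrite ltn_mod (nlf_q_gt0 S).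
  have := (cP _ (Ordinal sq) l rj).1.
  by rewrite /= addnC mulnC -divn_eq.
- rewrite sumE; apply: (@le_trans _ _ (lambda * (\sum_(r < q ^ j) \sum_i norm2 (b r i)))).
    rewrite bsum exprS -!mulrA ler_wpM2l ?(ltW lambda_gt0)// ler_pdivlMl//.
    apply: le_trans glow; rewrite gf.
    by rewrite le_eqVlt; apply/orP; left; apply/eqP; ring.
  rewrite mulr_sumr; apply: ler_sum => r _.
  by have [_ + _] := filter_frame (fun i => (bP r i (ltn_ord r)).1).
- rewrite sumE; apply: (@le_trans _ _ (Lambda * (\sum_(r < q ^ j) \sum_i norm2 (b r i)))).
    rewrite mulr_sumr; apply: ler_sum => r _.
    by have [_ _] := filter_frame (fun i => (bP r i (ltn_ord r)).1).
  rewrite bsum exprS -!mulrA ler_wpM2l// ler_pdivrMl//.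
  apply: le_trans gup _; rewrite gf.
  by rewrite le_eqVlt; apply/orP; left; apply/eqP; ring.
Qed.

Let phi_tr_L2 i : L2 (translates p varpi eps phi i).
Proof. exact: (translate_L2 S (u i.2) (phi_L2 i.1)). Qed.

(** Rescaled by varpi^(j+1), the refinement equation for n = s + q r expresses the
    translate by u(k) as a limit of combinations of translates of psi^r rescaled
    by varpi^j, which lie in the closed span by induction. *)
Lemma packet_in_space j n l k : (n < q ^ j)%N ->
  V0 (fun x : borel K => psi n l (varpi ^+ j * (x : K) - u k : K)).
Proof.
elim: j n l k => [|j ih] n l k nq.
  have -> : n = 0%N by move: nq; rewrite expn0; case: n.
  rewrite (exp0E (translate (u k) (psi 0 l))).
  have Lp := translate_L2 S (u k) (phi_L2 l); have Ls := translate_L2 S (u k) (psi_L2 0 l).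
  apply: (closed_span_ae (x := translates p varpi eps phi) phi_tr_L2 (f := translate (u k) (phi l))) => //.
    apply: closed_span_linear_span => //; exists [:: (1, (l, k))].
    by apply/funext => x; rewrite big_seq1 mul1r.
  have LD := L2onB measurableT (phi_L2 l) (psi_L2 0 l).
  have := translate_sqnorm S (u k) LD.1; rewrite packet0 => h.
  by rewrite -[RHS]h; apply: eq_sqnorm_on => x _; rewrite -nsqN opprB.
have rj : (n %/ q < q ^ j)%N by rewrite ltn_divLR ?(nlf_q_gt0 S)// mulnC -expnS.
have sq : (n %% q < q)%N by rewrite ltn_mod (nlf_q_gt0 S).
pose r := (n %/ q)%N; pose s := Ordinal sq.
have nE : n = (s + q * r)%N by rewrite addnC mulnC -divn_eq.
have v0 : varpi ^+ j.+1 != 0 by rewrite expf_neq0// (nlf_varpi0 S).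
pose scl (w : borel K -> R[i]) : borel K -> R[i] :=
  fun x => w (varpi ^+ j.+1 * (x : K) + 0 : K).
have scl_cvg (F : nat -> borel K -> R[i]) w : (forall m, complex_measurable (F m)) ->
    complex_measurable w -> L2_cvg_on mu [set: borel K] F w ->
    L2_cvg_on mu [set: borel K] (fun m => scl (F m)) (scl w).
  move=> mF mw Fw; rewrite /L2_cvg_on.
  have -> : (fun m => sqnorm_on mu setT (fun x => scl (F m) x - scl w x)) =
     (fun m => (abs (varpi ^+ j.+1))^-1%:E * sqnorm_on mu setT (fun x => F m x - w x)%R)%E.
    by apply/funext => m; rewrite -(affine_sqnorm S 0 v0 (complex_measurableB (mF m) mw)).
  have -> : (0 = (abs (varpi ^+ j.+1))^-1%:E * 0 :> \bar R)%E by rewrite mule0.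
  exact: cvgeZl.
have rec := packet_rec psi_packets r s.
have Ldil m i : L2 (dilate (p := p) varpi eps m (psi r i)) by exact: (dilate_L2 S).
have Lpart m : L2 (fun x : borel K => \sum_(i < N) \sum_(k' < m)
   (Num.sqrt (q%:R : R))%:C * a s l i k' * psi r i (varpi^-1 * (x : K) - u k')).
  apply: (L2on_sum measurableT) => i; apply: (L2on_sum measurableT) => m'.
  exact: (L2onZ measurableT _ (Ldil m' i)).
have cv := refined_cvg S (psi_L2 r) (psi_L2 (s + q * r)) rec l (u k).
have mpart m := (translate_L2 S (u k) (Lpart m)).1.
have cvs := scl_cvg _ _ mpart (translate_L2 S (u k) (psi_L2 (s + q * r) l)).1 cv.
rewrite (_ : (fun x => _) = scl (translate (u k) (psi (s + q * r) l))); last first.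
  by apply/funext => x; rewrite /scl /translate addr0 nE.
apply: (closed_span_limit (x := translates p varpi eps phi) phi_tr_L2 _ _ cvs).
  move=> m; rewrite (_ : scl _ = (fun x : borel K => \sum_(i < N) \sum_(k' < m)
      (Num.sqrt (q%:R : R))%:C * a s l i k' *
        psi r i (varpi ^+ j * (x : K) - u (addu S (q * k) k')))).
    apply: closed_span_sum => // i; apply: closed_span_sum => // k'.
    by apply: closed_spanZ => //; exact: ih.
  apply/funext => x; rewrite /scl /translate; apply: eq_bigr => i _; apply: eq_bigr => k' _.
  congr (_ * psi r i _); rewrite adduE (nlf_u_shift S) addr0 exprS.
  by field; exact: (nlf_varpi0 S).
exact: (affine_square_integrable S 0 v0 (translate_L2 S (u k) (psi_L2 (s + q * r) l))).
Qed.

Theorem packet_frame j : frame_with_bounds mu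
  (translates p varpi eps (fun i : 'I_(q ^ j) * 'I_N => psi i.1 i.2))
  (dilated_space mu varpi V0 j) (lambda ^+ j * C1) (Lambda ^+ j * C2).
Proof.
have [_ /andP[C10 C12] _] := phi_frame.
split.
- move=> [[n l] k]; split; first exact: (translate_L2 S (u k) (psi_L2 n l)).
  exact: packet_in_space.
- rewrite mulr_gt0 ?exprn_gt0//=; apply: ler_pM => //.
  + by rewrite exprn_ge0// ltW.
  + exact: ltW.
  + by rewrite lerXn2r// nnegrE ltW.
move=> f Vf; have Lf : L2 f := Vf.1.
have [fl2 flow fup] := packet_bounds Vf.
have -> : (\esum_(i in [set: ('I_(q ^ j) * 'I_N) * nat])
    (Normc.normc (inner mu f (translates p varpi eps
       (fun i : 'I_(q ^ j) * 'I_N => psi i.1 i.2) i)) ^+ 2)%:E =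
    (packet_sum f (q ^ j))%:E)%E.
  rewrite esum_fin_prod; last by move=> i; rewrite lee_fin nsq_ge0.
  rewrite /packet_sum pair_bigA /= -sumEFin; apply: eq_bigr => -[n l] _ /=.
  by rewrite -(L2on_nrm2 (fl2 n l (ltn_ord n))) -/(sqn _) sqnE.
by rewrite /sqnorm (L2on_nrm2 Lf) -!EFinM !lee_fin.
Qed.

End PacketFrames.

Local Open Scope complex_scope.

Theorem theorem3 (R : realType) (K : topologicalFieldType) (p c N : nat)
  (mu : {measure set (borel K) -> \bar R}) (abs : K -> R)
  (varpi : K) (eps : 'I_c -> K) (chi : K -> R[i])
  (K_local : local_field K) (K_char : p \in [pchar K])
  (mu_haar : haar_measure mu) (abs_modulus : modulus mu abs)
  (mu_normalized : mu (integers abs) = 1%E)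
  (varpi_prime : prime_element abs varpi)
  (K_residue : residue_field_card abs (p ^ c))
  (eps_basis : residue_basis abs (p ^ c) eps)
  (chi_standard : standard_character p varpi eps chi)
  (N_gt0 : (0 < N)%N)
  (phi : 'I_N -> borel K -> R[i])
  (phi_L2 : forall l, square_integrable mu (phi l))
  (C1 C2 : R)
  (phi_frame : frame_with_bounds mu (translates p varpi eps phi)
     (closed_linear_span mu (translates p varpi eps phi)) C1 C2)
  (a : 'I_(p ^ c) -> 'I_N -> 'I_N -> nat -> R[i])
  (a_l2 : forall r l j, square_summable (a r l j))
  (h : 'I_(p ^ c) -> 'I_N -> 'I_N -> borel K -> R[i])
  (h_symbol : forall r l j, fourier_symbol mu p varpi eps chi (a r l j) (h r l j))
  (h_bounded : forall i k,
     complex_measurable (fun xi : borel K => block_symbol_mx p varpi eps h xi i k) /\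
     exists M : R, \forall xi \ae mu,
       Normc.normc (block_symbol_mx p varpi eps h xi i k) <= M)
  (lambda Lambda : R)
  (lambda_inf : ess_inf mu (fun xi : borel K =>
     let H := block_symbol_mx p varpi eps h xi in
     (min_eigenvalue ((H ^t*)%sesqui *m H))%:E) = lambda%:E)
  (Lambda_sup : ess_sup mu (fun xi : borel K =>
     let H := block_symbol_mx p varpi eps h xi in
     (max_eigenvalue ((H ^t*)%sesqui *m H))%:E) = Lambda%:E)
  (lambda_Lambda : 0 < lambda <= Lambda)
  (psi : nat -> 'I_N -> borel K -> R[i])
  (psi_packets : wavelet_frame_packets mu p varpi eps a phi psi) :
  forall j : nat,
    frame_with_bounds mu
      (translates p varpi eps
         (fun i : 'I_((p ^ c) ^ j) * 'I_N => psi i.1 i.2))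
      (dilated_space mu varpi
         (closed_linear_span mu (translates p varpi eps phi)) j)
      (lambda ^+ j * C1) (Lambda ^+ j * C2).
Proof.
have S : normalized_local_field p mu abs varpi eps chi by split.
have a_l2' r l j : l2 (a r l j) by apply/l2P; rewrite sqnE; exact: a_l2.
have /andP[lambda_gt0 lambda_le] := lambda_Lambda.
have lambda_ge0 := ltW lambda_gt0.
have Lambda_ge0 := le_trans lambda_ge0 lambda_le.
have block_bounds : \forall xi \ae mu, forall v,
    let H := block_symbol_mx p varpi eps h xi in
    lambda * cnorm2 v <= cnorm2 (H *m v) <= Lambda * cnorm2 v.
  have := ess_inf_le mu (fun xi : borel K => (min_eigenvalue
    ((block_symbol_mx p varpi eps h xi ^t*)%sesqui *m block_symbol_mx p varpi eps h xi))%:E).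
  have := ess_sup_ge mu (fun xi : borel K => (max_eigenvalue
    ((block_symbol_mx p varpi eps h xi ^t*)%sesqui *m block_symbol_mx p varpi eps h xi))%:E).
  move: lambda_inf Lambda_sup => /= -> ->.
  apply: (@filterS2 _ _ (ae_filter_ringOfSetsType mu)) => xi.
  rewrite !lee_fin => hmax hmin v /=.
  have /andP[lo hi] := gram_bounds (block_symbol_mx p varpi eps h xi) v.
  have v0 : 0 <= cnorm2 v by apply: sumr_ge0 => i _; exact: nsq_ge0.
  apply/andP; split.
    by apply: le_trans lo; rewrite ler_wpM2r.
  by apply: le_trans hi _; rewrite ler_wpM2r.
move=> j; apply: (packet_frame a_l2' lambda_gt0 lambda_le _ phi_L2 phi_frame psi_packets (S := S)).
move=> b Lb.
have [lo hi] := filter_out_bounds S h_symbol a_l2' lambda_ge0 Lambda_ge0 block_bounds Lb.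
split => // r l.
exact: (filter_out_l2 S h_symbol a_l2' lambda_ge0 Lambda_ge0 block_bounds Lb).
Qed.
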